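(* Over polytopes with $n$ vertices, the maximum number of combinatorially distinct cut trees consisting only of polytope edges (edge-unfolding cut trees) is $2^{O(n)}$, and the maximum number of (arbitrary) combinatorially distinct cut trees is $2^{O(n^2)}$.
   Context: A polytope is a convex polyhedron. A geometric cut tree $\mathcal{T}_C$ for $Q$ is a tree drawn on $\partial Q$, each arc a polygonal path, such that cutting $\partial Q$ along $\mathcal{T}_C$ and flattening $\partial Q\setminus\mathcal{T}_C$ into the plane yields a simple polygon; an edge-unfolding cut tree is one consisting of edges of $Q$. The combinatorial cut tree $T_C$ of $\mathcal{T}_C$ is the labeled graph with a node for each point of $\mathcal{T}_C$ of degree not equal to 2 and a node for each point of $\mathcal{T}_C$ at a vertex of $Q$ (labeled by that vertex); arcs are the polygonal paths of $\mathcal{T}_C$ connecting these nodes. Cut trees are combinatorially distinct when their combinatorial cut trees differ as labeled trees. *)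

(* Defs.v *)
From HB Require Import structures.
From mathcomp Require Import all_boot all_order all_algebra.
From mathcomp Require Import all_classical all_reals all_analysis.
Set Implicit Arguments. Unset Strict Implicit. Unset Printing Implicit Defensive.
Import Order.TTheory GRing.Theory Num.Theory.
Import numFieldNormedType.Exports.
Local Open Scope classical_set_scope.
Local Open Scope ring_scope.

Section CutTrees.
Variable R : realType.
Local Notation P3 := 'rV[R]_3.
Local Notation P2 := 'rV[R]_2.

Definition dotp (m : nat) (u v : 'rV[R]_m) : R := \sum_(i < m) u 0 i * v 0 i.
Definition edist (m : nat) (u v : 'rV[R]_m) : R := Num.sqrt (dotp (u - v) (u - v)).

Definition segment (m : nat) (a b : 'rV[R]_m) : set 'rV[R]_m :=
  [set x | exists2 t : R, 0 <= t <= 1 & x = (1 - t) *: a + t *: b].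

Definition conv_hull (m : nat) (S : set 'rV[R]_m) : set 'rV[R]_m :=
  [set x | exists (k : nat) (w : 'I_k -> R) (p : 'I_k -> 'rV[R]_m),
     [/\ forall i, 0 <= w i, \sum_(i < k) w i = 1, forall i, S (p i)
       & x = \sum_(i < k) w i *: p i]].

Definition polytope_vertices (n : nat) (V : 'I_n -> P3) : Prop :=
  [/\ forall i j, V i = V j -> i = j,
      forall i, ~ conv_hull [set V j | j in [set j | j != i]] (V i)
    & interior (conv_hull (range V)) !=set0 ].

Definition hull (n : nat) (V : 'I_n -> P3) : set P3 := conv_hull (range V).
Definition bdry (Q : set P3) : set P3 := Q `\` interior Q.

Definition is_edge (n : nat) (V : 'I_n -> P3) (a b : P3) : Prop :=
  [/\ a != b, (exists i, a = V i), (exists j, b = V j) &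
      exists (c : P3) (d : R), (forall x, hull V x -> dotp c x <= d) /\
        [set x | hull V x /\ dotp c x = d] = segment a b].

Definition unit_itv : set R := [set t | 0 <= t <= 1].

Definition arc (S : set P3) (p q : P3) (g : R -> P3) : Prop :=
  [/\ {within unit_itv, continuous g},
      (forall s t, unit_itv s -> unit_itv t -> g s = g t -> s = t),
      g 0 = p, g 1 = q & g @` unit_itv `<=` S].

Definition has_loop (S : set P3) : Prop :=
  exists g : R -> P3,
    [/\ {within unit_itv, continuous g}, g 0 = g 1,
        (forall s t, 0 <= s < 1 -> 0 <= t < 1 -> g s = g t -> s = t)
      & g @` unit_itv `<=` S].

Definition polygonal_set (m : nat) (T : set 'rV[R]_m) : Prop :=
  exists (k : nat) (a b : 'I_k -> 'rV[R]_m),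
    T = \bigcup_(i in [set: 'I_k]) segment (a i) (b i).

Definition geometric_tree (T : set P3) : Prop :=
  [/\ polygonal_set T, T !=set0, connected T & ~ has_loop T].

Definition poly_side (m : nat) (q : nat -> P2) (i : nat) : set P2 :=
  segment (q i) (q (i.+1 %% m)%N).
Definition simple_closed_polygon (m : nat) (q : nat -> P2) : Prop :=
  [/\ (3 <= m)%N,
      (forall i j, (i < m)%N -> (j < m)%N -> q i = q j -> i = j) &
      (forall i j, (i < j)%N -> (j < m)%N ->
        if j == i.+1 then poly_side m q i `&` poly_side m q j = [set q j]
        else if (i == 0%N) && (j == m.-1) then
          poly_side m q i `&` poly_side m q j = [set q 0%N]
        else poly_side m q i `&` poly_side m q j = set0)].
Definition polygon_boundary (m : nat) (q : nat -> P2) : set P2 :=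
  \bigcup_(i in [set i | (i < m)%N]) poly_side m q i.

Definition simple_polygon_region (U : set P2) : Prop :=
  [/\ open U, connected U, bounded_set U &
      exists (m : nat) (q : nat -> P2),
        simple_closed_polygon m q /\ closure U `\` U = polygon_boundary m q].

(* geometric cut tree of Q = conv(V): a tree drawn on dQ such that cutting dQ
   along T and flattening dQ \ T into the plane (an injective, continuous map
   that is locally an isometry on the surface) yields a simple polygon. *)
Definition cut_tree (n : nat) (V : 'I_n -> P3) (T : set P3) : Prop :=
  let S := bdry (hull V) in
  [/\ T `<=` S, geometric_tree T &
    exists f : P3 -> P2,
      [/\ (forall x y, (S `\` T) x -> (S `\` T) y -> f x = f y -> x = y),
          {within S `\` T, continuous f},
          (forall x, (S `\` T) x -> exists2 r : R, 0 < r &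
             forall y z, (S `\` T) y -> (S `\` T) z ->
               edist x y < r -> edist x z < r -> segment y z `<=` S ->
               edist (f y) (f z) = edist y z)
        & simple_polygon_region (f @` (S `\` T))]].

Definition edge_cut_tree (n : nat) (V : 'I_n -> P3) (T : set P3) : Prop :=
  cut_tree V T /\
  exists (k : nat) (a b : 'I_k -> P3),
    (forall i, is_edge V (a i) (b i)) /\
    T = \bigcup_(i in [set: 'I_k]) segment (a i) (b i).

(* unit directions u such that T contains an initial piece of the ray p + t u;
   the degree of p in T is the number of such directions *)
Definition branch_dirs (T : set P3) (p : P3) : set P3 :=
  [set u | edist u 0 = 1 /\
           exists2 e : R, 0 < e & forall t, 0 < t <= e -> T (p + t *: u)].

Definition has_degree2 (T : set P3) (p : P3) : Prop :=
  exists u1 u2, u1 <> u2 /\ branch_dirs T p = [set u1] `|` [set u2].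

Definition ct_node (n : nat) (V : 'I_n -> P3) (T : set P3) (p : P3) : Prop :=
  T p /\ (~ has_degree2 T p \/ exists i, p = V i).

Definition ct_adj (n : nat) (V : 'I_n -> P3) (T : set P3) (p q : P3) : Prop :=
  p <> q /\ exists g, arc T p q g /\ forall t, 0 < t < 1 -> ~ ct_node V T (g t).

End CutTrees.

(* abstract finite labeled graph; labels are vertex indices (or none) *)
Record ltree (n : nat) := LTree {
  lt_size : nat;
  lt_adj : 'I_lt_size -> 'I_lt_size -> Prop;
  lt_lab : 'I_lt_size -> option 'I_n }.

Definition comb_tree_is (R : realType) (n : nat) (V : 'I_n -> 'rV[R]_3)
    (T : set 'rV[R]_3) (t : ltree n) : Prop :=
  exists s : 'I_(lt_size t) -> 'rV[R]_3,
    [/\ (forall i j, s i = s j -> i = j),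
        (forall i, ct_node V T (s i)),
        (forall p, ct_node V T p -> exists i, s i = p),
        (forall i j, ct_adj V T (s i) (s j) <-> @lt_adj n t i j) &
        (forall i k, @lt_lab n t i = Some k <-> s i = V k)].

(* Main.v *)
(* A cut tree made of edges is determined by a set of edges, so the first bound follows from
   a linear bound on the number of edges. For a generic height function, a vertex lies
   strictly between the lowest and the highest vertex of at most two facets: the plane
   section of the polytope at its height is convex and at most two of its sides issue from
   that vertex. Every edge is charged to such a pair (vertex, facet), and a pair is charged
   at most five times.

   For the second bound it is enough that a cut tree T has at most 2n nodes, since there are
   2^O(n^2) labeled graphs with that many nodes. As T has no loop and is connected, it has
   at most as many branch points as leaves, and all its leaves are vertices: near any other
   point the surface unfolds to a flat disc, so that at a leaf the unfolding would be a disc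
   slit along a radius, and the boundary of the polygon would have an end point. *)
Require Import Defs.
From HB Require Import structures.
From mathcomp Require Import all_boot all_order all_algebra.
From mathcomp Require Import all_classical all_reals all_analysis.
From mathcomp Require Import ring lra zify.
Import Defs.
Set Implicit Arguments. Unset Strict Implicit. Unset Printing Implicit Defensive.
Import Order.TTheory GRing.Theory Num.Theory.
Import numFieldNormedType.Exports.
Local Open Scope classical_set_scope.
Local Open Scope ring_scope.

(** * Euclidean vectors *)

(** Facets enter the edge count only as sets of vertices lying on a supporting plane, and the convex
    position of the vertices replaces any further facet structure. Two obstacles shape the second
    bound. A cut tree is given as a bare union of segments, which may overlap, cross or degenerate
    to points. It is redrawn as a straight-line graph whose edges meet only at nodes, so that
    absence of loops becomes acyclicity of a finite graph and the degrees sum to at most 2N - 2 for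
    N nodes. The unfolding is only assumed to preserve the distance of nearby points joined by a
    segment inside the surface, which says nothing about pairs on either side of an edge of the
    polytope. Near a point other than a vertex the surface is a pair of half planes with a common
    boundary line. Off the tree the unfolding is rigid on each of them and the two motions agree on
    the line; injectivity then excludes that one half is folded onto the other. The first bound also
    draws on the node count, which provides a finite labeled tree for each cut tree. *)

Section Dot.
Variables (R : realType) (m : nat).
Implicit Types (u v w : 'rV[R]_m) (a : R).

Lemma dotpC u v : dotp u v = dotp v u.
Proof. by rewrite /dotp; apply: eq_bigr => i _; rewrite mulrC. Qed.

Lemma dotpDr u v w : dotp u (v + w) = dotp u v + dotp u w.
Proof. by rewrite /dotp -big_split; apply: eq_bigr => i _; rewrite !mxE mulrDr. Qed.

Lemma dotpZr a u v : dotp u (a *: v) = a * dotp u v.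
Proof. by rewrite /dotp mulr_sumr; apply: eq_bigr => i _; rewrite !mxE mulrCA. Qed.

Lemma dotpNr u v : dotp u (- v) = - dotp u v.
Proof. by rewrite -scaleN1r dotpZr mulN1r. Qed.

Lemma dotpBr u v w : dotp u (v - w) = dotp u v - dotp u w.
Proof. by rewrite dotpDr dotpNr. Qed.

Lemma dotpDl u v w : dotp (u + v) w = dotp u w + dotp v w.
Proof. by rewrite !(dotpC _ w) dotpDr. Qed.

Lemma dotpZl a u v : dotp (a *: u) v = a * dotp u v.
Proof. by rewrite dotpC dotpZr dotpC. Qed.

Lemma dotpNl u v : dotp (- u) v = - dotp u v.
Proof. by rewrite dotpC dotpNr dotpC. Qed.

Lemma dotpBl u v w : dotp (u - v) w = dotp u w - dotp v w.
Proof. by rewrite dotpDl dotpNl. Qed.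

Lemma dotp0r u : dotp u 0 = 0.
Proof. by rewrite -(scale0r 0) dotpZr mul0r. Qed.

Lemma dotp0l u : dotp 0 u = 0.
Proof. by rewrite dotpC dotp0r. Qed.

Lemma dotp_sumr (I : Type) (r : seq I) (P : pred I) (F : I -> 'rV[R]_m) u :
  dotp u (\sum_(i <- r | P i) F i) = \sum_(i <- r | P i) dotp u (F i).
Proof. by apply: (big_morph (dotp u)) => [x y|]; [exact: dotpDr | exact: dotp0r]. Qed.

Lemma dotp_ge0 u : 0 <= dotp u u.
Proof. by rewrite /dotp sumr_ge0 // => i _; rewrite -expr2 sqr_ge0. Qed.

Lemma dotp_eq0 u : (dotp u u == 0) = (u == 0).
Proof.
apply/idP/eqP => [|->]; last by rewrite dotp0r.
rewrite /dotp psumr_eq0 => [/allP h|i _]; last by rewrite -expr2 sqr_ge0.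
apply/rowP => i; rewrite mxE; apply/eqP.
by have := h i (mem_index_enum _); rewrite /= mulf_eq0 orbb.
Qed.

Lemma dotp_gt0 u : (0 < dotp u u) = (u != 0).
Proof. by rewrite lt_neqAle dotp_ge0 andbT eq_sym dotp_eq0. Qed.

Definition dotpE := (dotpDl, dotpDr, dotpNl, dotpNr, dotpZl, dotpZr, dotp0l, dotp0r).

Definition enorm u := Num.sqrt (dotp u u).

Lemma edistE u v : edist u v = enorm (u - v). Proof. by []. Qed.

Lemma enorm_ge0 u : 0 <= enorm u. Proof. exact: sqrtr_ge0. Qed.

Lemma enorm_sqr u : enorm u ^+ 2 = dotp u u.
Proof. by rewrite sqr_sqrtr // dotp_ge0. Qed.

Lemma enorm_eq0 u : (enorm u == 0) = (u == 0).
Proof. by rewrite -dotp_eq0 -enorm_sqr expf_eq0. Qed.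

Lemma enorm_gt0 u : (0 < enorm u) = (u != 0).
Proof. by rewrite lt_neqAle enorm_ge0 andbT eq_sym enorm_eq0. Qed.

Lemma enorm0 : enorm 0 = 0 :> R. Proof. by apply/eqP; rewrite enorm_eq0. Qed.

Lemma enormZ a u : enorm (a *: u) = `|a| * enorm u.
Proof. by rewrite /enorm !dotpE mulrA -expr2 sqrtrM ?sqr_ge0 // sqrtr_sqr. Qed.

Lemma enormN u : enorm (- u) = enorm u.
Proof. by rewrite -scaleN1r enormZ normrN1 mul1r. Qed.

(** Cauchy-Schwarz, read off from the squared norm of [enorm v *: u - enorm u *: v]. *)
Lemma dotp_CS u v : dotp u v <= enorm u * enorm v.
Proof.
have [->|un0] := eqVneq u 0; first by rewrite enorm0 dotp0l mul0r.
have [->|vn0] := eqVneq v 0; first by rewrite enorm0 dotp0r mulr0.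
have up : 0 < enorm u by rewrite enorm_gt0.
have vp : 0 < enorm v by rewrite enorm_gt0.
have := dotp_ge0 (enorm v *: u - enorm u *: v).
rewrite !dotpE (dotpC v u) -!enorm_sqr => h.
have : 0 <= (2 * (enorm u * enorm v)) * (enorm u * enorm v - dotp u v).
  by move: h; congr (_ <= _); ring.
by rewrite pmulr_rge0 ?subr_ge0 // mulr_gt0 // mulr_gt0.
Qed.

Lemma ler_enormD u v : enorm (u + v) <= enorm u + enorm v.
Proof.
rewrite -(@ler_pXn2r _ 2) ?nnegrE ?addr_ge0 ?enorm_ge0 //.
rewrite enorm_sqr !dotpE (dotpC v u) sqrrD !enorm_sqr.
by have := dotp_CS u v; lra.
Qed.

Lemma edist_triangle v u w : edist u w <= edist u v + edist v w.
Proof. by rewrite !edistE (le_trans _ (ler_enormD _ _)) // addrA subrK. Qed.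

Lemma edistC u v : edist u v = edist v u.
Proof. by rewrite !edistE -enormN opprB. Qed.

Lemma edist_eq0 u v : (edist u v == 0) = (u == v).
Proof. by rewrite edistE enorm_eq0 subr_eq0. Qed.

Lemma edist_ge0 u v : 0 <= edist u v. Proof. exact: enorm_ge0. Qed.

Lemma edistxx u : edist u u = 0. Proof. by apply/eqP; rewrite edist_eq0. Qed.

Lemma ler_coord_enorm u i : `|u 0 i| <= enorm u.
Proof.
rewrite -(@ler_pXn2r _ 2) ?nnegrE ?enorm_ge0 // enorm_sqr real_normK ?num_real //.
by rewrite /dotp (bigD1 i) //= expr2 lerDl sumr_ge0 // => j _; rewrite -expr2 sqr_ge0.
Qed.

End Dot.

(** The matrix with rows [p i] kills [h] from one side, hence is singular, and a kernel vector on
    the other side gives the coefficients. *)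
Lemma rV3_dependent (R : realType) (h : 'rV[R]_3) (p : 'I_3 -> 'rV[R]_3) :
  h != 0 -> (forall i, dotp h (p i) = 0) ->
  exists2 a : 'rV[R]_3, a != 0 & \sum_i a 0 i *: p i = 0.
Proof.
move=> hn0 hp; pose M := \matrix_(i < 3) p i.
have : \det M == 0.
  rewrite -det_tr; apply/det0P; exists h => //; apply/rowP => j.
  rewrite !mxE -[RHS](hp j) /dotp; apply: eq_bigr => i _.
  by rewrite !mxE.
move=> /det0P [a an0 aM]; exists a => //.
rewrite -[RHS]aM mulmx_sum_row; apply: eq_bigr => i _.
by rewrite rowK.
Qed.

(* Three vectors of a plane are dependent; applying c i to the relation shows that any
   two of its coefficients have opposite signs. *)
Lemma no_three_supports (R : realType) (h : 'rV[R]_3) (p c : 'I_3 -> 'rV[R]_3) :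
  h != 0 -> (forall i, dotp h (p i) = 0) ->
  (forall i, dotp (c i) (p i) = 0) ->
  (forall i j, i != j -> 0 < dotp (c i) (p j)) -> False.
Proof.
move=> hn0 hp cd cp; have [a an0 ap] := rV3_dependent hn0 hp.
have eqi i : \sum_j a 0 j * dotp (c i) (p j) = 0.
  have := congr1 (dotp (c i)) ap; rewrite dotp0r dotp_sumr => apc.
  rewrite -[RHS]apc; by apply: eq_bigr => j _; rewrite dotpZr.
have opp i j k : i != j -> i != k -> j != k ->
    a 0 j * dotp (c i) (p j) + a 0 k * dotp (c i) (p k) = 0.
  move=> ij ik jk; rewrite -[RHS](eqi i) (bigD1 i) //= cd mulr0 add0r.
  rewrite (bigD1 j) 1?eq_sym //= (bigD1 k) /=; last by rewrite ![k == _]eq_sym ik jk.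
  rewrite big1 ?addr0 // => l /andP[/andP[li lj] lk].
  (* A further index would give four distinct elements of a set of three. *)
  have := max_card (mem [:: i; j; k; l]); rewrite card_ord.
  rewrite (card_uniqP _) //= !inE !negb_or ij ik jk /= ![_ == l]eq_sym li lj lk.
  by [].
have sgn i j k : i != j -> i != k -> j != k -> 0 < a 0 j -> a 0 k < 0.
  move=> ij ik jk aj; have := opp i j k ij ik jk.
  have := cp i j ij; have := cp i k ik => c1 c2 e.
  have : 0 < a 0 j * dotp (c i) (p j) by rewrite mulr_gt0.
  rewrite -[_ * _](addrK (a 0 k * dotp (c i) (p k))) e sub0r oppr_gt0.
  by rewrite pmulr_llt0.
have other (i : 'I_3) : exists j k, [/\ i != j, i != k & j != k].
  by case: i => [[|[|[|//]]]] ?;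
   [exists (inord 1), (inord 2)|exists (inord 0), (inord 2)|exists (inord 0), (inord 1)];
   split; rewrite -val_eqE /= ?inordK.
have nop i : ~ 0 < a 0 i.
  move=> ai; have [j [k [ij ik jk]]] := other i.
  have aj : a 0 j < 0 by apply: (sgn k i j); rewrite // eq_sym.
  have ak : a 0 k < 0 by apply: (sgn j i k); rewrite // eq_sym.
  have := opp i j k ij ik jk.
  have : a 0 j * dotp (c i) (p j) < 0 by rewrite pmulr_llt0 // cp.
  have : a 0 k * dotp (c i) (p k) < 0 by rewrite pmulr_llt0 // cp.
  lra.
have non i : ~ a 0 i < 0.
  move=> ai; have [j [k [ij ik jk]]] := other i.
  have ji : j != i by rewrite eq_sym.
  have := opp j i k ji jk ik.
  have : a 0 i * dotp (c j) (p i) < 0 by rewrite pmulr_llt0 // cp.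
  have : a 0 k * dotp (c j) (p k) <= 0.
    by rewrite pmulr_lle0 ?cp // leNgt; apply/negP/nop.
  lra.
case/eqP: an0; apply/rowP => i; rewrite mxE; apply/eqP.
have /negP := nop i; have /negP := non i; rewrite -!leNgt => x y.
by apply/eqP/le_anti; rewrite x y.
Qed.

(** The topology on row vectors comes from the sup norm, which the Euclidean norm dominates and
    exceeds by a factor of at most m. Dividing by m + 1 instead of m yields the strict inequality
    and covers m = 0. *)
Lemma nbhs_edistP (R : realType) (m : nat) (A : set 'rV[R]_m) (z : 'rV[R]_m) :
  nbhs z A <-> exists2 e : R, 0 < e & forall y, edist z y < e -> A y.
Proof.
split=> [/nbhs_ballP [e /= e0 eA]|[e e0 eA]].
  exists e => // y zy; apply: eA; split=> // i j; rewrite ord1 /ball /=.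
  by rewrite (le_lt_trans _ zy) // (le_trans _ (ler_coord_enorm _ j)) // !mxE.
have m0 : 0 < m.+1%:R :> R by [].
apply/nbhs_ballP; exists (e / m.+1%:R) => /=; first exact: divr_gt0.
move=> y zy; apply: eA.
suff : edist z y <= m%:R * (e / m.+1%:R).
  move=> /le_lt_trans; apply; rewrite mulrCA gtr_pMr //.
  by rewrite ltr_pdivrMr // mul1r ltr_nat.
rewrite edistE -(@ler_pXn2r _ 2) ?nnegrE ?enorm_ge0 ?mulr_ge0 ?divr_ge0 ?(ltW e0) //.
rewrite enorm_sqr /dotp (@le_trans _ _ (\sum_(i < m) (e / m.+1%:R) ^+ 2)) //.
  apply: ler_sum => i _; rewrite -expr2 -real_normK ?num_real //.
  rewrite ler_pXn2r ?nnegrE ?normr_ge0 ?divr_ge0 ?(ltW e0) //.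
  by have := zy.2 ord0 i; rewrite /ball /= !mxE => /ltW.
rewrite sumr_const card_ord -[X in X <= _]mulr_natl [in leRHS]exprMn ler_wpM2r ?sqr_ge0 //.
by case: (m) => [|k]; rewrite ?expr0n // expr2 ler_peMr // ler1n.
Qed.

Lemma segment_l (R : realType) (m : nat) (a b : 'rV[R]_m) : segment a b a.
Proof. by exists 0; rewrite ?lexx ?ler01 // subr0 scale1r scale0r addr0. Qed.

Lemma segment_r (R : realType) (m : nat) (a b : 'rV[R]_m) : segment a b b.
Proof. by exists 1; rewrite ?lexx ?ler01 // subrr scale1r scale0r add0r. Qed.

Lemma conv_hull_segment (R : realType) (m : nat) (S : set 'rV[R]_m) (a b x : 'rV[R]_m) :
  S a -> S b -> segment a b x -> conv_hull S x.
Proof.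
move=> Sa Sb [t /andP[t0 t1] ->].
exists 2, (fun i => if i == 0 then 1 - t else t), (fun i => if i == 0 then a else b).
by split=> [i||i|]; rewrite ?big_ord_recl ?big_ord0 ?addr0 //=; first [case: ifP => _ //; lra | ring].
Qed.

Lemma conv_hull_ge (R : realType) (m : nat) (S : set 'rV[R]_m) (c x : 'rV[R]_m) (d : R) :
  (forall y, S y -> d <= dotp c y) -> conv_hull S x -> d <= dotp c x.
Proof.
move=> Sc [k [w [p [w0 w1 Sp ->]]]]; rewrite dotp_sumr.
rewrite -[d]mul1r -w1 mulr_suml; apply: ler_sum => i _.
by rewrite dotpZr ler_wpM2l // Sc.
Qed.

Section Polytope.
Variables (R : realType) (n : nat) (V : 'I_n -> 'rV[R]_3).

(** A combination in [conv_hull] may use a vertex several times; adding up its weights leaves one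
    weight per index. *)
Lemma hullP (x : 'rV[R]_3) : hull V x <->
  exists w : 'I_n -> R, [/\ forall i, 0 <= w i, \sum_i w i = 1 & x = \sum_i w i *: V i].
Proof.
split=> [[k [w [p [w0 w1 pV ->]]]]|[w [w0 w1 ->]]]; last first.
  by exists n, w, V; split=> // i; exists i.
have /choice[j jV] : forall i, exists j, V j = p i by move=> i; have [j _ <-] := pV i; exists j.
exists (fun l => \sum_(i | j i == l) w i); split.
- by move=> l; apply: sumr_ge0.
- by rewrite -[RHS]w1 (partition_big j predT).
rewrite (partition_big j predT) //=; apply: eq_bigr => l _.
by rewrite scaler_suml; apply: eq_bigr => i /eqP <-; rewrite jV.
Qed.

Lemma hull_vertex i : hull V (V i).
Proof.
apply/hullP; exists (fun j => (j == i)%:R); split=> [j||]; first by case: eqP.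
  by rewrite (bigD1 i) //= eqxx big1 ?addr0 // => j /negPf ->.
by rewrite (bigD1 i) //= eqxx scale1r big1 ?addr0 // => j /negPf ->; rewrite scale0r.
Qed.

Hypothesis PV : polytope_vertices V.

Let Vinj : injective V. Proof. by case: PV. Qed.

Lemma vertex_extreme i j k : segment (V i) (V j) (V k) -> k = i \/ k = j.
Proof.
move=> s; have [->|ki] := eqVneq k i; first by left.
have [->|kj] := eqVneq k j; first by right.
case: PV => _ /(_ k) + _; case; apply: conv_hull_segment s.
  by exists i => //=; rewrite eq_sym.
by exists j => //=; rewrite eq_sym.
Qed.

(** If all vertices had the same height along [c], so would the whole hull, yet an interior point
    can be moved a little along [c]. *)
Lemma vertices_not_coplanar (c x : 'rV[R]_3) : c != 0 -> exists k, dotp c (V k - x) != 0.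
Proof.
move=> cn0; apply/not_existsP => H.
have {}H k : dotp c (V k) = dotp c x.
  by have /negP := H k; rewrite negbK dotpBr subr_eq0 => /eqP.
have Hh y : hull V y -> dotp c y = dotp c x.
  move=> /hullP[w [w0 w1 ->]]; rewrite dotp_sumr.
  by under eq_bigr do rewrite dotpZr H; rewrite -mulr_suml w1 mul1r.
case: PV => _ _ [z /nbhs_edistP[e e0 eh]].
have cp : 0 < enorm c by rewrite enorm_gt0.
have := Hh (z + (e / 2 / enorm c) *: c).
rewrite dotpDr dotpZr (Hh z); last by apply: eh; rewrite edistxx.
rewrite -enorm_sqr => H1; have : e / 2 / enorm c * enorm c ^+ 2 = 0.
  apply: (@addrI _ (dotp c x)); rewrite addr0 H1 //; apply: eh.
  rewrite edistE opprD addrA subrr add0r enormN enormZ gtr0_norm ?divr_gt0 //.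
  by rewrite divfK ?gt_eqF // gtr_pMr // invf_lt1 // ltr1n.
by apply/eqP; rewrite gt_eqF // mulr_gt0 ?divr_gt0 // exprn_gt0.
Qed.

(** Normal form of an edge: a functional that vanishes at both ends and is positive at all other
    vertices. A further vertex on the face would lie on the segment and so not be extreme. *)
Lemma edge_support i j : is_edge V (V i) (V j) -> i != j /\
  exists c, [/\ forall k, 0 <= dotp c (V k - V i), dotp c (V j - V i) = 0
    & forall k, dotp c (V k - V i) = 0 -> k = i \/ k = j].
Proof.
case=> ij _ _ [c [d [cd cs]]]; split; first by apply: contra_neq ij => ->.
have [hi ci] : hull V (V i) /\ dotp c (V i) = d.
  by have : [set x | hull V x /\ dotp c x = d] (V i) by rewrite cs; exact: segment_l.
have [hj cj] : hull V (V j) /\ dotp c (V j) = d.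
  by have : [set x | hull V x /\ dotp c x = d] (V j) by rewrite cs; exact: segment_r.
exists (- c); split=> [k||k].
- by rewrite dotpNl dotpBr ci oppr_ge0 subr_le0 cd //; exact: hull_vertex.
- by rewrite dotpNl dotpBr ci cj subrr oppr0.
move=> /eqP; rewrite dotpNl dotpBr oppr_eq0 ci subr_eq0 => /eqP ck.
by apply: vertex_extreme; rewrite -cs; split => //; exact: hull_vertex.
Qed.

(** The height vector is a point (1, t, t^2) of a moment curve: the height difference of two
    vertices is then a nonzero polynomial in t, and t is chosen off the roots of the product of all
    these polynomials. *)
Lemma generic_height : exists2 h : 'rV[R]_3, h != 0 & injective (fun i => dotp h (V i)).
Proof.
pose p := \prod_(e : 'I_n * 'I_n | e.1 != e.2) rVpoly (V e.1 - V e.2).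
have pn0 : p != 0.
  apply/prodf_neq0 => -[i j] /= ij; apply/negP => /eqP.
  rewrite -(raddf0 (@rVpoly R 3)) => /(can_inj (@rVpolyK _ _)) /eqP.
  by rewrite subr_eq0 (inj_eq Vinj) (negPf ij).
have [t pt] : exists t, ~~ root p t.
  (* A nonzero polynomial has fewer than [size p] roots, so it cannot vanish at all of 0, ...,
     [size p] - 1. *)
  pose rs := [seq i%:R | i <- iota 0 (size p)] : seq R.
  have /allPn[t _ pt] : ~~ all (root p) rs.
    apply/negP => /(max_poly_roots pn0).
    rewrite map_inj_uniq ?iota_uniq; last by move=> a b /eqP; rewrite eqr_nat => /eqP.
    by rewrite size_map size_iota ltnn => /(_ isT).
  by exists t.
exists (\row_i t ^+ i); first by apply/eqP => /rowP/(_ 0); rewrite !mxE expr0 => /eqP; rewrite oner_eq0.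
move=> i j hij; apply/eqP/negP => /negP ij; case/negP: pt.
rewrite rootE /p horner_prod; apply/eqP/eqP.
rewrite prodf_seq_eq0; apply/hasP; exists (i, j); first exact: mem_index_enum.
rewrite /= ij /= horner_poly; apply/eqP.
transitivity (dotp (\row_i0 t ^+ i0) (V i - V j)); last by rewrite dotpBr hij subrr.
by rewrite /dotp; apply: eq_bigr => k _; rewrite insubT //= => k3; rewrite !mxE mulrC;
  congr (_ * (_ - _)); congr (V _ _ _); apply: val_inj.
Qed.

End Polytope.

Lemma rV3_dependent3 (R : realType) (h x y z : 'rV[R]_3) :
  h != 0 -> dotp h x = 0 -> dotp h y = 0 -> dotp h z = 0 ->
  exists a b c : R, ~ [/\ a = 0, b = 0 & c = 0] /\ a *: x + b *: y + c *: z = 0.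
Proof.
move=> hn0 hx hy hz.
have [|a an0] := @rV3_dependent R h (fun i => [:: x; y; z]`_i) hn0.
  by case=> -[|[|[|//]]].
rewrite !big_ord_recl big_ord0 /= addr0 addrA => e.
exists (a 0 ord0), (a 0 (lift ord0 ord0)), (a 0 (lift ord0 (lift ord0 ord0))).
split=> // -[a0 a1 a2]; case/eqP: an0; apply/rowP => -[[|[|[|//]]] i3]; rewrite mxE;
  [rewrite -a0|rewrite -a1|rewrite -a2]; congr (a _ _); exact: val_inj.
Qed.

(** A substitute for the cross product that also serves for dependent vectors: a kernel vector of
    the matrix with columns [c], [d] and 0. *)
Lemma exists_orthogonal (R : realType) (c d : 'rV[R]_3) :
  exists2 g : 'rV[R]_3, g != 0 & dotp g c = 0 /\ dotp g d = 0.
Proof.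
pose M := \matrix_(i < 3, j < 3) (if j == 0 :> nat then c 0 i else if j == 1%N :> nat then d 0 i else 0).
have : \det M == 0.
  rewrite (expand_det_col M (inord 2)) big1 // => i _.
  by rewrite !mxE inordK //= mul0r.
move=> /det0P [g gn0 gM]; exists g => //; split.
  by have /rowP/(_ 0) := gM; rewrite !mxE => <-; apply: eq_bigr => i _; rewrite !mxE.
by have /rowP/(_ 1) := gM; rewrite !mxE => <-; apply: eq_bigr => i _; rewrite !mxE.
Qed.

(** * The number of edges of a polytope *)

Lemma leq_card_bigcup (I T : finType) (P : pred I) (F : I -> {set T}) :
  (#|(\bigcup_(i | P i) F i)%SET| <= \sum_(i | P i) #|F i|)%N.
Proof.
elim/big_rec2: _ => [|i m A _ IH]; first by rewrite cards0.
by rewrite (leq_trans (leq_card_setU _ _)) // leq_add2l.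
Qed.

Lemma three_in_set (T : finType) (A : {set T}) :
  (2 < #|A|)%N -> exists2 f : 'I_3 -> T, injective f & forall i, f i \in A.
Proof.
move=> A3; exists (fun i => enum_val (widen_ord A3 i)) => [i j /enum_val_inj/(congr1 val) /= ij|i].
  exact: val_inj.
exact: enum_valP.
Qed.

Section EdgeCount.
Variables (R : realType) (n : nat) (V : 'I_n -> 'rV[R]_3).
Hypothesis PV : polytope_vertices V.
Local Notation eV i j := (is_edge V (V i) (V j)).

Let Vinj : injective V. Proof. by case: PV. Qed.

(** [Z] collects the vertices on a supporting plane, so edges and single vertices qualify as well;
    [middle] and the third vertex supplied by [edge_in_facet] single out the two-dimensional
    faces. *)
Definition facet_at (Z : {set 'I_n}) (c : 'rV[R]_3) (v : 'I_n) :=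
  [/\ c != 0, forall k, 0 <= dotp c (V k - V v)
    & forall k, (k \in Z) = (dotp c (V k - V v) == 0)].

Definition facet Z := exists c v, facet_at Z c v.

Lemma facet_rebase Z v : facet Z -> v \in Z -> exists c, facet_at Z c v.
Proof.
move=> [c [w [c0 cp cZ]]]; rewrite cZ dotpBr subr_eq0 => /eqP vw.
by exists c; split=> // k; [have := cp k | rewrite cZ]; rewrite !dotpBr vw.
Qed.

Lemma edge_sym i j : eV i j -> eV j i.
Proof.
move=> [ij ei ej [c [d [cd e]]]]; split; rewrite // 1?eq_sym //.
exists c, d; split=> //; rewrite e; apply/seteqP; split=> x [t /andP[t0 t1] ->].
  by exists (1 - t); [lra | rewrite opprB addrC subrKC].
by exists (1 - t); [lra | rewrite opprB addrC subrKC].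
Qed.

(* Rotate the supporting plane of the edge around it until it meets a third vertex. *)
Lemma edge_in_facet i j : eV i j ->
  exists Z, [/\ facet Z, i \in Z, j \in Z & exists k, [/\ k \in Z, k != i & k != j]].
Proof.
move=> /(edge_support PV)[ij [c [cp cj c0]]].
have dn0 : V j - V i != 0 by rewrite subr_eq0 (inj_eq Vinj) eq_sym.
have cn0 : c != 0.
  have [g gn0 [_ gj]] := exists_orthogonal 0 (V j - V i).
  have [k gk] := vertices_not_coplanar PV (V i) gn0.
  apply/eqP => ce; have := c0 k; rewrite ce dotp0l => /(_ erefl) [] kE; move: gk; rewrite kE.
    by rewrite subrr dotp0r eqxx.
  by rewrite gj eqxx.
have [g gn0 [gc gj gneg]] : exists2 g, g != 0 &
    [/\ dotp g c = 0, dotp g (V j - V i) = 0 & exists k, dotp g (V k - V i) < 0].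
  have [g gn0 [gc gj]] := exists_orthogonal c (V j - V i).
  have [k] := vertices_not_coplanar PV (V i) gn0.
  rewrite neq_lt => /orP[gk|gk]; first by exists g => //; split=> //; exists k.
  exists (- g); rewrite ?oppr_eq0 //; rewrite !dotpNl gc gj oppr0; split=> //.
  by exists k; rewrite dotpNl oppr_lt0.
case: gneg => k0 gk0.
(* The plane [c + s *: g] reaches vertex [k] when s is this ratio, so the smallest ratio is the
   first contact and leaves all other vertices on the nonnegative side. *)
pose r k := dotp c (V k - V i) / - dotp g (V k - V i).
case: (@arg_minP _ _ _ k0 (fun k => dotp g (V k - V i) < 0) r gk0) => k gk kmin.
pose c' := c + r k *: g.
have rk : 0 <= r k by rewrite divr_ge0 // oppr_ge0 ltW.
exists [set l | dotp c' (V l - V i) == 0]%SET; split.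
- exists c', i; split=> [|l|l]; last by rewrite inE.
    apply/eqP => c'0; have := congr1 (fun x => dotp x c) c'0.
    rewrite dotp0l dotpDl dotpZl gc mulr0 addr0 => /eqP.
    by rewrite dotp_eq0 (negPf cn0).
  rewrite dotpDl dotpZl; have [gl|gl] := ltP (dotp g (V l - V i)) 0.
    have := kmin l gl; rewrite {2}/r ler_pdivlMr ?oppr_gt0 //; lra.
  by rewrite addr_ge0 // mulr_ge0.
- by rewrite inE subrr dotp0r.
- by rewrite inE dotpDl dotpZl cj gj mulr0 addr0.
exists k; rewrite inE; split.
- rewrite dotpDl dotpZl /r; have : dotp g (V k - V i) != 0 by rewrite lt_eqF.
  by move=> ?; apply/eqP; field.
- by apply: contraTneq gk => ->; rewrite subrr dotp0r ltxx.
- by apply: contraTneq gk => ->; rewrite gj ltxx.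
Qed.

(** Inside the plane of the facet each edge at [v] lies on a supporting line with the other edges
    strictly on one side, and [no_three_supports] rules this out for three edges. *)
Lemma facet_edges_at Z v : facet Z -> v \in Z ->
  (#|[set w in Z | `[< eV v w >]]%SET| <= 2)%N.
Proof.
move=> fZ vZ; have [c [cn0 cp cZ]] := facet_rebase fZ vZ.
rewrite leqNgt; apply/negP => /three_in_set[w winj wN].
have wZ i : w i \in Z by have := wN i; rewrite inE => /andP[].
have /choice[e eP] : forall i, exists e, [/\ v != w i, forall k, 0 <= dotp e (V k - V v),
    dotp e (V (w i) - V v) = 0 & forall k, dotp e (V k - V v) = 0 -> k = v \/ k = w i].
  move=> i; have := wN i; rewrite inE => /andP[_ /asboolP /(edge_support PV)[vw [e [e1 e2 e3]]]].
  by exists e.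
apply: (@no_three_supports R c (fun i => V (w i) - V v) e cn0) => [i|i|i j ij].
- by apply/eqP; rewrite -cZ.
- by case: (eP i).
have [_ e1 _ e3] := eP i; have [vj _ _ _] := eP j; rewrite lt_neqAle e1 andbT eq_sym.
apply/eqP => /e3[/esym /eqP|/winj /esym /eqP]; first exact/negP.
exact/negP.
Qed.

Variable h : 'rV[R]_3.
Hypotheses (hn0 : h != 0) (hinj : injective (fun i => dotp h (V i))).

Definition middle (Z : {set 'I_n}) v := [/\ v \in Z,
  exists2 a, a \in Z & dotp h (V a) < dotp h (V v)
  & exists2 b, b \in Z & dotp h (V v) < dotp h (V b)].

(** The two differences have heights of opposite sign, so a nontrivial relation between them would
    place [V v] on the segment from [V a] to [V b], although it is extreme. *)
Lemma middle_noncollinear a v b (x y : R) :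
  dotp h (V a) < dotp h (V v) -> dotp h (V v) < dotp h (V b) ->
  x *: (V a - V v) + y *: (V b - V v) = 0 -> x = 0 /\ y = 0.
Proof.
move=> av vb e.
have := congr1 (dotp h) e; rewrite dotp0r dotpDr !dotpZr !dotpBr => eh.
have [y0|yn0] := eqVneq y 0.
  move: eh; rewrite y0 mul0r addr0 => /eqP; rewrite mulf_eq0 subr_eq0 (lt_eqF av) orbF.
  by move=> /eqP.
have s : segment (V a) (V b) (V v).
  have xy : 0 < x / y.
    have -> : x / y = (dotp h (V b) - dotp h (V v)) / (dotp h (V v) - dotp h (V a)).
      have d : dotp h (V v) - dotp h (V a) != 0 by rewrite subr_eq0 gt_eqF.
      apply/eqP; rewrite eqr_div //; apply/eqP; move: eh; lra.
    by rewrite divr_gt0 ?subr_gt0.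
  have xyn0 : x + y != 0.
    have -> : x + y = y * (x / y + 1) by field.
    by rewrite mulf_neq0 // gt_eqF // addr_gt0.
  (* The relation reads (x + y) [V v] = x [V a] + y [V b]. *)
  exists (y / (x + y)).
    have -> : y / (x + y) = (x / y + 1)^-1.
      have q : x / y + 1 != 0 by rewrite gt_eqF // addr_gt0.
      by apply: (mulIf q); rewrite mulVf //; field; rewrite yn0.
    by rewrite invr_ge0 addr_ge0 ?(ltW xy) //= invf_le1 ?addr_gt0 // lerDr ltW.
  apply: (scalerI xyn0); rewrite scalerDr !scalerA.
  have -> : (x + y) * (1 - y / (x + y)) = x by field.
  rewrite mulrCA divff // mulr1; apply/eqP; rewrite eq_sym -subr_eq0 -[X in _ == X]e.
  by rewrite !scalerBr scalerDl; apply/eqP; rewrite opprD addrACA.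
case: (vertex_extreme PV s) => ve; move: av vb; rewrite ve ltxx //.
Qed.

(* Each such facet meets the horizontal plane through V v in a segment issued from V v,
   along which it supports the section of the polytope by this plane. *)
Lemma facets_at_middle v : (#|[set Z | `[< facet Z /\ middle Z v >]]%SET| <= 2)%N.
Proof.
rewrite leqNgt; apply/negP => /three_in_set[Z Zinj ZN].
have {}ZN i : facet (Z i) /\ middle (Z i) v by have := ZN i; rewrite inE => /asboolP.
have /choice[c cP] : forall i, exists c, facet_at (Z i) c v.
  by move=> i; have [fZ [vZ _ _]] := ZN i; apply: facet_rebase.
have /choice[a aP] : forall i, exists a, a \in Z i /\ dotp h (V a) < dotp h (V v).
  by move=> i; have [_ [_ [a ? ?] _]] := ZN i; exists a.
have /choice[b bP] : forall i, exists b, b \in Z i /\ dotp h (V v) < dotp h (V b).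
  by move=> i; have [_ [_ _ [b ? ?]]] := ZN i; exists b.
pose be i := dotp h (V (b i)) - dotp h (V v).
pose al i := dotp h (V v) - dotp h (V (a i)).
have be0 i : 0 < be i by rewrite subr_gt0; case: (bP i).
have al0 i : 0 < al i by rewrite subr_gt0; case: (aP i).
(* Two facets sharing [v], [a j] and [b j] contain three noncollinear points of a common plane,
   hence have the same vertices. *)
have sub i l j k : a j \in Z i -> b j \in Z i -> a j \in Z l -> b j \in Z l ->
    k \in Z i -> k \in Z l.
  have [ci1 _ ci] := cP i; have [_ _ cl] := cP l.
  rewrite !ci !cl => /eqP ai /eqP bi /eqP al' /eqP bl /eqP ki.
  have [x [y [z [nz e]]]] := rV3_dependent3 ci1 ai bi ki.
  have /eqP := congr1 (dotp (c l)) e; rewrite (dotpDr _ (_ + _)) (dotpDr _ (_ *: _)) !dotpZr dotp0r al' bl !mulr0 !add0r.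
  rewrite mulf_eq0 => /orP[/eqP z0|-> //]; case: nz.
  by move: e; rewrite z0 scale0r addr0 => /(middle_noncollinear (aP j).2 (bP j).2)[-> ->].
(* The weights cancel the heights: up to a positive factor, [p i] leads from [V v] to the point
   where the segment from [a i] to [b i] crosses the horizontal plane. *)
pose p i := be i *: (V (a i) - V v) + al i *: (V (b i) - V v).
apply: (no_three_supports hn0 (p := p) (c := c)) => [i|i|i j ij]; rewrite /p.
- by rewrite dotpDr !dotpZr !dotpBr /be /al; ring.
- have [_ _ ci] := cP i; rewrite dotpDr !dotpZr.
  have [ai _] := aP i; have [bi _] := bP i.
  by move: ai bi; rewrite !ci => /eqP -> /eqP ->; rewrite !mulr0 addr0.
have [_ ci1 ci] := cP i.
rewrite dotpDr !dotpZr lt_neqAle eq_sym addr_ge0 ?mulr_ge0 ?(ltW (al0 _)) ?(ltW (be0 _)) // andbT.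
rewrite paddr_eq0 ?mulr_ge0 ?(ltW (al0 _)) ?(ltW (be0 _)) //.
rewrite !mulf_eq0 (gt_eqF (al0 j)) (gt_eqF (be0 j)) /= -!ci; apply/negP => /andP[ai bi].
have [aj _] := aP j; have [bj _] := bP j.
case/negP: ij; apply/eqP/Zinj/setP => k; apply/idP/idP; exact: (sub _ _ j).
Qed.

Definition up_edges : {set 'I_n * 'I_n} :=
  [set e | `[< eV e.1 e.2 /\ dotp h (V e.1) < dotp h (V e.2) >]].

Definition charged (v : 'I_n) (Z : {set 'I_n}) : {set 'I_n * 'I_n} :=
  [set e in up_edges | [&& e.1 \in Z, e.2 \in Z &
    [|| v == e.1, v == e.2 | `[< forall k, k \in Z ->
       dotp h (V e.1) <= dotp h (V k) <= dotp h (V e.2) >]]]]%SET.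

(* An edge of a facet Z is charged to its upper end if Z rises above it, else to its lower
   end if Z goes below it, else (when it joins the bottom of Z to its top) to any other
   vertex of Z. *)
Lemma edge_charged e : e \in up_edges ->
  exists v Z, [/\ facet Z, middle Z v & e \in charged v Z].
Proof.
case: e => i j eu; move: (eu); rewrite inE => /asboolP /= [eij hij].
have [Z [fZ iZ jZ [k [kZ ki kj]]]] := edge_in_facet eij.
have [/existsP[l /andP[lZ lj]]|] := boolP [exists l, (l \in Z) && (dotp h (V j) < dotp h (V l))].
  exists j, Z; split=> //; last by rewrite inE eu /= iZ jZ eqxx orbT.
  by split=> //; [exists i | exists l].
rewrite negb_exists => /forallP Hj.
have [/existsP[l /andP[lZ lj]]|] := boolP [exists l, (l \in Z) && (dotp h (V l) < dotp h (V i))].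
  exists i, Z; split=> //; last by rewrite inE eu /= iZ jZ eqxx.
  by split=> //; [exists l | exists j].
rewrite negb_exists => /forallP Hi.
have Hij l : l \in Z -> dotp h (V i) <= dotp h (V l) <= dotp h (V j).
  by move=> lZ; have := Hi l; have := Hj l; rewrite lZ /= -!leNgt => -> ->.
exists k, Z; split=> //; last first.
  by rewrite inE eu /= iZ jZ /=; apply/orP; right; apply/orP; right; apply/asboolP.
have /andP[ik kj'] := Hij k kZ.
split=> //; [exists i => //|exists j => //].
  by rewrite lt_neqAle ik andbT (inj_eq hinj) eq_sym.
by rewrite lt_neqAle kj' andbT (inj_eq hinj).
Qed.

(** The five are the at most two edges of [Z] at [v], counted with [v] as lower and as upper end,
    and the edge from the bottom of [Z] to its top, unique because heights are distinct. *)
Lemma card_charged v Z : facet Z -> middle Z v -> (#|charged v Z| <= 5)%N.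
Proof.
move=> fZ [vZ _ _]; set N := [set w in Z | `[< eV v w >]]%SET.
have N2 : (#|N| <= 2)%N := facet_edges_at fZ vZ.
pose ext := [set e : 'I_n * 'I_n | [&& e.1 \in Z, e.2 \in Z &
  `[< forall k, k \in Z -> dotp h (V e.1) <= dotp h (V k) <= dotp h (V e.2) >]]]%SET.
have ext1 : (#|ext| <= 1)%N.
  apply/card_le1_eqP => -[i j] [i' j']; rewrite !inE /= => /and3P[iZ jZ /asboolP H].
  move=> /and3P[iZ' jZ' /asboolP H'].
  have /andP[a1 _] := H _ iZ'; have /andP[a2 _] := H' _ iZ.
  have /andP[_ b1] := H _ jZ'; have /andP[_ b2] := H' _ jZ.
  by congr (_, _); apply: hinj; apply: le_anti; rewrite ?a1 ?a2 ?b1 ?b2.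
have : charged v Z \subset ([set (v, w) | w in N] :|: [set (w, v) | w in N] :|: ext)%SET.
  apply/fintype.subsetP => -[i j]; rewrite !inE /= => /andP[/asboolP[eij _]] /and3P[iZ jZ].
  case/or3P => [/eqP vi|/eqP vj|H].
  - apply/orP; left; apply/orP; left; apply/imsetP; exists j; last by rewrite vi.
    by rewrite inE jZ vi /=; apply/asboolP.
  - apply/orP; left; apply/orP; right; apply/imsetP; exists i; last by rewrite vj.
    by rewrite inE iZ vj /=; apply/asboolP/edge_sym.
  - by rewrite iZ jZ H orbT.
move=> /subset_leq_card /leq_trans; apply.
apply: (leq_trans (leq_card_setU _ _)); rewrite (@leq_trans (2 + 2 + 1)) //.
apply: leq_add => //; apply: (leq_trans (leq_card_setU _ _)).
by apply: leq_add; apply: leq_trans N2; apply: leq_imset_card.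
Qed.

(** Ten is two facets per vertex times five charges per pair. *)
Lemma card_up_edges : (#|up_edges| <= 10 * n)%N.
Proof.
pose M v := [set Z | `[< facet Z /\ middle Z v >]]%SET.
have : up_edges \subset (\bigcup_v \bigcup_(Z in M v) charged v Z)%SET.
  apply/fintype.subsetP => e /edge_charged[v [Z [fZ mZ eZ]]].
  by apply/bigcupP; exists v => //; apply/bigcupP; exists Z => //; rewrite inE; apply/asboolP.
move=> /subset_leq_card /leq_trans; apply.
apply: (leq_trans (leq_card_bigcup _ _)).
rewrite (@leq_trans (\sum_(v < n) 10)) //; last by rewrite sum_nat_const card_ord mulnC.
apply: leq_sum => v _; apply: (leq_trans (leq_card_bigcup _ _)).
rewrite (@leq_trans (\sum_(Z in M v) 5)) //.
  by apply: leq_sum => Z; rewrite inE => /asboolP[fZ mZ]; apply: card_charged.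
by rewrite sum_nat_const; have := facets_at_middle v; rewrite -/(M v) => M2; rewrite (leq_mul M2 (leqnn 5)).
Qed.

End EdgeCount.

(** [E] holds each edge in its upward orientation only, while [a] and [b] come in either order,
    hence the equality of segments rather than of pairs. *)
Lemma polytope_edge_list (R : realType) (n : nat) (V : 'I_n -> 'rV[R]_3) :
  polytope_vertices V -> exists E : {set 'I_n * 'I_n}, (#|E| <= 10 * n)%N /\
    forall a b, is_edge V a b -> exists2 e, e \in E & segment a b = segment (V e.1) (V e.2).
Proof.
move=> PV; have [h hn0 hinj] := generic_height PV.
exists (up_edges V h); split; first exact: card_up_edges.
move=> a b ab; have [anb [i ai] [j bj] _] := ab.
have : dotp h (V i) != dotp h (V j).
  by apply: contra_neq anb; rewrite ai bj => /hinj ->.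
rewrite neq_lt => /orP[ij|ij].
  exists (i, j); last by rewrite ai bj.
  by rewrite inE; apply/asboolP; split=> //=; rewrite -ai -bj.
exists (j, i); first by rewrite inE; apply/asboolP; split=> //=; apply: edge_sym; rewrite -ai -bj.
rewrite /= ai bj; apply/seteqP; split=> x [t /andP[t0 t1] ->].
  by exists (1 - t); [lra | rewrite opprB addrC subrKC].
by exists (1 - t); [lra | rewrite opprB addrC subrKC].
Qed.

(** * The skeleton of a polygonal set *)

Lemma exists_min_pos (R : realType) (I : finType) (e : I -> R) :
  (forall i, 0 < e i) -> exists2 d, 0 < d & forall i, d <= e i.
Proof.
(* The default 1 keeps the minimum positive for an empty family. *)
move=> e0; exists (\big[Order.min/1]_i e i); last by move=> i; exact: bigmin_le_cond.
by apply/bigmin_gtP; split.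
Qed.

Lemma ltr_norm_conv (R : realType) (r a b k : R) : `|a| < r -> `|b| < r -> 0 <= k <= 1 ->
  `|(1 - k) * a + k * b| < r.
Proof.
move=> ar br /andP[k0 k1].
have [am bm] : `|a| <= Num.max `|a| `|b| /\ `|b| <= Num.max `|a| `|b|.
  by rewrite !le_max !lexx orbT.
have : Num.max `|a| `|b| < r by rewrite gt_max ar.
apply: le_lt_trans; rewrite (le_trans (ler_normD _ _)) // !normrM (ger0_norm k0).
by rewrite ger0_norm ?subr_ge0 //; nra.
Qed.

Ltac row_ring := apply/rowP => ?; rewrite !mxE; ring.

Section Segments.
Variables (R : realType) (m : nat).
Implicit Types (a b c d x y : 'rV[R]_m).

Lemma segmentP a b x :
  segment a b x <-> exists2 t, 0 <= t <= 1 & x = a + t *: (b - a).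
Proof.
have E t : (1 - t) *: a + t *: b = a + t *: (b - a).
  by rewrite scalerBl scale1r scalerBr addrA addrAC.
by split=> -[t t01 ->]; exists t; rewrite ?E.
Qed.

Lemma segmentC a b : segment a b = segment b a.
Proof.
by apply/seteqP; split=> x [t /andP[t0 t1] ->]; exists (1 - t);
  [lra | rewrite opprB addrC subrKC | lra | rewrite opprB addrC subrKC].
Qed.

Lemma segmentxx a : segment a a = [set a].
Proof.
apply/seteqP; split=> x /=; last by move=> ->; exact: segment_l.
by move=> /segmentP[t _ ->]; rewrite subrr scaler0 addr0.
Qed.

Lemma segment_subl a b c : segment a b c -> segment a c `<=` segment a b.
Proof.
move=> /segmentP[t /andP[t0 t1] ->] x /segmentP[s /andP[s0 s1] ->].
apply/segmentP; exists (s * t); first by rewrite mulr_ge0 //= mulr_ile1.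
by row_ring.
Qed.

Lemma segment_subr a b c : segment a b c -> segment c b `<=` segment a b.
Proof. by rewrite (segmentC a) (segmentC c); exact: segment_subl. Qed.

Lemma segment_split a b c x : segment a b c -> segment a b x ->
  segment a c x \/ segment c b x.
Proof.
wlog le_xc : a b / exists t s, [/\ 0 <= s, s <= t, t <= 1, c = a + t *: (b - a) & x = a + s *: (b - a)].
  move=> H /segmentP[t /andP[t0 t1] cE] /segmentP[s /andP[s0 s1] xE].
  have [st|ts] := leP s t.
    by apply: H; [exists t, s | apply/segmentP; exists t; rewrite ?t0 | apply/segmentP; exists s; rewrite ?s0].
  rewrite (segmentC a c) (segmentC c b) or_comm; apply: H.
  - exists (1 - t), (1 - s); split; [lra|lra|lra| |].
      by rewrite cE; row_ring.
    by rewrite xE; row_ring.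
  - by rewrite segmentC; apply/segmentP; exists t; rewrite ?t0.
  - by rewrite segmentC; apply/segmentP; exists s; rewrite ?s0.
case: le_xc => t [s [s0 st t1 -> ->]] _ _; left; apply/segmentP.
have [t00|tn0] := eqVneq t 0.
  have s00 : s = 0 by apply: le_anti; rewrite s0 -t00 st.
  by exists 0; rewrite ?lexx ?ler01 // s00 !scale0r.
have tp : 0 < t by rewrite lt_neqAle eq_sym tn0 (le_trans s0 st).
exists (s / t); first by rewrite divr_ge0 ?(ltW tp) //= ler_pdivrMr // mul1r.
by apply/rowP => ?; rewrite !mxE; field.
Qed.

Lemma segment_line (x d : 'rV[R]_m) (al be ga : R) : al <= ga <= be ->
  segment (x + al *: d) (x + be *: d) (x + ga *: d).
Proof.
move=> /andP[ag gb]; have [e|ab] := eqVneq al be.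
  have -> : ga = al by apply: le_anti; rewrite ag e gb.
  exact: segment_l.
have ab' : 0 < be - al by rewrite subr_gt0 lt_neqAle ab (le_trans ag gb).
apply/segmentP; exists ((ga - al) / (be - al)).
  by rewrite divr_ge0 ?(ltW ab') ?subr_ge0 //= ler_pdivrMr // mul1r lerD2r.
rewrite [x + be *: d]addrC addrKA -scalerBl scalerA divfK ?gt_eqF //.
by row_ring.
Qed.

Lemma closed_segment a b : closed (segment a b).
Proof.
have -> : segment a b = (fun t : R => (1 - t) *: a + t *: b) @` `[0, 1].
  by apply/seteqP; split=> x [t t01]; [move=> ->|move=> <-]; exists t => //; move: t01; rewrite /= in_itv.
apply: compact_closed; first exact: norm_hausdorff.
apply: continuous_compact; last exact: segment_compact.
apply: continuous_subspaceT => t.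
apply: cvgD; apply: cvgZr_tmp => //.
by apply: cvgB => //; apply: cvg_cst.
Qed.

Lemma closed_away (A : set 'rV[R]_m) x : closed A -> ~ A x ->
  exists2 e, 0 < e & forall y, edist x y < e -> ~ A y.
Proof.
move=> cA Ax; have : nbhs x (~` A) by apply: open_nbhs_nbhs; split; first exact: closed_openC.
by move=> /nbhs_edistP[e e0 eA]; exists e.
Qed.

Lemma segment_initial a b e : a != b -> 0 < e ->
  exists t, [/\ 0 < t, t <= 1 & edist a (a + t *: (b - a)) < e].
Proof.
move=> ab e0; have n0 : 0 < enorm (b - a) by rewrite enorm_gt0 subr_eq0 eq_sym.
exists (Num.min 1 (e / 2 / enorm (b - a))); rewrite lt_min ltr01 divr_gt0 ?divr_gt0 //=.
split=> //; first by rewrite ge_min lexx.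
rewrite edistE opprD addrA subrr add0r enormN enormZ ger0_norm; last first.
  by rewrite le_min ler01 /= !divr_ge0 // ltW.
apply: (@le_lt_trans _ _ (e / 2 / enorm (b - a) * enorm (b - a))).
  by rewrite ler_wpM2r ?enorm_ge0 // ge_min lexx orbT.
by rewrite divfK ?gt_eqF // ltr_pdivrMr // ltr_pMr // ltr1n.
Qed.

Lemma finite_set_enum (P : set 'rV[R]_m) : finite_set P ->
  exists (N : nat) (p : 'I_N -> 'rV[R]_m), injective p /\ forall x, P x <-> exists i, x = p i.
Proof.
move=> /finite_seqP[s ->]; exists (size (undup s)), (tnth (in_tuple (undup s))); split.
  by apply/tuple_uniqP; rewrite undup_uniq.
move=> x; split => [/= xs|[i ->]].
  by apply/tnthP; rewrite memtE /= mem_undup.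
by rewrite /= -mem_undup; apply: mem_tnth.
Qed.

Definition dir x y := (enorm (y - x))^-1 *: (y - x).

Lemma enorm_dir x y : x != y -> enorm (dir x y) = 1.
Proof.
move=> xy; have n0 : 0 < enorm (y - x) by rewrite enorm_gt0 subr_eq0 eq_sym.
by rewrite enormZ gtr0_norm ?invr_gt0 // mulVf ?gt_eqF.
Qed.

Lemma dir_line x t d : 0 < t -> enorm d = 1 -> dir x (x + t *: d) = d.
Proof.
move=> t0 d1; rewrite /dir addrC addKr enormZ d1 mulr1 gtr0_norm // scalerA mulVf ?scale1r //.
by rewrite gt_eqF.
Qed.

Lemma dir_segment x y z : segment x y z -> z != x -> dir x z = dir x y.
Proof.
move=> /segmentP[t /andP[t0 t1] ->].
rewrite -subr_eq0 addrC addKr scaler_eq0 negb_or => /andP[tn0 xy].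
have tp : 0 < t by rewrite lt_neqAle eq_sym tn0.
rewrite /dir addrC addKr enormZ gtr0_norm // scalerA; congr (_ *: _).
by rewrite invfM mulrAC mulVf // mul1r.
Qed.

Lemma dir_eq x y z : x != y -> x != z -> dir x y = dir x z ->
  edist x y <= edist x z -> segment x z y.
Proof.
move=> xy xz e; rewrite !(edistC x) !edistE => le.
have ny : 0 < enorm (y - x) by rewrite enorm_gt0 subr_eq0 eq_sym.
have nz : 0 < enorm (z - x) by rewrite enorm_gt0 subr_eq0 eq_sym.
apply/segmentP; exists (enorm (y - x) / enorm (z - x)).
  by rewrite divr_ge0 ?enorm_ge0 //= ler_pdivrMr // mul1r.
rewrite -scalerA -/(dir x z) -e /dir scalerA divff ?gt_eqF // scale1r.
by rewrite addrC subrK.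
Qed.

End Segments.

Arguments closed_segment : clear implicits.

Section Skeleton.
Variables (R : realType) (m : nat) (T : set 'rV[R]_m).
Local Notation P := 'rV[R]_m.

Definition skel_adj (N : nat) (p : 'I_N -> P) (i j : 'I_N) : Prop :=
  [/\ i != j, segment (p i) (p j) `<=` T
    & forall k, segment (p i) (p j) (p k) -> k = i \/ k = j].

(** A straight-line drawing of a graph that fills [T], possibly with isolated nodes. The last clause
    forbids crossings; an edge may occur there in either orientation. *)
Definition skeleton (N : nat) (p : 'I_N -> P) : Prop :=
  [/\ injective p, forall i, T (p i),
      forall x, T x -> (exists i, x = p i) \/
        exists i j, skel_adj p i j /\ segment (p i) (p j) x
    & forall i j k l x, skel_adj p i j -> skel_adj p k l ->
        segment (p i) (p j) x -> segment (p k) (p l) x ->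
        (exists i, x = p i) \/ (i = k /\ j = l \/ i = l /\ j = k)].

Lemma skel_adjC N (p : 'I_N -> P) i j : skel_adj p i j -> skel_adj p j i.
Proof.
move=> [ij sT H]; split; [by rewrite eq_sym|by rewrite segmentC|].
by move=> k; rewrite segmentC => /H; tauto.
Qed.

Section Build.
Variables (k : nat) (a b : 'I_k -> P).
Hypothesis TE : T = \bigcup_(i in [set: 'I_k]) segment (a i) (b i).
Variables (N : nat) (p : 'I_N -> P).
Hypotheses (pinj : injective p) (pT : forall i, T (p i)).
Hypotheses (ap : forall i, exists l, a i = p l) (bp : forall i, exists l, b i = p l).
Hypothesis crossp : forall i j x,
  segment (a i) (b i) `&` segment (a j) (b j) = [set x] -> exists l, x = p l.

Let in_seg x : T x -> exists i, segment (a i) (b i) x.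
Proof. by rewrite TE => -[i _ s]; exists i. Qed.

Let seg_sub i : segment (a i) (b i) `<=` T.
Proof. by rewrite TE => x s; exists i. Qed.

Lemma skel_cover x : T x -> (exists i, x = p i) \/
  exists i j, skel_adj p i j /\ segment (p i) (p j) x.
Proof.
move=> Tx; have [?|xP] := pselect (exists i, x = p i); [by left|right].
have [i0 s0] := in_seg Tx; have [la aE] := ap i0; have [lb bE] := bp i0.
pose Q (e : 'I_N * 'I_N) := `[< segment (p e.1) (p e.2) x /\ segment (p e.1) (p e.2) `<=` T >].
have Q0 : Q (la, lb).
  by apply/asboolP; rewrite /= -aE -bE; split=> //; exact: seg_sub.
(* A shortest segment of T through x with ends among the nodes contains no other node. *)
case: (arg_minP (fun e => edist (p e.1) (p e.2)) Q0) => -[i j] /asboolP /= [sx sT] emin.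
exists i, j; split=> //.
have ij : i != j.
  by apply/negP => /eqP ij; apply: xP; exists i; move: sx; rewrite ij segmentxx.
have pij : p i != p j by rewrite (inj_eq pinj).
split=> // l sl; have [->|li] := eqVneq l i; first by left.
have [->|lj] := eqVneq l j; first by right.
exfalso.
have [t /andP[t0 t1] lE] := (segmentP _ _ _).1 sl.
have t0' : 0 < t.
  rewrite lt_neqAle t0 andbT; apply/negP => /eqP te; case/eqP: li; apply: pinj.
  by rewrite lE -te scale0r addr0.
have t1' : t < 1.
  rewrite lt_neqAle t1 andbT; apply/negP => /eqP te; case/eqP: lj; apply: pinj.
  by rewrite lE te scale1r addrC subrK.
have n0 : 0 < enorm (p i - p j) by rewrite enorm_gt0 subr_eq0.
case: (segment_split sl sx) => sx'.
  have := emin (i, l); rewrite /Q /= => H.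
  have {}H : edist (p i) (p j) <= edist (p i) (p l).
    by apply: H; apply/asboolP; split=> //; apply: subset_trans sT; exact: segment_subl.
  move: H; rewrite !edistE lE.
  have -> : p i - (p i + t *: (p j - p i)) = t *: (p i - p j) by row_ring.
  by rewrite enormZ gtr0_norm // leNgt gtr_pMl // t1'.
have := emin (l, j); rewrite /Q /= => H.
have {}H : edist (p i) (p j) <= edist (p l) (p j).
  by apply: H; apply/asboolP; split=> //; apply: subset_trans sT; exact: segment_subr.
move: H; rewrite !edistE lE.
have -> : p i + t *: (p j - p i) - p j = (1 - t) *: (p i - p j) by row_ring.
by rewrite enormZ gtr0_norm ?subr_gt0 // leNgt gtr_pMl // ltrBlDr ltrDl t0'.
Qed.

(** A segment of [T] through [x] that met the chosen one only at [x] would make [x] a crossing,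
    hence a node. So the two share a second point and span the same line. *)
Lemma locally_on_line x : T x -> ~ (exists i, x = p i) ->
  exists2 d, d != 0 & exists2 e, 0 < e & forall y, T y -> edist x y < e -> exists s, y = x + s *: d.
Proof.
move=> Tx xP; have [i0 s0] := in_seg Tx.
have dn0 : b i0 - a i0 != 0.
  apply/negP; rewrite subr_eq0 => /eqP ab; apply: xP; have [l aE] := ap i0; exists l.
  by move: s0; rewrite ab segmentxx -aE.
exists (b i0 - a i0) => //.
have /choice[e eP] : forall i, exists e, 0 < e /\ forall y, segment (a i) (b i) y ->
    edist x y < e -> exists s, y = x + s *: (b i0 - a i0).
  move=> i; have [si|si] := pselect (segment (a i) (b i) x); last first.
    by have [e e0 eA] := closed_away (closed_segment _ _ (a i) (b i)) si; exists e; split=> // y sy /eA.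
  have [z [[z1 z2] zx]] : exists z, (segment (a i) (b i) `&` segment (a i0) (b i0)) z /\ z <> x.
    apply: contrapT => H; apply: xP; apply: (crossp (i := i) (j := i0)).
    apply/seteqP; split=> [z zz|z ->] //; apply: contrapT => zx.
    by apply: H; exists z.
  exists 1; split=> // y sy _.
  have [tx _ xE] := (segmentP _ _ _).1 si; have [tz _ zE] := (segmentP _ _ _).1 z1.
  have [sx _ xE'] := (segmentP _ _ _).1 s0; have [sz _ zE'] := (segmentP _ _ _).1 z2.
  have [ty _ yE] := (segmentP _ _ _).1 sy.
  have tn : tz - tx != 0.
    by apply: contra_notN zx; rewrite subr_eq0 => /eqP tt; rewrite xE zE tt.
  have eq1 : (tz - tx) *: (b i - a i) = (sz - sx) *: (b i0 - a i0).
    have : z - x = z - x by []; rewrite {1}xE {1}zE xE' zE'.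
    by rewrite [_ + tz *: _]addrC [_ + sz *: _]addrC !addrKA -!scalerBl.
  exists ((ty - tx) * ((sz - sx) / (tz - tx))).
  have -> : ((ty - tx) * ((sz - sx) / (tz - tx))) *: (b i0 - a i0) = (ty - tx) *: (b i - a i).
    by rewrite -scalerA; congr (_ *: _); rewrite mulrC -scalerA -eq1 scalerA mulVf // scale1r.
  by rewrite xE yE; row_ring.
have [d d0 de] := exists_min_pos (fun i => (eP i).1).
exists d => // y /in_seg[i si] xy; apply: (eP i).2 si _.
exact: lt_le_trans xy (de i).
Qed.

(** The edge leaves [x] along the line that carries [T] nearby, so both ends lie on that line.
    Neither end is [x], which lies between them. *)
Lemma skel_edge_line x d e i j : d != 0 -> 0 < e -> ~ (exists i, x = p i) ->
  (forall y, T y -> edist x y < e -> exists s, y = x + s *: d) ->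
  skel_adj p i j -> segment (p i) (p j) x ->
  exists al be, [/\ p i = x + al *: d, p j = x + be *: d & (al < 0 < be) || (be < 0 < al)].
Proof.
move=> dn0 e0 xP xl [ij sT _] sx.
have on l : segment (p i) (p j) (p l) -> exists al, p l = x + al *: d.
  move=> sl; have xl' : x != p l by apply/negP => /eqP xE; apply: xP; exists l.
  have [t [t0 t1 te]] := segment_initial xl' e0.
  have [s sE] : exists s, x + t *: (p l - x) = x + s *: d.
    apply: (xl _ _ te); apply: sT; have : segment x (p l) (x + t *: (p l - x)) by apply/segmentP; exists t; rewrite ?(ltW t0).
    have [s|s] := segment_split sl sx.
      by move=> sy; apply: (segment_subl sl); apply: (segment_subr s).
    by rewrite segmentC => sy; apply: (segment_subr sl); apply: (segment_subl s).
  exists (s / t); move: sE => /addrI sE.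
  by rewrite mulrC -scalerA -sE scalerA mulVf ?gt_eqF // scale1r addrC subrK.
have [al aE] := on i (segment_l _ _); have [be bE] := on j (segment_r _ _).
exists al, be; split=> //.
have aln0 : al != 0 by apply/negP => /eqP a0; apply: xP; exists i; rewrite aE a0 scale0r addr0.
have ben0 : be != 0 by apply/negP => /eqP a0; apply: xP; exists j; rewrite bE a0 scale0r addr0.
have [t /andP[t0 t1] tE] := (segmentP _ _ _).1 sx.
have : (al + t * (be - al)) *: d = 0.
  apply: (@addrI _ x); rewrite addr0 [RHS]tE aE bE; row_ring.
move/eqP; rewrite scaler_eq0 (negPf dn0) orbF => /eqP e1.
move: aln0 ben0; rewrite !neq_lt => /orP[pa|pa] /orP[pb|pb]; rewrite pa pb ?orbT //; exfalso; nra.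
Qed.

(** Two edges through a point that is not a node lie on one line. Once both are oriented along [d],
    if their ends on one side differed, the nearer one would be a node inside the other edge. *)
Lemma skel_cross i j i' j' x : skel_adj p i j -> skel_adj p i' j' ->
  segment (p i) (p j) x -> segment (p i') (p j') x ->
  (exists i, x = p i) \/ (i = i' /\ j = j' \/ i = j' /\ j = i').
Proof.
move=> ij ij' s s'; have [?|xP] := pselect (exists i, x = p i); [by left|right].
have Tx : T x by case: ij => _ + _; apply.
have [d dn0 [e e0 xl]] := locally_on_line Tx xP.
wlog: i j ij s / exists al be, [/\ p i = x + al *: d, p j = x + be *: d & al < 0 < be].
  move=> H; have [al [be [aE bE /orP[ab|ba]]]] := skel_edge_line dn0 e0 xP xl ij s.
    by apply: (H i j ij s); exists al, be.
  have s2 : segment (p j) (p i) x by rewrite segmentC.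
  have ex : exists al be, [/\ p j = x + al *: d, p i = x + be *: d & al < 0 < be] by exists be, al.
  by have [[-> ->]|[-> ->]] := H j i (skel_adjC ij) s2 ex; [right|left].
wlog: i' j' ij' s' / exists al be, [/\ p i' = x + al *: d, p j' = x + be *: d & al < 0 < be].
  move=> H; have [al [be [aE bE /orP[ab|ba]]]] := skel_edge_line dn0 e0 xP xl ij' s'.
    by apply: (H i' j' ij' s'); exists al, be.
  have s2 : segment (p j') (p i') x by rewrite segmentC.
  have ex : exists al be, [/\ p j' = x + al *: d, p i' = x + be *: d & al < 0 < be] by exists be, al.
  by move=> H'; have [[-> ->]|[-> ->]] := H j' i' (skel_adjC ij') s2 ex H'; [right|left].
move=> [al' [be' [aE' bE' /andP[a0' b0']]]] [al [be [aE bE /andP[a0 b0]]]]; left.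
have inj_line u v : x + u *: d = x + v *: d -> u = v.
  by move=> /addrI/eqP; rewrite -subr_eq0 -scalerBl scaler_eq0 (negPf dn0) orbF subr_eq0 => /eqP.
have [_ _ H] := ij; have [_ _ H'] := ij'.
split.
  apply: pinj; rewrite aE aE'; have [aa|aa] := leP al al'.
    case: (H i'); first by rewrite aE bE aE'; apply: segment_line; rewrite aa; lra.
      by move=> ii; rewrite -aE -aE' ii.
    by move=> ji; move: bE; rewrite -ji aE' => /inj_line ?; exfalso; lra.
  case: (H' i); first by rewrite aE' bE' aE; apply: segment_line; lra.
    by move=> ii; rewrite -aE -aE' ii.
  by move=> ji; move: bE'; rewrite -ji aE => /inj_line ?; exfalso; lra.
apply: pinj; rewrite bE bE'; have [aa|aa] := leP be' be.
  case: (H j'); first by rewrite aE bE bE'; apply: segment_line; lra.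
    by move=> ji; move: aE; rewrite -ji bE' => /inj_line ?; exfalso; lra.
  by move=> ii; rewrite -bE -bE' ii.
case: (H' j); first by rewrite aE' bE' bE; apply: segment_line; lra.
  by move=> ji; move: aE'; rewrite -ji bE => /inj_line ?; exfalso; lra.
by move=> ii; rewrite -bE -bE' ii.
Qed.

End Build.

Lemma skeleton_exists (W : set P) : polygonal_set T -> finite_set W -> W `<=` T ->
  exists (N : nat) (p : 'I_N -> P), skeleton p /\ forall x, W x -> exists i, x = p i.
Proof.
move=> [k [a [b TE]]] finW WT.
(* When the intersection is a single point, [xget] returns it. For overlapping segments it picks an
   arbitrary common point, and for disjoint ones it gives 0, which [X] retains only if it lies in
   [T]. *)
pose cr (e : 'I_k * 'I_k) := xget 0 (segment (a e.1) (b e.1) `&` segment (a e.2) (b e.2)).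
pose X := W `|` range a `|` range b `|` (T `&` range cr).
have finX : finite_set X.
  rewrite /X !finite_setU; split; [split; [split=> //|]|]; try exact: finite_image.
  by apply: sub_finite_set (@subIsetr _ _ _) _; exact: finite_image.
have [N [p [pinj pX]]] := finite_set_enum finX.
have aT i : T (a i) by rewrite TE; exists i => //; exact: segment_l.
have bT i : T (b i) by rewrite TE; exists i => //; exact: segment_r.
have pT i : T (p i).
  have /pX : exists j, p i = p j by exists i.
  by move=> [[[/WT //|[j _ <-] //]|[j _ <-] //]|[]].
have ap i : exists l, a i = p l by apply/pX; left; left; right; exists i.
have bp i : exists l, b i = p l by apply/pX; left; right; exists i.
have crossp i j x : segment (a i) (b i) `&` segment (a j) (b j) = [set x] -> exists l, x = p l.
  move=> E; apply/pX; right; split.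
    have : (segment (a i) (b i) `&` segment (a j) (b j)) x by rewrite E.
    by move=> [s _]; rewrite TE; exists i.
  exists (i, j) => //; rewrite /cr /= E.
  by case: xgetP => [y _ -> //|/(_ x)]; case.
exists N, p; split.
  split=> // [x|i j i' j' x]; first exact: (skel_cover TE pinj ap bp).
  exact: (skel_cross TE pinj ap crossp).
by move=> x Wx; apply/pX; left; left; left.
Qed.

(** Finitely many closed segments miss [x], so a small ball avoids them all. The degenerate pairs
    (i, i) keep the nodes other than [x] out of the ball. *)
Lemma skeleton_star N (p : 'I_N -> P) x : skeleton p ->
  exists2 e, 0 < e & forall y, T y -> edist x y < e -> y = x \/
    exists i j, [/\ skel_adj p i j, segment (p i) (p j) x & segment (p i) (p j) y].
Proof.
move=> [pinj pT cover cross].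
have /choice[e eP] : forall ij, exists e, 0 < e /\
    (~ segment (p ij.1) (p ij.2) x -> forall y, edist x y < e -> ~ segment (p ij.1) (p ij.2) y).
  move=> [i j] /=; have [s|s] := pselect (segment (p i) (p j) x); first by exists 1.
  by have [e e0 eA] := closed_away (closed_segment _ _ (p i) (p j)) s; exists e.
have [d d0 de] := exists_min_pos (fun i => (eP i).1).
exists d => // y Ty xy; case: (cover y Ty) => [[i yE]|[i [j [ij sy]]]].
  left; have := (eP (i, i)).2; rewrite /= segmentxx => H.
  apply: contrapT => yx; apply: (H _ y _ _) => //; first by move=> xE; apply: yx; rewrite xE -yE.
  exact: lt_le_trans xy (de _).
right; exists i, j; split=> //; apply: contrapT => sx.
by apply: ((eP (i, j)).2 sx y) sy; exact: lt_le_trans xy (de _).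
Qed.

End Skeleton.

(** Translates a local picture of [T] as a star with tips [Q] into the unit directions by which
    degree is defined. *)
Lemma branch_dirs_star (R : realType) (T Q : set 'rV[R]_3) (x : 'rV[R]_3) (e : R) :
  0 < e -> (forall q, Q q -> x != q /\ segment x q `<=` T) ->
  (forall y, T y -> edist x y < e -> y = x \/ exists2 q, Q q & segment x q y) ->
  branch_dirs T x = [set dir x q | q in Q].
Proof.
move=> e0 QT star; apply/seteqP; split=> u.
  move=> [+ [d d0 uT]]; rewrite edistE subr0 => u1.
  pose t := Num.min d (e / 2).
  have t0 : 0 < t by rewrite lt_min d0 divr_gt0.
  have un0 : u != 0 by rewrite -enorm_eq0 u1 oner_eq0.
  case: (star (x + t *: u)).
  - by apply: uT; rewrite t0 ge_min lexx.
  - rewrite edistE opprD addrA subrr add0r enormN enormZ u1 mulr1 gtr0_norm //.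
    by rewrite gt_min; apply/orP; right; rewrite ltr_pdivrMr // ltr_pMr // ltr1n.
  - move=> /eqP; rewrite -subr_eq0 addrC addKr scaler_eq0 (negPf un0) orbF => /eqP tz.
    by move: t0; rewrite tz ltxx.
  move=> [q Qq s]; exists q => //; rewrite -(dir_segment s); first by rewrite dir_line.
  by rewrite -subr_eq0 addrC addKr scaler_eq0 negb_or un0 gt_eqF.
move=> [q /QT[xq sT] <-]; split; first by rewrite edistE subr0 enorm_dir.
have n0 : 0 < enorm (q - x) by rewrite enorm_gt0 subr_eq0 eq_sym.
exists (enorm (q - x)) => // t /andP[t0 te]; apply: sT; apply/segmentP.
exists (t / enorm (q - x)); last by rewrite /dir scalerA.
by rewrite divr_ge0 ?enorm_ge0 ?(ltW t0) //= ler_pdivrMr // mul1r.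
Qed.

(** * Degree sums in finite forests *)

Section Forest.
Variables (I : finType) (e : rel I).
Hypotheses (esym : symmetric e) (eirr : irreflexive e).

Definition nbrs (A : {set I}) v := [set w in A | e v w]%SET.

Lemma cycle_of_degree2 (A : {set I}) : A != finset.set0 ->
  (forall v, v \in A -> (1 < #|nbrs A v|)%N) ->
  exists s, [/\ uniq s, (2 < size s)%N & cycle e s].
Proof.
move=> /set0Pn[v0 v0A] deg2.
pose Q n := `[< exists x s, [/\ path e x s, uniq (x :: s), {subset x :: s <= A} & size s = n] >].
have Q0 : exists n, Q n.
  exists 0%N; apply/asboolP; exists v0, [::]; split=> // x.
  by rewrite inE => /eqP ->.
have Qb n : Q n -> (n <= #|I|)%N.
  move=> /asboolP[x [s [_ us _ <-]]].
  by have := max_card (mem (x :: s)); rewrite (card_uniqP us) /= => /ltnW.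
(* The first vertex of a longest path has all its neighbours on the path. *)
case: (ex_maxnP Q0 Qb) => n /asboolP[x [s [ps us sA sn]]] nmax.
have xs y : y \in nbrs A x -> y \in s.
  rewrite inE => /andP[yA xy]; apply: contraT => ys.
  have : Q n.+1.
    apply/asboolP; exists y, (x :: s); split=> /=; rewrite ?sn //.
    - by rewrite esym xy.
    - rewrite inE negb_or ys andbT -cons_uniq us andbT; apply/negP => /eqP yx.
      by rewrite yx eirr in xy.
    - by move=> z; rewrite inE => /orP[/eqP -> //|]; apply: sA.
  by move=> /nmax; rewrite ltnn.
have /deg2/card_gt1P[y [z [yN zN yz]]] : x \in A by apply: sA; rewrite mem_head.
(* A neighbour of the first vertex other than the second vertex of the path closes a cycle of length
   at least three. *)
have [w [wN ws]] : exists w, w \in nbrs A x /\ w != head x s.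
  by have [yh|] := eqVneq y (head x s); [exists z; rewrite -yh eq_sym|exists y].
have wins := xs _ wN; move: wN; rewrite inE => /andP[_ xw].
move: ps us ws; case/splitPr: wins => p1 p2.
rewrite cat_path /= => /and3P[pp1 lw _] + wh.
rewrite -cons_uniq -cat_cons cat_uniq /= => /and3P[/andP[xp1 up1] /norP[wp1 _] _].
exists (x :: rcons p1 w); split.
- rewrite /= rcons_uniq mem_rcons inE negb_or xp1 up1 !andbT.
  move: wp1; rewrite inE negb_or eq_sym => /andP[-> ->]. 
  by [].
- by rewrite /= size_rcons; case: p1 wh {pp1 lw xp1 up1 wp1} => //=; rewrite eqxx.
- by rewrite /= !rcons_path pp1 lw last_rcons esym xw.
Qed.

(** Some vertex of [A] has at most one neighbour in [A]. Removing it lowers the degree sum by at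
    most two and twice the cardinality by exactly two. *)
Lemma forest_degree_sum : ~ (exists s, [/\ uniq s, (2 < size s)%N & cycle e s]) ->
  forall A : {set I}, A != finset.set0 -> (\sum_(v in A) #|nbrs A v| + 2 <= 2 * #|A|)%N.
Proof.
move=> acyc A; have [n] := ubnP #|A|; elim: n A => // n IH A An A0.
have [v vA dv] : exists2 v, v \in A & (#|nbrs A v| <= 1)%N.
  apply: contrapT => H; apply: acyc; apply: (cycle_of_degree2 A0) => v vA.
  by rewrite ltnNge; apply/negP => dv; apply: H; exists v.
pose B := (A :\ v)%SET.
have cA : #|A| = #|B|.+1 by rewrite (cardsD1 v) vA.
have sumE : (\sum_(w in A) #|nbrs A w| = #|nbrs A v| + (\sum_(w in B) #|nbrs B w| + #|nbrs A v|))%N.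
  rewrite (big_setD1 v) //=; congr addn.
  have nE w : w \in B -> #|nbrs A w| = (#|nbrs B w| + e v w)%N.
    rewrite !inE => /andP[wv wA]; rewrite (cardsD1 v) !inE vA /= addnC esym; congr addn.
    by apply: eq_card => u; rewrite !inE andbA.
  rewrite (eq_bigr _ nE) big_split /=; congr addn.
  rewrite -sum1_card [RHS](eq_bigl (fun w => (w \in B) && e v w)); last first.
    move=> w; rewrite !inE; case: (eqVneq w v) => [->|] //=; by rewrite eirr andbF.
  by rewrite big_mkcondr /=; apply: eq_bigr => w _; case: (e v w).
have [B0|B0] := eqVneq B finset.set0.
  have Av : A = [set v]%SET by rewrite -(finset.setD1K vA) -/B B0 finset.setU0.
  have N0 : #|nbrs A v| = 0%N.
    by apply: eq_card0 => w; rewrite !inE Av inE; case: eqP => // ->; rewrite eirr.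
  by rewrite sumE N0 cA B0 big_set0 cards0.
have := IH B _ B0; rewrite -ltnS -cA => /(_ An).
by rewrite sumE cA; lia.
Qed.

End Forest.

(** * Closed polylines and loops *)

Section Loop.
Variable R : realType.
Local Notation P := 'rV[R]_3.

(** Truncation to the unit interval: a sum of truncated steps describes a polyline by one continuous
    formula, without gluing pieces. *)
Definition clamp (u : R) : R := Num.max 0 (Num.min u 1).

Lemma clamp_continuous : continuous clamp.
Proof.
have -> : clamp = (cst 0 : R -> R^o) \max ((id : R -> R^o) \min cst 1) by [].
move=> u; apply: continuous_max; first exact: cst_continuous.
by apply: continuous_min; [exact: cvg_id | exact: cst_continuous].
Qed.

Lemma clamp_le0 u : u <= 0 -> clamp u = 0.
Proof. by move=> u0; rewrite /clamp; apply/max_idPl; rewrite ge_min u0. Qed.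

Lemma clamp_ge1 u : 1 <= u -> clamp u = 1.
Proof.
by move=> u1; rewrite /clamp (min_idPr u1); apply/max_idPr.
Qed.

Lemma clamp_id u : 0 <= u <= 1 -> clamp u = u.
Proof. by move=> /andP[u0 u1]; rewrite /clamp (min_idPl u1); apply/max_idPr. Qed.

(* The edge from q i to q i.+1 is run through while t goes from i / k to i.+1 / k. *)
Definition polyline (k : nat) (q : nat -> P) (t : R) : P :=
  q 0%N + \sum_(0 <= i < k) clamp (k%:R * t - i%:R) *: (q i.+1 - q i).

Lemma polyline_continuous k q : continuous (polyline k q).
Proof.
move=> t; apply: cvgD; first exact: cvg_cst.
elim: (index_iota 0 k) => [|i r IH].
  by under eq_fun do rewrite big_nil; rewrite big_nil; apply: cvg_cst.
under eq_fun do rewrite big_cons; rewrite big_cons; apply: cvgD => //; apply: cvgZr_tmp.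
apply: (@cvg_comp _ _ _ (fun t => k%:R * t - i%:R) clamp); last exact: clamp_continuous.
apply: cvgB; last exact: cvg_cst.
by apply: cvgM; [exact: cvg_cst | exact: cvg_id].
Qed.

(** At this parameter the steps before [j] are complete and those after [j] have not begun, so the
    sum telescopes. *)
Lemma polylineE k q j (u : R) : (j < k)%N -> 0 <= u <= 1 ->
  polyline k q ((j%:R + u) / k%:R) = q j + u *: (q j.+1 - q j).
Proof.
move=> jk u01; have k0 : k%:R != 0 :> R by rewrite pnatr_eq0 -lt0n (leq_trans _ jk).
rewrite /polyline mulrC divfK // (@big_cat_nat _ _ _ j) //=; last exact: ltnW.
rewrite (@big_ltn _ _ _ j) //.
have -> : j%:R + u - j%:R = u by ring.
rewrite (clamp_id u01) [X in _ + (_ + X)]big1_seq ?addr0.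
  rewrite addrA; congr (_ + _); rewrite big_seq (eq_bigr (fun i => q i.+1 - q i)) -?big_seq.
    by rewrite telescope_sumr // addrC subrK.
  move=> i; rewrite mem_index_iota => /andP[_ ij]; rewrite clamp_ge1 ?scale1r //.
  have : i.+1%:R <= j%:R :> R by rewrite ler_nat.
  by rewrite -natr1; case/andP: u01; lra.
move=> i; rewrite mem_index_iota => /andP[_ /andP[ji _]]; rewrite clamp_le0 ?scale0r //.
have : j.+1%:R <= i%:R :> R by rewrite ler_nat.
by rewrite -natr1; case/andP: u01; lra.
Qed.

Lemma split_unit (k : nat) (t : R) : (0 < k)%N -> 0 <= t < 1 ->
  exists (j : nat) (u : R), [/\ (j < k)%N, 0 <= u < 1 & t = (j%:R + u) / k%:R].
Proof.
move=> k0 /andP[t0 t1]; have k0' : 0 < k%:R :> R by rewrite ltr0n.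
have kt : 0 <= k%:R * t by rewrite mulr_ge0 // ltW.
have /andP[l1 l2] := truncn_itv kt.
exists (Num.truncn (k%:R * t)), (k%:R * t - (Num.truncn (k%:R * t))%:R); split.
- by rewrite -(@ltr_nat R) (le_lt_trans l1) // gtr_pMr.
- by rewrite subr_ge0 l1 /= ltrBlDr addrC natr1.
- by rewrite addrC subrK mulrAC divff ?mul1r // gt_eqF.
Qed.

(** Sides are taken without their last point, so the node shared by consecutive sides counts once,
    as in the injectivity clause of [has_loop]. *)
Lemma polyline_loop (T : set P) (k : nat) (q : nat -> P) : (0 < k)%N -> q k = q 0%N ->
  (forall i, (i < k)%N -> q i != q i.+1 /\ segment (q i) (q i.+1) `<=` T) ->
  (forall i j (u v : R), (i < k)%N -> (j < k)%N -> 0 <= u < 1 -> 0 <= v < 1 ->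
     q i + u *: (q i.+1 - q i) = q j + v *: (q j.+1 - q j) -> i = j) ->
  has_loop T.
Proof.
move=> k0 qk qT qinj; exists (polyline k q).
have k0' : k%:R != 0 :> R by rewrite pnatr_eq0 -lt0n.
have at0 : polyline k q 0 = q 0%N.
  have := @polylineE k q 0%N 0 k0; rewrite add0r mul0r scale0r addr0 => -> //.
  by rewrite lexx ler01.
have at1 : polyline k q 1 = q 0%N.
  have := @polylineE k q k.-1 1; rewrite natr1 prednK // divff // => -> //.
    by rewrite scale1r addrC subrK.
  by rewrite lexx ler01.
split.
- by apply: continuous_subspaceT => t; exact: polyline_continuous.
- by rewrite at0 at1.
- move=> s t /(split_unit k0)[i [u [ik u01 ->]]] /(split_unit k0)[j [v [jk v01 ->]]].
  have w01 (w : R) : 0 <= w < 1 -> 0 <= w <= 1 by move=> /andP[-> /ltW].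
  rewrite !polylineE ?w01 // => E.
  have ij : i = j by apply: qinj E.
  move: E; rewrite -ij => /addrI/eqP; rewrite -subr_eq0 -scalerBl scaler_eq0 !subr_eq0.
  by have [/negPf qi _] := qT i ik; rewrite [q i.+1 == _]eq_sym qi orbF => /eqP ->.
move=> x [t /andP[t0 t1] <-].
have [t1' | ] := ltP t 1; last first.
  move=> t1'; have -> : t = 1 by apply: le_anti; rewrite t1 t1'.
  by rewrite at1; have [_ qs] := qT 0%N k0; apply: qs; exact: segment_l.
have [|j [u [jk /andP[u0 u1] ->]]] := @split_unit k t k0; first by rewrite t0.
rewrite polylineE ?u0 ?(ltW u1) //.
by have [_ qs] := qT j jk; apply/qs/segmentP; exists u; rewrite ?u0 ?(ltW u1).
Qed.

(** Skeleton edges meet only at nodes, so a graph cycle traced as a closed polyline is a simple loop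
    in [T]. *)
Lemma skeleton_acyclic (T : set P) (N : nat) (p : 'I_N -> P) (e : rel 'I_N) :
  skeleton T p -> (forall i j, e i j -> skel_adj T p i j) -> ~ has_loop T ->
  ~ (exists s, [/\ uniq s, (2 < size s)%N & cycle e s]).
Proof.
move=> [pinj pT _ cross] eadj nl [s [us s3 cs]]; apply: nl.
case: s us s3 cs => // x s us s3 cs; set k := size (x :: s) in s3 *.
have k0 : (0 < k)%N by [].
pose ix j := nth x (x :: s) (j %% k).
have ixS j : (j < k)%N -> e (ix j) (ix j.+1).
  move=> jk; rewrite /ix (modn_small jk).
  have /(pathP x)/(_ j) := cs; rewrite size_rcons => /(_ jk).
  rewrite -rcons_cons nth_rcons jk nth_rcons.
  have [js|] := ltnP j (size s); first by rewrite modn_small.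
  move=> sj; have -> : j = size s by apply/eqP; rewrite eqn_leq sj andbT -ltnS.
  by rewrite eqxx modnn.
have ix_inj i j : (i < k)%N -> (j < k)%N -> ix i = ix j -> i = j.
  move=> ik jk /eqP; rewrite /ix !modn_small // nth_uniq //.
  by move=> /eqP.
have ixk : ix k = ix 0%N by rewrite /ix modnn mod0n.
apply: (@polyline_loop T k (p \o ix)) => //=; first by rewrite ixk.
  by move=> i /ixS/eadj[ij sT _]; rewrite (inj_eq pinj).
move=> i j u v ik jk /andP[u0 u1] /andP[v0 v1] E.
have adji := eadj _ _ (ixS _ ik); have adjj := eadj _ _ (ixS _ jk).
set y := _ + _ in E.
have si : segment (p (ix i)) (p (ix i.+1)) y by apply/segmentP; exists u; rewrite ?u0 ?ltW.
have sj : segment (p (ix j)) (p (ix j.+1)) y by rewrite E; apply/segmentP; exists v; rewrite ?v0 ?ltW.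
have notend l (w : R) : (l < k)%N -> w < 1 -> y = p (ix l) + w *: (p (ix l.+1) - p (ix l)) -> y <> p (ix l.+1).
  move=> lk w1 -> /eqP; rewrite -subr_eq0.
  have -> : p (ix l) + w *: (p (ix l.+1) - p (ix l)) - p (ix l.+1) = (1 - w) *: (p (ix l) - p (ix l.+1)) by row_ring.
  have [ij _ _] := eadj _ _ (ixS _ lk).
  by rewrite scaler_eq0 !subr_eq0 (inj_eq pinj) (negPf ij) orbF eq_sym lt_eqF.
case: (cross _ _ _ _ _ adji adjj si sj) => [[l yl]|[[/ix_inj -> //]|[e1 e2]]].
  have [_ _ Hi] := adji; have [_ _ Hj] := adjj.
  case: (Hi l); rewrite -?yl // => li; last by case: (notend i u ik u1 erefl); rewrite yl li.
  case: (Hj l); rewrite -?yl // => lj; last by case: (notend j v jk v1 E); rewrite yl lj.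
  by apply: ix_inj => //; rewrite -li.
(* What remains is one edge run in both directions, so that i = j + 1 and j = i + 1 modulo [k],
   which fails for [k] at least three. *)
have ixm l : ix l = ix (l %% k)%N by rewrite /ix modn_mod.
have m1 : i = (j.+1 %% k)%N by apply: ix_inj; rewrite ?ltn_mod // -ixm.
have m2 : j = (i.+1 %% k)%N by apply: ix_inj; rewrite ?ltn_mod // -ixm.
exfalso; move: m1 m2.
have [jk1|jk1] := ltnP j.+1 k.
  rewrite (modn_small jk1) => ij; have [ik1|ik1] := ltnP i.+1 k; first by rewrite modn_small //; lia.
  have -> : i.+1 = k by lia.
  by rewrite modnn; lia.
have -> : j.+1 = k by lia.
by rewrite modnn => ->; rewrite modn_small; lia.
Qed.

End Loop.

(** * The boundary of a polytope away from its vertices *)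

(* Induction on the number of generators: a functional c separating b from the
   previous generators but negative on the new one q is repaired by projecting
   along q onto the kernel of c. *)
Lemma farkas (R : realType) (m n : nat) (p : 'I_n -> 'rV[R]_m) (b : 'rV[R]_m) :
  (exists2 w : 'I_n -> R, forall i, 0 <= w i & b = \sum_i w i *: p i) \/
  (exists2 c : 'rV[R]_m, forall i, 0 <= dotp c (p i) & dotp c b < 0).
Proof.
elim: n p b => [|n IH] p b.
  have [->|bn0] := eqVneq b 0; first by left; exists (fun=> 0) => //; rewrite big_ord0.
  by right; exists (- b) => [[]//|]; rewrite dotpNl oppr_lt0 dotp_gt0.
pose q := p ord0; pose p' i := p (lift ord0 i).
have ext (w : 'I_n -> R) (t : R) : (forall i, 0 <= w i) -> 0 <= t -> b = t *: q + \sum_i w i *: p' i ->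
    exists2 w : 'I_n.+1 -> R, forall i, 0 <= w i & b = \sum_i w i *: p i.
  move=> w0 t0 bE; exists (fun i => oapp w t (unlift ord0 i)).
    by move=> i; case: (unlift ord0 i) => [j|] /=.
  rewrite big_ord_recl unlift_none /= bE; congr (_ + _).
  by apply: eq_bigr => i _; rewrite liftK.
case: (IH p' b) => [[w w0 bE]|[c cp cb]].
  by left; apply: (ext w 0) => //; rewrite scale0r add0r.
have [cq|cq] := leP 0 (dotp c q).
  right; exists c => // i; case: (unliftP ord0 i) => [j ->|->] //; exact: cp.
have cqn0 : dotp c q != 0 by rewrite lt_eqF.
case: (IH (fun i => p' i - (dotp c (p' i) / dotp c q) *: q) (b - (dotp c b / dotp c q) *: q)).
  move=> [w w0 bE]; left.
  apply: (ext w (dotp c b / dotp c q - \sum_i w i * (dotp c (p' i) / dotp c q)) w0).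
    rewrite subr_ge0 (@le_trans _ _ 0) //.
      by rewrite sumr_le0 // => i _; rewrite mulr_ge0_le0 // mulr_ge0_le0 // invr_le0 ltW.
    by rewrite mulr_le0 // ?invr_le0 ltW.
  rewrite -[LHS](subrK ((dotp c b / dotp c q) *: q)) bE.
  rewrite [X in X + _ = _](eq_bigr (fun i => w i *: p' i - (w i * (dotp c (p' i) / dotp c q)) *: q)); last first.
    by move=> i _; rewrite scalerBr scalerA.
  by rewrite sumrB -scaler_suml; move: (\sum_i _ *: _) (\sum_i _) => A s; row_ring.
move=> [c' cp' cb']; right; pose c2 := c' - (dotp c' q / dotp c q) *: c.
have c2E v : dotp c2 v = dotp c' (v - (dotp c v / dotp c q) *: q).
  by rewrite /c2 dotpBl dotpBr dotpZl dotpZr; ring.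
exists c2; last by rewrite c2E.
move=> i; case: (unliftP ord0 i) => [j ->|->]; first by rewrite c2E; exact: cp'.
by rewrite c2E divff // scale1r subrr dotp0r.
Qed.

Lemma orthonormal_basis (R : realType) (m : nat) (f : 'I_m -> 'rV[R]_m) :
  (forall i j, dotp (f i) (f j) = (i == j)%:R) -> forall y, y = \sum_i dotp (f i) y *: f i.
Proof.
move=> ff y; pose M := \matrix_(i < m) f i.
have MM : M *m M^T = 1%:M.
  apply/matrixP => i j; rewrite !mxE -[RHS]ff.
  by apply: eq_bigr => k _; rewrite !mxE.
have {1}-> : y = (y *m M^T) *m M by rewrite -mulmxA (mulmx1C MM) mulmx1.
rewrite mulmx_sum_row; apply: eq_bigr => i _; rewrite rowK; congr (_ *: _).
by rewrite dotpC mxE; apply: eq_bigr => k _; rewrite !mxE.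
Qed.

Lemma orthonormal_frame (R : realType) (u w c : 'rV[R]_3) :
  dotp u u = 1 -> dotp w w = 1 -> dotp c c = 1 ->
  dotp u w = 0 -> dotp u c = 0 -> dotp w c = 0 ->
  forall y, y = dotp u y *: u + dotp w y *: w + dotp c y *: c.
Proof.
move=> uu ww cc uw uc wc y.
pose f (i : 'I_3) := if i == 0 :> nat then u else if i == 1%N :> nat then w else c.
rewrite {1}(@orthonormal_basis _ _ f _ y); first by rewrite !big_ord_recl big_ord0 addr0 addrA.
by case=> -[|[|[|//]]] ?; case=> -[|[|[|//]]] ?;
  rewrite /f /= ?uu ?ww ?cc ?uw ?uc ?wc // dotpC ?uw ?uc ?wc.
Qed.

Lemma orthonormal_pair (R : realType) (u w : 'rV[R]_2) :
  dotp u u = 1 -> dotp w w = 1 -> dotp u w = 0 ->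
  forall y, y = dotp u y *: u + dotp w y *: w.
Proof.
move=> uu ww uw y; pose f (i : 'I_2) := if i == 0 :> nat then u else w.
rewrite {1}(@orthonormal_basis _ _ f _ y); first by rewrite !big_ord_recl big_ord0 addr0.
by case=> -[|[|//]] ?; case=> -[|[|//]] ?; rewrite /f /= ?uu ?ww ?uw // dotpC ?uw.
Qed.

Lemma dotp_normalize (R : realType) (m : nat) (g : 'rV[R]_m) : g != 0 ->
  dotp ((enorm g)^-1 *: g) ((enorm g)^-1 *: g) = 1.
Proof.
move=> gn0; have e0 : enorm g != 0 by rewrite enorm_eq0.
by rewrite dotpZl dotpZr -enorm_sqr; field.
Qed.

(** * Directions that stay in the polytope *)

Section TangentCone.
Variables (R : realType) (n : nat) (V : 'I_n -> 'rV[R]_3) (x : 'rV[R]_3).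
Hypothesis hx : hull V x.

Lemma hull_convex a b c : hull V a -> hull V b -> segment a b c -> hull V c.
Proof.
move=> /hullP[v [v0 v1 ->]] /hullP[w [w0 w1 ->]] [t /andP[t0 t1] ->].
apply/hullP; exists (fun i => (1 - t) * v i + t * w i); split.
- by move=> i; rewrite addr_ge0 ?mulr_ge0 // subr_ge0.
- by rewrite big_split /= -!mulr_sumr v1 w1; ring.
rewrite !scaler_sumr -big_split; apply: eq_bigr => i _.
by rewrite [RHS]scalerDl -!scalerA.
Qed.

(* tangent false f: x + t f stays in the hull for small t >= 0;
   tangent true f: the same for small t of either sign. *)
Definition tangent (s : bool) (f : 'rV[R]_3) := exists2 d : R, 0 < d &
  forall t, `|t| <= d -> s || (0 <= t) -> hull V (x + t *: f).

Lemma tangent_line f : tangent false f -> tangent false (- f) -> tangent true f.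
Proof.
move=> [d d0 H] [d' d'0 H']; exists (Num.min d d'); first by rewrite lt_min d0.
move=> t; rewrite le_min => /andP[td td'] _; have [t0|t0] := leP 0 t; first exact: H.
by rewrite -[t]opprK scaleNr -scalerN; apply: H'; rewrite ?normrN //= oppr_ge0 ltW.
Qed.

Lemma tangent_side s f : tangent s f -> tangent false f.
Proof. by move=> [d d0 H]; exists d => // t td /= t0; apply: H; rewrite ?t0 ?orbT. Qed.

Lemma tangentZ s f k : 0 <= k -> tangent s f -> tangent s (k *: f).
Proof.
move=> k0 [d d0 H]; exists (d / (k + 1)); first by rewrite divr_gt0 // ltr_wpDl.
move=> t td t0; rewrite scalerA; apply: H.
  rewrite normrM (ger0_norm k0) (le_trans (ler_wpM2r k0 td)) // mulrAC ler_pdivrMr ?ltr_wpDl //.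
  by rewrite ler_wpM2l // ?(ltW d0) // lerDl.
by case: (s) t0 => //= t0; rewrite mulr_ge0.
Qed.

(** The sum of two displacements is the midpoint of their doubles, so convexity costs a factor of
    two in the radius. *)
Lemma tangentD s1 s2 f g (d1 d2 : R) :
  (forall t, `|t| <= d1 -> s1 || (0 <= t) -> hull V (x + t *: f)) ->
  (forall t, `|t| <= d2 -> s2 || (0 <= t) -> hull V (x + t *: g)) ->
  forall t1 t2, `|t1| <= d1 / 2 -> `|t2| <= d2 / 2 -> s1 || (0 <= t1) -> s2 || (0 <= t2) ->
  hull V (x + t1 *: f + t2 *: g).
Proof.
move=> H1 H2 t1 t2 l1 l2 p1 p2.
have n2 (t : R) : `|2 * t| = 2 * `|t| by rewrite normrM ger0_norm.
apply: (@hull_convex (x + (2 * t1) *: f) (x + (2 * t2) *: g)).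
- by apply: H1; [rewrite n2; lra | case: (s1) p1 => //= ?; rewrite mulr_ge0].
- by apply: H2; [rewrite n2; lra | case: (s2) p2 => //= ?; rewrite mulr_ge0].
by exists (1 / 2); [lra | apply/rowP => ?; rewrite !mxE; field].
Qed.

Lemma tangent_add f g : tangent false f -> tangent false g -> tangent false (f + g).
Proof.
move=> [d d0 H] [d' d'0 H']; exists (Num.min (d / 2) (d' / 2)); first by rewrite lt_min !divr_gt0.
move=> t; rewrite le_min => /andP[td td'] t0; rewrite scalerDr addrA.
exact: (tangentD H H').
Qed.

Lemma tangent3 s1 s2 s3 f1 f2 f3 : tangent s1 f1 -> tangent s2 f2 -> tangent s3 f3 ->
  exists2 d : R, 0 < d & forall t1 t2 t3, `|t1| <= d -> `|t2| <= d -> `|t3| <= d ->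
    s1 || (0 <= t1) -> s2 || (0 <= t2) -> s3 || (0 <= t3) ->
    hull V (x + t1 *: f1 + t2 *: f2 + t3 *: f3).
Proof.
move=> [d1 d10 H1] [d2 d20 H2] [d3 d30 H3].
pose d := Num.min d1 (Num.min d2 d3).
have d0 : 0 < d by rewrite !lt_min d10 d20.
have [dd1 dd2 dd3] : [/\ d <= d1, d <= d2 & d <= d3] by rewrite /d !ge_min !lexx ?orbT; split.
exists (d / 4); first by rewrite divr_gt0.
move=> t1 t2 t3 l1 l2 l3 p1 p2 p3.
have n2 (t : R) : `|2 * t| = 2 * `|t| by rewrite normrM ger0_norm.
apply: (@hull_convex (x + (2 * t1) *: f1 + (2 * t2) *: f2) (x + (2 * t3) *: f3)).
- apply: (tangentD H1 H2); rewrite ?n2; try lra.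
    by case: (s1) p1 => //= ?; rewrite mulr_ge0.
  by case: (s2) p2 => //= ?; rewrite mulr_ge0.
- by apply: H3; [rewrite n2; lra | case: (s3) p3 => //= ?; rewrite mulr_ge0].
by exists (1 / 2); [lra | apply/rowP => ?; rewrite !mxE; field].
Qed.

Lemma tangent_vertex i : tangent false (V i - x).
Proof.
exists 1 => // t t1 /= t0; apply: (hull_convex hx (hull_vertex V i)).
by apply/segmentP; exists t; rewrite // t0 -(ger0_norm t0).
Qed.

Lemma tangent0 : tangent false 0.
Proof. by exists 1 => // t _ _; rewrite scaler0 addr0. Qed.

Lemma tangent_cone (w : 'I_n -> R) : (forall i, 0 <= w i) ->
  tangent false (\sum_i w i *: (V i - x)).
Proof.
move=> w0; apply: (big_ind (tangent false)); [exact: tangent0 | exact: tangent_add|].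
by move=> i _; apply: tangentZ => //; exact: tangent_vertex.
Qed.

(** If every direction were tangent, the coordinate directions would make [x] interior. A direction
    that is not tangent lies outside the cone of the [V i - x], and [farkas] separates it. *)
Lemma supporting_plane : ~ interior (hull V) x ->
  exists2 c : 'rV[R]_3, dotp c c = 1 & forall i, 0 <= dotp c (V i - x).
Proof.
move=> nint.
have [b bK] : exists b, ~ tangent false b.
  apply: contrapT => H; apply: nint; apply/nbhs_edistP.
  have tg f : tangent true f.
    by apply: tangent_line; apply: contrapT => K; apply: H; eexists; exact: K.
  have [d d0 Hd] := tangent3 (tg (delta_mx 0 ord0)) (tg (delta_mx 0 (lift ord0 ord0)))
    (tg (delta_mx 0 (lift ord0 (lift ord0 ord0)))).
  exists d => // y yd; pose z := y - x.
  have -> : y = x + z 0 ord0 *: delta_mx 0 ord0 + z 0 (lift ord0 ord0) *: delta_mx 0 (lift ord0 ord0)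
      + z 0 (lift ord0 (lift ord0 ord0)) *: delta_mx 0 (lift ord0 (lift ord0 ord0)).
    rewrite -!addrA -{1}(subrKC x y) -/z; congr (_ + _).
    by rewrite {1}(row_sum_delta z) !big_ord_recl big_ord0 addr0.
  have zd k : `|z 0 k| <= d.
    by rewrite (le_trans (ler_coord_enorm z k)) // ltW // -edistE edistC.
  exact: Hd.
case: (farkas (fun i => V i - x) b) => [[w w0 bE]|[c cp cb]].
  by case: bK; rewrite bE; exact: tangent_cone.
have cn0 : c != 0 by apply: contraTneq cb => ->; rewrite dotp0l ltxx.
have e0 : 0 < enorm c by rewrite enorm_gt0.
exists ((enorm c)^-1 *: c).
  exact: dotp_normalize.
by move=> i; rewrite dotpZl mulr_ge0 // invr_ge0 ltW.
Qed.

(** [x] balances the vertices by its weights. If [V k] has positive weight, the direction opposite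
    to [V k - x] is a nonnegative combination of the others, so [x] moves both ways along this
    line. *)
Lemma tangent_line_exists : (forall i, x != V i) ->
  exists2 u : 'rV[R]_3, dotp u u = 1 & tangent true u.
Proof.
move=> xV; have [v [v0 v1 xE]] := (hullP V x).1 hx.
have [k vk] : exists k, 0 < v k.
  apply: contrapT => H; have : \sum_i v i = 0.
    apply: big1 => i _; apply: le_anti; rewrite v0 andbT leNgt.
    by apply/negP => vi; apply: H; exists i.
  by rewrite v1 => /eqP; rewrite oner_eq0.
pose g := V k - x; have gn0 : g != 0 by rewrite subr_eq0 eq_sym.
have tg : tangent false (- g).
  have -> : - g = \sum_i (if i == k then 0 else v i / v k) *: (V i - x).
    have S0 : \sum_i v i *: (V i - x) = 0.
      under eq_bigr do rewrite scalerBr.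
      by rewrite sumrB -scaler_suml v1 scale1r -xE subrr.
    apply: (@scalerI _ _ (v k)); first by rewrite gt_eqF.
    rewrite (bigD1 k) //= eqxx scale0r add0r scaler_sumr.
    move: S0; rewrite (bigD1 k) //= => /eqP; rewrite addrC addr_eq0 -scalerN => /eqP <-.
    by apply: eq_bigr => i /negPf ->; rewrite scalerA mulrC divfK // gt_eqF.
  by apply: tangent_cone => i; case: eqP => // _; rewrite divr_ge0.
have e0 : 0 < enorm g by rewrite enorm_gt0.
exists ((enorm g)^-1 *: g).
  exact: dotp_normalize.
apply: tangentZ; first by rewrite invr_ge0 ltW.
by apply: tangent_line => //; exact: tangent_vertex.
Qed.

End TangentCone.

(* The sign of al i * ga j - ga i * al j tells on which side of (al i, ga i) lies (al j, ga j). *)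
Lemma clockwise_most (R : realType) (n : nat) (al ga : 'I_n -> R) :
  (forall i, 0 <= ga i) -> (exists i, ga i != 0) ->
  exists i, (al i != 0) || (ga i != 0) /\ forall j, 0 <= al i * ga j - ga i * al j.
Proof.
move=> g0 [k gk].
(* A vector on the boundary of the half plane that points to the positive side is extreme; if there
   is none, one takes the largest quotient [al i / ga i] over positive [ga i]. *)
have [[i [gi ai]]|H] := pselect (exists i, ga i = 0 /\ 0 < al i).
  exists i; rewrite gt_eqF //; split=> // j.
  by rewrite gi mul0r subr0 mulr_ge0 // ltW.
have gk0 : 0 < ga k by rewrite lt_neqAle eq_sym gk g0.
case: (arg_maxP (fun i => al i / ga i) (gk0 : (fun i => 0 < ga i) k)) => i gi imax.
exists i; rewrite (gt_eqF gi) orbT; split=> // j.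
have [gj|gj] := ltP 0 (ga j).
  have h : al j / ga j <= al i / ga i := imax j gj.
  have -> : al i * ga j - ga i * al j = (ga i * ga j) * (al i / ga i - al j / ga j).
    by field; rewrite (gt_eqF gi) (gt_eqF gj).
  by rewrite mulr_ge0 ?subr_ge0 // mulr_ge0 // ltW.
have gj0 : ga j = 0 by apply: le_anti; rewrite gj g0.
rewrite gj0 mulr0 sub0r oppr_ge0 pmulr_rle0 // leNgt; apply/negP => aj.
by apply: H; exists j.
Qed.

Lemma dotp_unit_le (R : realType) (m : nat) (c v : 'rV[R]_m) : dotp c c = 1 -> `|dotp c v| <= enorm v.
Proof.
move=> c1; have e1 : enorm c = 1 by rewrite /enorm c1 sqrtr1.
rewrite ler_norml; apply/andP; split.
  by rewrite lerNl -dotpNr (le_trans (dotp_CS _ _)) // e1 mul1r enormN.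
by rewrite (le_trans (dotp_CS _ _)) // e1 mul1r.
Qed.

(** * The boundary near a point as a wedge of two half planes *)

Section Wedge.
Variables (R : realType) (n : nat) (V : 'I_n -> 'rV[R]_3) (x : 'rV[R]_3).
Hypothesis PV : polytope_vertices V.
Hypothesis hx : hull V x.

Lemma tangentN f : tangent V x true f -> tangent V x true (- f).
Proof.
by move=> [d d0 H]; exists d => // t td _; rewrite scalerN -scaleNr; apply: H; rewrite ?normrN.
Qed.

Lemma tangent_lineZ f k : tangent V x true f -> tangent V x false (k *: f).
Proof.
move=> tf; have [k0|k0] := leP 0 k; first by apply: tangentZ => //; exact: tangent_side tf.
rewrite -[k *: f]opprK -scalerN -scaleNr; apply: tangentZ; first by rewrite oppr_ge0 ltW.
exact/tangent_side/tangentN.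
Qed.

(** [u] directs the common line of the half planes, [a] and [b] point into them orthogonally to it,
    and [na], [nb] are their unit normals towards the polytope. Both sides of [nab] are the sine of
    the dihedral angle. *)
Variables (u a b na nb : 'rV[R]_3).
Hypotheses (uu : dotp u u = 1) (aa : dotp a a = 1) (nana : dotp na na = 1)
  (ua : dotp u a = 0) (una : dotp u na = 0) (ana : dotp a na = 0)
  (bb : dotp b b = 1) (nbnb : dotp nb nb = 1)
  (ub : dotp u b = 0) (unb : dotp u nb = 0) (bnb : dotp b nb = 0).
Hypotheses (nab : dotp na b = dotp nb a) (nab0 : 0 <= dotp na b) (ab : a <> b).
Hypotheses (utan : tangent V x true u) (atan : tangent V x false a) (btan : tangent V x false b).
Hypotheses (HA : forall k, 0 <= dotp na (V k - x)) (HB : forall k, 0 <= dotp nb (V k - x)).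

Local Notation A y := (dotp na (y - x)).
Local Notation B y := (dotp nb (y - x)).

Let fa := orthonormal_frame uu aa nana ua una ana.
Let fb := orthonormal_frame uu bb nbnb ub unb bnb.

Lemma hull_side c y : (forall k, 0 <= dotp c (V k - x)) -> hull V y -> 0 <= dotp c (y - x).
Proof.
move=> Hc hy; rewrite dotpBr subr_ge0; apply: conv_hull_ge hy => _ [k _ <-].
by rewrite -subr_ge0 -dotpBr.
Qed.

(** If the sine vanishes, [b] is [a] or [- a], and [ab] leaves the second: [x] is then inside a
    facet. There [nb = - na] would force all vertices into one plane. *)
Lemma wedge_cases : 0 < dotp na b \/ [/\ dotp na b = 0, b = - a & nb = na].
Proof.
have [D0|D0] := eqVneq (dotp na b) 0; last by left; rewrite lt_neqAle eq_sym D0.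
right; have ba : b = - a.
  have bE : b = dotp a b *: a by rewrite {1}(fa b) ub D0 !scale0r add0r addr0.
  have : dotp a b ^+ 2 = 1 by rewrite -[RHS]bb [in RHS]bE !dotpE aa; ring.
  move=> /eqP; rewrite sqrf_eq1 => /orP[/eqP e|/eqP e].
    by case: ab; rewrite bE e scale1r.
  by rewrite bE e scaleN1r.
split=> //.
have nE : nb = dotp na nb *: na.
  have anb : dotp a nb = 0 by rewrite -[a]opprK -ba dotpNl bnb oppr0.
  by rewrite {1}(fa nb) unb anb !scale0r !add0r.
have : dotp na nb ^+ 2 = 1 by rewrite -[RHS]nbnb [in RHS]nE !dotpE nana; ring.
move=> /eqP; rewrite sqrf_eq1 => /orP[/eqP e|/eqP e]; first by rewrite nE e scale1r.
have nan0 : na != 0 by rewrite -dotp_eq0 nana oner_eq0.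
have [k /eqP[]] := vertices_not_coplanar PV x nan0.
have := HB k; rewrite nE e scaleN1r dotpNl oppr_ge0 => h.
by apply: le_anti; rewrite h HA.
Qed.

(** With positive sine, the coordinates of [y - x] along [a] and [b] are the distances to the two
    planes divided by the sine. In the flat case [u] and [a] are tangent both ways and [na] one
    way. *)
Lemma wedge_local : exists2 r, 0 < r & forall y, edist x y < r -> 0 <= A y -> 0 <= B y -> hull V y.
Proof.
have xyE (y : 'rV[R]_3) : enorm (y - x) = edist x y by rewrite edistC.
case: wedge_cases => [D0|[D0 ba nE]].
  have [d d0 H] := tangent3 utan atan btan.
  exists (Num.min d (d * dotp na b)); first by rewrite lt_min d0 mulr_gt0.
  move=> y; rewrite lt_min => /andP[yd yd'] Ay By.
  have Dn0 : dotp na b != 0 by rewrite gt_eqF.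
  have bE : b = dotp a b *: a + dotp na b *: na by rewrite {1}(fa b) ub scale0r add0r.
  have naE : na = (dotp na b)^-1 *: (b - dotp a b *: a).
    by rewrite {2}bE addrAC subrr add0r scalerA mulVf // scale1r.
  have yE : y - x = dotp u (y - x) *: u + (B y / dotp na b) *: a + (A y / dotp na b) *: b.
    have E1 : y - x = dotp u (y - x) *: u + (dotp a (y - x) - A y / dotp na b * dotp a b) *: a
        + (A y / dotp na b) *: b.
      rewrite {1}(fa (y - x)) -!addrA; congr (_ + _).
      rewrite {2}naE; move: (dotp a (y - x)) (A y) (dotp a b) (dotp na b) => p q r s.
      by row_ring.
    rewrite {1}E1; congr (_ + _ *: a + _).
    have := congr1 (dotp nb) E1; rewrite !dotpDr !dotpZr -nab (dotpC nb u) unb (dotpC nb b) bnb.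
    rewrite !mulr0 addr0 add0r -dotpDr => ->.
    by rewrite mulfK.
  rewrite -[y](subrKC x) yE !addrA; apply: H => //=.
  - by rewrite (le_trans (dotp_unit_le _ uu)) // xyE ltW.
  - rewrite ger0_norm ?divr_ge0 // ler_pdivrMr // (le_trans (ler_norm _)) //.
    by rewrite (le_trans (dotp_unit_le _ nbnb)) // xyE ltW.
  - rewrite ger0_norm ?divr_ge0 // ler_pdivrMr // (le_trans (ler_norm _)) //.
    by rewrite (le_trans (dotp_unit_le _ nana)) // xyE ltW.
  - by rewrite divr_ge0.
  - by rewrite divr_ge0.
have at2 : tangent V x true a by apply: tangent_line => //; rewrite -ba.
(* A vertex off the plane points along [na] up to a combination of [u] and [a], which may be
   subtracted since both are tangent in either sense. *)
have ntan : tangent V x false na.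
  have nan0 : na != 0 by rewrite -dotp_eq0 nana oner_eq0.
  have [k kn0] := vertices_not_coplanar PV x nan0.
  have kp : 0 < A (V k) by rewrite lt_neqAle eq_sym kn0 HA.
  have -> : na = (A (V k))^-1 *: ((V k - x) + (- dotp u (V k - x)) *: u + (- dotp a (V k - x)) *: a).
    apply: (@scalerI _ _ (A (V k))); first by rewrite gt_eqF.
    rewrite scalerA mulfV ?gt_eqF // scale1r {2}(fa (V k - x)).
    by move: (A _) (dotp u _) (dotp a _) => p q r; row_ring.
  apply: tangentZ; first by rewrite invr_ge0 ltW.
  apply: tangent_add; last exact: tangent_lineZ.
  by apply: tangent_add; [exact: tangent_vertex | exact: tangent_lineZ].
have [d d0 H] := tangent3 utan at2 ntan.
exists d => // y yd Ay By.
rewrite -[y](subrKC x) {1}(fa (y - x)) !addrA; apply: H => //=.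
- by rewrite (le_trans (dotp_unit_le _ uu)) // xyE ltW.
- by rewrite (le_trans (dotp_unit_le _ aa)) // xyE ltW.
- by rewrite (le_trans (dotp_unit_le _ nana)) // xyE ltW.
Qed.

Lemma wedge_not_interior c y : dotp c c = 1 -> (forall k, 0 <= dotp c (V k - x)) ->
  dotp c (y - x) = 0 -> ~ interior (hull V) y.
Proof.
move=> c1 Hc cy /nbhs_edistP[e e0 He].
have /(hull_side Hc) : hull V (y - (e / 2) *: c).
  apply: He; rewrite edistE opprB addrC subrK enormZ /enorm c1 sqrtr1 mulr1.
  by rewrite gtr0_norm ?divr_gt0 // ltr_pdivrMr // ltr_pMr // ltr1n.
rewrite addrAC dotpBr cy dotpZr c1 mulr1 sub0r oppr_ge0; lra.
Qed.

Lemma wedge_bdry : exists2 r, 0 < r & forall y, edist x y < r ->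
  bdry (hull V) y <-> [/\ 0 <= A y, 0 <= B y & A y = 0 \/ B y = 0].
Proof.
have [r r0 H] := wedge_local; exists r => // y yr; split; last first.
  move=> [Ay By AB]; split; first exact: H.
  by case: AB; [exact: wedge_not_interior | exact: wedge_not_interior].
move=> [hy ny]; have Ay := hull_side HA hy; have By := hull_side HB hy; split=> //.
apply: contrapT => /not_orP[/eqP An0 /eqP Bn0]; apply: ny; apply/nbhs_edistP.
have Ap : 0 < A y by rewrite lt_neqAle eq_sym An0.
have Bp : 0 < B y by rewrite lt_neqAle eq_sym Bn0.
exists (Num.min (r - edist x y) (Num.min (A y) (B y))); first by rewrite !lt_min subr_gt0 yr Ap.
move=> z; rewrite !lt_min => /and3P[z1 z2 z3].
have zE : z - x = (y - x) + (z - y) by row_ring.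
have side c : dotp c c = 1 -> edist y z < dotp c (y - x) -> 0 <= dotp c (z - x).
  move=> c1 lt; rewrite zE dotpDr; have := dotp_unit_le (z - y) c1.
  by rewrite ler_norml => /andP[+ _]; move: lt; rewrite edistC edistE; lra.
apply: H; [|exact: side|exact: side].
by rewrite (le_lt_trans (edist_triangle y _ _)) // -ltrBrDl.
Qed.

Lemma wedge_chart : exists2 r, 0 < r &
  (forall s t, `|s| < r -> `|t| < r -> 0 <= t ->
     bdry (hull V) (x + s *: u + t *: a) /\ bdry (hull V) (x + s *: u + t *: b)) /\
  (forall y, bdry (hull V) y -> edist x y < r -> exists s t, 0 <= t /\
     (y = x + s *: u + t *: a \/ y = x + s *: u + t *: b)).
Proof.
have [r r0 H] := wedge_bdry; exists (r / 2); first by rewrite divr_gt0.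
have Hr2 : r / 2 < r by rewrite ltr_pdivrMr // ltr_pMr // ltr1n.
split.
  have near (s t : R) v : dotp v v = 1 -> `|s| < r / 2 -> `|t| < r / 2 -> edist x (x + s *: u + t *: v) < r.
    move=> v1 sr tr; rewrite edistC edistE.
    have -> : x + s *: u + t *: v - x = s *: u + t *: v by row_ring.
    rewrite (le_lt_trans (ler_enormD _ _)) // !enormZ /enorm uu v1 sqrtr1; lra.
  move=> s t sr tr t0; split; (apply/H; first exact: near).
    have -> : x + s *: u + t *: a - x = s *: u + t *: a by row_ring.
    rewrite !dotpDr !dotpZr (dotpC na u) una (dotpC na a) ana (dotpC nb u) unb -nab !mulr0 addr0 add0r.
    by split=> //; [rewrite mulr_ge0 | left].
  have -> : x + s *: u + t *: b - x = s *: u + t *: b by row_ring.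
  rewrite !dotpDr !dotpZr (dotpC na u) una (dotpC nb b) bnb (dotpC nb u) unb !mulr0 addr0 add0r.
  by split=> //; [rewrite mulr_ge0 | right].
move=> y by_ yr; have /(H _ (lt_trans yr Hr2))[Ay By AB] := by_.
exists (dotp u (y - x)).
case: AB => [A0|B0].
  have yE : y = x + dotp u (y - x) *: u + dotp a (y - x) *: a.
    by rewrite -{1}[y](subrKC x) {1}(fa (y - x)) A0 scale0r addr0 !addrA.
  have yE' : y - x = dotp u (y - x) *: u + dotp a (y - x) *: a by rewrite {1}(fa (y - x)) A0 scale0r addr0.
  have BE : B y = dotp a (y - x) * dotp na b.
    rewrite [LHS](congr1 (dotp nb) yE') (dotpDr _ (_ *: _)) !dotpZr (dotpC nb u) unb -nab mulr0 add0r.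
    by [].
  case: wedge_cases => [D0|[_ ba _]].
    by exists (dotp a (y - x)); split; [rewrite -(pmulr_lge0 _ D0) -BE | left].
  have [a0|a0] := leP 0 (dotp a (y - x)); first by exists (dotp a (y - x)); split=> //; left.
  exists (- dotp a (y - x)); split; first by rewrite oppr_ge0 ltW.
  by right; rewrite ba scalerN scaleNr opprK.
have yE : y = x + dotp u (y - x) *: u + dotp b (y - x) *: b.
  by rewrite -{1}[y](subrKC x) {1}(fb (y - x)) B0 scale0r addr0 !addrA.
have yE' : y - x = dotp u (y - x) *: u + dotp b (y - x) *: b by rewrite {1}(fb (y - x)) B0 scale0r addr0.
have AE : A y = dotp b (y - x) * dotp na b.
  by rewrite [LHS](congr1 (dotp na) yE') (dotpDr _ (_ *: _)) !dotpZr (dotpC na u) una mulr0 add0r.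
case: wedge_cases => [D0|[_ ba _]].
  by exists (dotp b (y - x)); split; [rewrite -(pmulr_lge0 _ D0) -AE | right].
have [b0|b0] := leP 0 (dotp b (y - x)); first by exists (dotp b (y - x)); split=> //; right.
exists (- dotp b (y - x)); split; first by rewrite oppr_ge0 ltW.
by left; rewrite -[a]opprK -ba scalerN scaleNr opprK.
Qed.

End Wedge.

(** Projected along [u], the vertices lie in a half plane at [x]. The two extreme rays of the
    projected cone, given by [clockwise_most] for the configuration and its mirror image, are [a]
    and [b]. *)
Lemma boundary_chart (R : realType) (n : nat) (V : 'I_n -> 'rV[R]_3) (x : 'rV[R]_3) :
  polytope_vertices V -> bdry (hull V) x -> (forall i, x != V i) ->
  exists u a b : 'rV[R]_3, [/\ dotp u u = 1, dotp a a = 1 & dotp b b = 1] /\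
    [/\ dotp u a = 0, dotp u b = 0, a <> b & exists2 r, 0 < r &
      (forall s t, `|s| < r -> `|t| < r -> 0 <= t ->
         bdry (hull V) (x + s *: u + t *: a) /\ bdry (hull V) (x + s *: u + t *: b)) /\
      (forall y, bdry (hull V) y -> edist x y < r -> exists s t, 0 <= t /\
         (y = x + s *: u + t *: a \/ y = x + s *: u + t *: b))].
Proof.
move=> PV [hx nint] xV.
have [c cc cp] := supporting_plane hx nint.
have [u uu utan] := tangent_line_exists hx xV.
have uc : dotp u c = 0.
  have [d d0 H] := utan; have dn : `|d| <= d by rewrite gtr0_norm.
  have := hull_side cp (H _ dn isT); have := hull_side cp (H (- d) _ isT).
  rewrite normrN => /(_ dn); rewrite ![x + _]addrC !addrK scaleNr dotpNr dotpZr oppr_ge0.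
  rewrite pmulr_rle0 // pmulr_rge0 // dotpC => h1 h2.
  by apply: le_anti; rewrite h1 h2.
have [w0 w0n [w0u w0c]] := exists_orthogonal u c.
have [w [ww uw wc]] : exists w, [/\ dotp w w = 1, dotp u w = 0 & dotp w c = 0].
  exists ((enorm w0)^-1 *: w0); rewrite dotp_normalize // dotpZr dotpC w0u mulr0.
  by rewrite dotpZl w0c mulr0.
pose al k := dotp w (V k - x); pose ga k := dotp c (V k - x).
have cn0 : c != 0 by rewrite -dotp_eq0 cc oner_eq0.
have gan0 := vertices_not_coplanar PV x cn0.
have [i [ci Hi]] := clockwise_most al cp gan0.
have [j [cj Hj]] := clockwise_most (fun k => - al k) cp gan0.
have F := orthonormal_frame uu ww cc uw uc wc.
have ptan k : tangent V x false (al k *: w + ga k *: c).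
  have -> : al k *: w + ga k *: c = (V k - x) + (- dotp u (V k - x)) *: u.
    rewrite {1}(F (V k - x)) -/(al k) -/(ga k).
    by move: (al k) (ga k) (dotp u _) => p q r; row_ring.
  by apply: tangent_add; [exact: tangent_vertex | exact: tangent_lineZ].
pose e k := enorm (al k *: w + ga k *: c).
have normE p q p' q' : dotp (p *: w + q *: c) (p' *: w + q' *: c) = p * p' + q * q'.
  by rewrite !(dotpDl, dotpDr, dotpZl, dotpZr) ww cc (dotpC c w) wc; ring.
have e0 k : (al k != 0) || (ga k != 0) -> 0 < e k.
  move=> k0; rewrite enorm_gt0 -dotp_eq0 normE paddr_eq0 -?expr2 ?sqr_ge0 // !sqrf_eq0.
  by rewrite negb_and.
have eE k : al k ^+ 2 + ga k ^+ 2 = e k ^+ 2 by rewrite enorm_sqr normE !expr2.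
have ei := e0 _ ci; have ej : 0 < e j by apply: e0; rewrite -oppr_eq0.
have ein := lt0r_neq0 ei; have ejn := lt0r_neq0 ej.
pose vec (p q : R) := p *: w + q *: c.
have uvec p q : dotp u (vec p q) = 0 by rewrite dotpDr !dotpZr uw uc !mulr0 addr0.
have vecV p q k : dotp (vec p q) (V k - x) = p * al k + q * ga k by rewrite dotpDl !dotpZl.
have unit k p q : 0 < e k -> p ^+ 2 + q ^+ 2 = e k ^+ 2 -> dotp (vec (p / e k) (q / e k)) (vec (p / e k) (q / e k)) = 1.
  move=> ek E; rewrite normE; have ekn := lt0r_neq0 ek.
  have -> : p / e k * (p / e k) + q / e k * (q / e k) = (p ^+ 2 + q ^+ 2) / e k ^+ 2 by field.
  by rewrite E divff // expf_neq0.
exists u, (vec (al i / e i) (ga i / e i)), (vec (al j / e j) (ga j / e j)).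
have Hi' k : 0 <= dotp (vec (- ga i / e i) (al i / e i)) (V k - x).
  rewrite vecV.
  have -> : - ga i / e i * al k + al i / e i * ga k = (al i * ga k - ga i * al k) / e i by field.
  by apply: divr_ge0; [exact: Hi | exact: ltW].
have Hj' k : 0 <= dotp (vec (ga j / e j) (- al j / e j)) (V k - x).
  rewrite vecV.
  have -> : ga j / e j * al k + - al j / e j * ga k = (- al j * ga k - ga j * - al k) / e j by field.
  by apply: divr_ge0; [exact: Hj | exact: ltW].
have wvec p q : dotp w (vec p q) = p by rewrite dotpDr !dotpZr ww wc mulr1 mulr0 addr0.
have cvec p q : dotp c (vec p q) = q by rewrite dotpDr !dotpZr cc (dotpC c) wc mulr1 mulr0 add0r.
have nana : dotp (vec (- ga i / e i) (al i / e i)) (vec (- ga i / e i) (al i / e i)) = 1.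
  by apply: (unit i _ _ ei); rewrite sqrrN addrC; exact: eE.
have nbnb : dotp (vec (ga j / e j) (- al j / e j)) (vec (ga j / e j) (- al j / e j)) = 1.
  by apply: (unit j _ _ ej); rewrite sqrrN addrC; exact: eE.
have ab : vec (al i / e i) (ga i / e i) <> vec (al j / e j) (ga j / e j).
  move=> E; have Ec := congr1 (dotp c) E; have Ew := congr1 (dotp w) E.
  rewrite !cvec in Ec; rewrite !wvec in Ew.
  have n0 : vec (ga j / e j) (- al j / e j) != 0.
    by rewrite -dotp_eq0 nbnb oner_eq0.
  have [k /eqP[]] := vertices_not_coplanar PV x n0.
  have h1 := Hi' k; have h2 := Hj' k; rewrite !vecV !mulNr Ec Ew in h1 h2 *.
  clear - h1 h2; lra.
have aa := unit i _ _ ei (eE i); have bb := unit j _ _ ej (eE j).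
have ana : dotp (vec (al i / e i) (ga i / e i)) (vec (- ga i / e i) (al i / e i)) = 0.
  by rewrite normE; field.
have bnb : dotp (vec (al j / e j) (ga j / e j)) (vec (ga j / e j) (- al j / e j)) = 0.
  by rewrite normE; field.
have nab : dotp (vec (- ga i / e i) (al i / e i)) (vec (al j / e j) (ga j / e j)) =
    dotp (vec (ga j / e j) (- al j / e j)) (vec (al i / e i) (ga i / e i)).
  by rewrite !normE; field; rewrite ein ejn.
have nab0 : 0 <= dotp (vec (- ga i / e i) (al i / e i)) (vec (al j / e j) (ga j / e j)).
  rewrite normE.
  have -> : - ga i / e i * (al j / e j) + al i / e i * (ga j / e j) = (al i * ga j - ga i * al j) / e i / e j.
    by field; rewrite ein ejn.
  by apply: divr_ge0 (ltW ej); apply: divr_ge0 (ltW ei); exact: Hi.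
have vtan k : 0 < e k -> tangent V x false (vec (al k / e k) (ga k / e k)).
  move=> ek; have -> : vec (al k / e k) (ga k / e k) = (e k)^-1 *: (al k *: w + ga k *: c).
    by rewrite /vec scalerDr !scalerA ![_^-1 * _]mulrC.
  by apply: tangentZ (ptan k); rewrite invr_ge0 ltW.
refine (conj (And3 uu aa bb) (And4 (uvec _ _) (uvec _ _) ab _)).
exact: (@wedge_chart R n V x PV hx u _ _ _ _ uu aa nana (uvec _ _) (uvec _ _) ana bb nbnb
  (uvec _ _) (uvec _ _) bnb nab nab0 ab utan (vtan i ei) (vtan j ej) Hi' Hj').
Qed.

(** * Unfoldings *)

(** Continuation along an interval: local existence and uniqueness make the set of parameters where
    [m] fits both open and closed in the connected unit interval. *)
Lemma locally_constant_unit (R : realType) (M : Type) (rig : R -> M -> Prop) :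
  (forall t, 0 <= t <= 1 -> exists m, exists2 d, 0 < d &
     forall s, 0 <= s <= 1 -> `|s - t| < d -> rig s m) ->
  (forall t m m', 0 <= t <= 1 -> rig t m -> rig t m' -> m = m') ->
  forall m, rig 0 m -> rig 1 m.
Proof.
move=> loc uni m r0.
pose I01 : set R := [set` `[0, 1]].
have conn : connected I01 by exact: segment_connected.
pose B : set R := I01 `&` [set t | rig t m].
pose near (P : R -> Prop) : set R := [set t | exists2 d, 0 < d &
  forall s, 0 <= s <= 1 -> `|s - t| < d -> P s].
have near_open P : open (near P).
  rewrite openE => t [d d0 H]; apply/nbhs_ballP; exists (d / 2); first exact: divr_gt0.
  move=> s; rewrite /ball /= => st; exists (d / 2); first exact: divr_gt0.
  move=> w w01 ws; apply: H => //; rewrite -(subrK s w) -addrA (le_lt_trans (ler_normD _ _)) //.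
  by rewrite (distrC s); lra.
have in01 t : I01 t -> 0 <= t <= 1 by rewrite /I01 /= in_itv.
have BE : B = I01.
  apply: conn.
  - by exists 0; split => //; rewrite /I01 /= in_itv /= lexx ler01.
  - exists (near (rig ^~ m)); first exact: near_open.
    apply/seteqP; split => t [t01 H]; split => //.
      have [m' [d d0 Hd]] := loc t (in01 _ t01); exists d => // s s01 st.
      have rm' : rig t m' by apply: Hd; [exact: in01 | rewrite subrr normr0].
      by rewrite (uni t m m' (in01 _ t01) H rm'); exact: Hd.
    by have [d d0 Hd] := H; apply: Hd; [exact: in01|rewrite subrr normr0].
  - exists (~` near (fun s => ~ rig s m)); first exact/open_closedC/near_open.
    apply/seteqP; split => t [t01 H]; split => //.
      by move=> [d d0 Hd]; apply: (Hd t (in01 _ t01)) => //; rewrite subrr normr0.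
    have [m' [d d0 Hd]] := loc t (in01 _ t01).
    apply: contrapT => nr; apply: H; exists d => // s s01 st rm; apply: nr.
    rewrite (uni s m m' s01 rm (Hd _ s01 st)).
    by apply: Hd; [exact: in01|rewrite subrr normr0].
have : B 1 by rewrite BE /I01 /= in_itv /= lexx ler01.
by case.
Qed.

(** * Rigid motions of the plane *)

Section Rigid.
Variable R : realType.
Local Notation P2 := 'rV[R]_2.
Implicit Types (M : P2 * P2 * P2).

Definition aff M (s t : R) : P2 := M.1.1 + s *: M.1.2 + t *: M.2.

Definition orthonormal M := [/\ dotp M.1.2 M.1.2 = 1, dotp M.2 M.2 = 1 & dotp M.1.2 M.2 = 0].

Definition rigid_at (F : R -> R -> P2) (s t : R) M := exists2 d, 0 < d &
  forall s' t', `|s' - s| < d -> `|t' - t| < d -> F s' t' = aff M s' t'.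

Lemma rigid_at_inj F s t M M' : rigid_at F s t M -> rigid_at F s t M' -> M = M'.
Proof.
move=> [d d0 H] [d' d'0 H'].
pose e := Num.min d d' / 2.
have e0 : 0 < e by rewrite divr_gt0 // lt_min d0.
have [ed ed'] : e < d /\ e < d'.
  have : e < Num.min d d' by rewrite /e ltr_pdivrMr // ltr_pMr ?ltr1n // lt_min d0.
  by rewrite lt_min => /andP.
have eq s' t' : `|s' - s| <= e -> `|t' - t| <= e -> aff M s' t' = aff M' s' t'.
  by move=> h1 h2; rewrite -H ?(le_lt_trans _ ed) // -H' ?(le_lt_trans _ ed').
have nn : `|e| <= e by rewrite gtr0_norm.
have E0 : aff M s t = aff M' s t by apply: eq; rewrite subrr normr0 ltW.
have E1 : aff M (s + e) t = aff M' (s + e) t.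
  by apply: eq; rewrite ?subrr ?normr0 ?(ltW e0) // addrC addKr.
have E2 : aff M s (t + e) = aff M' s (t + e).
  by apply: eq; rewrite ?subrr ?normr0 ?(ltW e0) // addrC addKr.
have en0 : e != 0 by rewrite gt_eqF.
have e1 : M.1.2 = M'.1.2.
  apply: (scalerI en0); transitivity (aff M (s + e) t - aff M s t); first by rewrite /aff; row_ring.
  by rewrite E1 E0 /aff; row_ring.
have e2 : M.2 = M'.2.
  apply: (scalerI en0); transitivity (aff M s (t + e) - aff M s t); first by rewrite /aff; row_ring.
  by rewrite E2 E0 /aff; row_ring.
have e3 : M.1.1 = M'.1.1.
  transitivity (aff M s t - s *: M.1.2 - t *: M.2); first by rewrite /aff; row_ring.
  by rewrite E0 e1 e2 /aff; row_ring.
by case: M M' {E0 E1 E2 eq H H'} e1 e2 e3 => [[? ?] ?] [[? ?] ?] /= -> -> ->.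
Qed.

Lemma aff_dist M s t s' t' : orthonormal M ->
  dotp (aff M s t - aff M s' t') (aff M s t - aff M s' t') = (s - s') ^+ 2 + (t - t') ^+ 2.
Proof.
move=> [h1 h2 h3].
have -> : aff M s t - aff M s' t' = (s - s') *: M.1.2 + (t - t') *: M.2 by rewrite /aff; row_ring.
by rewrite !(dotpDl, dotpDr, dotpZl, dotpZr) (dotpC M.2) h1 h2 h3; ring.
Qed.

(** Polarisation turns distances into inner products of displacements from the corner (s0, t0), and
    the two axis displacements form an orthonormal frame. The separate equation at [s0 + d] lets two
    such motions be compared along a common line. *)
Lemma isometry_aff (D : R -> R -> Prop) (G : R -> R -> P2) (s0 t0 d e : R) :
  d != 0 -> e != 0 -> D s0 t0 -> D (s0 + d) t0 -> D s0 (t0 + e) ->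
  (forall s t s' t', D s t -> D s' t' ->
     dotp (G s t - G s' t') (G s t - G s' t') = (s - s') ^+ 2 + (t - t') ^+ 2) ->
  exists a1 a2, [/\ dotp a1 a1 = 1, dotp a2 a2 = 1, dotp a1 a2 = 0,
    G (s0 + d) t0 = G s0 t0 + d *: a1 & forall s t, D s t -> G s t = G s0 t0 + (s - s0) *: a1 + (t - t0) *: a2].
Proof.
move=> dn en D0 D1 D2 iso.
have [v vE] : exists v, forall s t, v s t = G s t - G s0 t0 by exists (fun s t => G s t - G s0 t0).
have vv s t s' t' : D s t -> D s' t' -> dotp (v s t) (v s' t') = (s - s0) * (s' - s0) + (t - t0) * (t' - t0).
  move=> Dst Dst'; have h1 := iso _ _ _ _ Dst D0; have h2 := iso _ _ _ _ Dst' D0.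
  rewrite -!vE in h1 h2.
  have := iso _ _ _ _ Dst Dst'.
  have -> : G s t - G s' t' = v s t - v s' t' by rewrite !vE; row_ring.
  rewrite !(dotpBl, dotpBr) (dotpC (v s' t')) h1 h2 => h3; lra.
pose a1 := d^-1 *: v (s0 + d) t0; pose a2 := e^-1 *: v s0 (t0 + e).
have h1 : dotp a1 a1 = 1 by rewrite dotpZl dotpZr vv //; field.
have h2 : dotp a2 a2 = 1 by rewrite dotpZl dotpZr vv //; field.
have h3 : dotp a1 a2 = 0 by rewrite dotpZl dotpZr vv //; field; rewrite dn en.
exists a1, a2; split=> //; first by rewrite /a1 vE scalerA mulfV // scale1r subrKC.
move=> s t Dst; have := orthonormal_pair h1 h2 h3 (v s t).
rewrite {1}vE => /eqP; rewrite subr_eq addrC addrA => /eqP ->.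
congr (_ + _ *: _ + _ *: _); rewrite dotpZl vv //; field; [exact: dn|exact: en].
Qed.

End Rigid.

(** * The unfolding in a chart around a point other than a vertex *)

Section Unfold.
Variables (R : realType) (n : nat) (V : 'I_n -> 'rV[R]_3) (T : set 'rV[R]_3) (f : 'rV[R]_3 -> 'rV[R]_2).
Hypothesis PV : polytope_vertices V.
Local Notation S := (bdry (hull V)).
Hypothesis Tclosed : closed T.
Hypothesis finj : forall x y, (S `\` T) x -> (S `\` T) y -> f x = f y -> x = y.
Hypothesis floc : forall x, (S `\` T) x -> exists2 r : R, 0 < r &
  forall y z, (S `\` T) y -> (S `\` T) z -> edist x y < r -> edist x z < r ->
    segment y z `<=` S -> edist (f y) (f z) = edist y z.

Section AtPoint.
Variables (x u a b : 'rV[R]_3) (r : R).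
Hypotheses (uu : dotp u u = 1) (aa : dotp a a = 1) (bb : dotp b b = 1)
  (ua : dotp u a = 0) (ub : dotp u b = 0) (ab : a <> b).
Hypotheses (r0 : 0 < r)
  (chS : forall s t, `|s| < r -> `|t| < r -> 0 <= t ->
     S (x + s *: u + t *: a) /\ S (x + s *: u + t *: b))
  (chT : forall y, S y -> edist x y < r -> exists s t, 0 <= t /\
     (y = x + s *: u + t *: a \/ y = x + s *: u + t *: b)).

(* Folds the plane along the line t = 0 onto the two half planes bounded by x + R u. *)
Definition phi (s t : R) := x + s *: u + (if 0 <= t then t *: a else (- t) *: b).

Lemma phi_ge s t : 0 <= t -> phi s t = x + s *: u + t *: a.
Proof. by rewrite /phi => ->. Qed.

Lemma phi_le s t : t <= 0 -> phi s t = x + s *: u + (- t) *: b.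
Proof.
rewrite /phi => t0; case: ifP => // t1.
by have -> : t = 0 by [apply: le_anti; rewrite t0 t1]; rewrite oppr0 !scale0r.
Qed.

Lemma phi_S s t : `|s| < r -> `|t| < r -> S (phi s t).
Proof.
move=> sr tr; have [t0|t0] := leP 0 t.
  by rewrite (phi_ge _ t0); exact: (chS sr tr t0).1.
by rewrite phi_le ?ltW //; case: (chS (t := - t) sr); rewrite ?normrN ?oppr_ge0 ?ltW.
Qed.

Lemma phi_onto y : S y -> edist x y < r -> exists s t, y = phi s t.
Proof.
move=> Sy yr; have [s [t [t0 [->|->]]]] := chT Sy yr; exists s.
  by exists t; rewrite phi_ge.
by exists (- t); rewrite phi_le ?opprK // oppr_le0.
Qed.

Lemma phi0 : phi 0 0 = x.
Proof. by rewrite phi_ge // !scale0r !addr0. Qed.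

Lemma phiZ k s t : 0 <= k -> phi (k * s) (k * t) = x + k *: (phi s t - x).
Proof.
move=> k0; have [t0|t0] := leP 0 t.
  by rewrite !phi_ge ?mulr_ge0 //; row_ring.
by rewrite !phi_le ?(ltW t0) //; [row_ring | rewrite mulr_ge0_le0 // ltW].
Qed.

Lemma enorm_ua s t : dotp (s *: u + t *: a) (s *: u + t *: a) = s ^+ 2 + t ^+ 2.
Proof. by rewrite !(dotpDl, dotpDr, dotpZl, dotpZr) (dotpC a) uu aa ua; ring. Qed.

Lemma enorm_ub s t : dotp (s *: u + t *: b) (s *: u + t *: b) = s ^+ 2 + t ^+ 2.
Proof. by rewrite !(dotpDl, dotpDr, dotpZl, dotpZr) (dotpC b) uu bb ub; ring. Qed.

Lemma phi_lip s t s' t' : edist (phi s t) (phi s' t') <= `|s - s'| + `|t - t'|.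
Proof.
have E v w (p q : R) : x + s *: u + p *: v - (x + s' *: u + q *: w) = (s - s') *: u + (p *: v - q *: w) by row_ring.
have eu : enorm u = 1 by rewrite /enorm uu sqrtr1.
have ea : enorm a = 1 by rewrite /enorm aa sqrtr1.
have eb : enorm b = 1 by rewrite /enorm bb sqrtr1.
have D v : enorm ((s - s') *: u + v) <= `|s - s'| + enorm v.
  by rewrite (le_trans (ler_enormD _ _)) // enormZ eu mulr1.
rewrite edistE; case: (leP 0 t) => t0; case: (leP 0 t') => t0'.
- rewrite !phi_ge // E (le_trans (D _)) // lerD2l -scalerBl enormZ ea mulr1 //.
- rewrite phi_ge // phi_le ?(ltW t0') // E (le_trans (D _)) // lerD2l.
  rewrite (le_trans (ler_enormD _ _)) // enormN !enormZ ea eb !mulr1 normrN.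
  by rewrite (ger0_norm t0) (ltr0_norm t0') ger0_norm // subr_ge0 ltW // (lt_le_trans t0').
- rewrite phi_le ?(ltW t0) // phi_ge // E (le_trans (D _)) // lerD2l.
  rewrite (le_trans (ler_enormD _ _)) // enormN !enormZ ea eb !mulr1 normrN.
  by rewrite (ger0_norm t0') (ltr0_norm t0) ltr0_norm ?subr_lt0 ?(lt_le_trans t0) // opprB addrC.
- rewrite !phi_le ?(ltW t0) ?(ltW t0') // E (le_trans (D _)) // lerD2l -scalerBl enormZ eb mulr1.
  by rewrite -opprD normrN.
Qed.

Lemma phi_inj s t s' t' : phi s t = phi s' t' -> s = s' /\ t = t'.
Proof.
have du s1 t1 : dotp u (phi s1 t1) = dotp u x + s1.
  by rewrite /phi; case: ifP => _; rewrite !(dotpDr, dotpZr) uu ?ua ?ub; ring.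
move=> E; have ss : s = s'.
  by apply: (@addrI _ (dotp u x)); rewrite -(du s t) E du.
split=> //; move: E; rewrite /phi ss => /addrI.
have e1 (p : R) v : 0 <= p -> dotp v v = 1 -> enorm (p *: v) = p.
  by move=> p0 v1; rewrite enormZ /enorm v1 sqrtr1 mulr1 ger0_norm.
case: (leP 0 t) => t0; case: (leP 0 t') => t0' E; have := congr1 (@enorm _ _) E; rewrite !e1 ?oppr_ge0 ?(ltW t0) ?(ltW t0') //.
- move=> tt; exfalso; apply: ab; have t0'' : - t' != 0 by rewrite oppr_eq0 lt_eqF.
  by apply: (scalerI t0''); rewrite -E tt.
- move=> tt; exfalso; apply: ab; have t0'' : - t != 0 by rewrite oppr_eq0 lt_eqF.
  by apply: (scalerI t0''); rewrite E -tt.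
- exact: oppr_inj.
Qed.

(** On one side of the fold [phi] is an isometry onto a flat piece of the surface, the situation in
    which [floc] applies. *)
Lemma phi_side s t s' t' : (0 <= t /\ 0 <= t' \/ t <= 0 /\ t' <= 0) ->
  `|s| < r -> `|t| < r -> `|s'| < r -> `|t'| < r ->
  dotp (phi s t - phi s' t') (phi s t - phi s' t') = (s - s') ^+ 2 + (t - t') ^+ 2 /\
  segment (phi s t) (phi s' t') `<=` S.
Proof.
move=> side sr tr sr' tr'; split.
  case: side => -[t0 t0'].
    rewrite !phi_ge //; have -> : x + s *: u + t *: a - (x + s' *: u + t' *: a) = (s - s') *: u + (t - t') *: a by row_ring.
    exact: enorm_ua.
  rewrite !phi_le //; have -> : x + s *: u + - t *: b - (x + s' *: u + - t' *: b) = (s - s') *: u + (t' - t) *: b by row_ring.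
  by rewrite enorm_ub; ring.
move=> y [k /andP[k0 k1] ->].
have -> : (1 - k) *: phi s t + k *: phi s' t' = phi ((1 - k) * s + k * s') ((1 - k) * t + k * t').
  case: side => -[t0 t0'].
    by rewrite !phi_ge //; [row_ring | nra].
  by rewrite !phi_le //; [row_ring | nra].
by apply: phi_S; apply: ltr_norm_conv; rewrite ?k0.
Qed.

(** Off the fold one half plane suffices. On it, the motions of both halves agree along the line, so
    their second frame vectors are equal or opposite. If opposite, mirror points would have one
    image, against [finj]. *)
Lemma phi_rigid s0 t0 : `|s0| < r -> `|t0| < r -> ~ T (phi s0 t0) ->
  exists2 M, orthonormal M & rigid_at (fun s t => f (phi s t)) s0 t0 M.
Proof.
move=> sr tr nT.
have [e e0 He] := closed_away Tclosed nT.
have Sx : (S `\` T) (phi s0 t0) by split=> //; exact: phi_S.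
have [rf rf0 Hf] := floc Sx.
have [d d0 [de df ds dt]] : exists2 d, 0 < d & [/\ d + d <= e, d + d <= rf, `|s0| + d <= r & `|t0| + d <= r].
  exists (Num.min (Num.min (e / 2) (rf / 2)) (Num.min (r - `|s0|) (r - `|t0|))).
    by rewrite !lt_min !divr_gt0 // !subr_gt0 sr tr.
  set d := Num.min _ _.
  have : d <= Num.min (Num.min (e / 2) (rf / 2)) (Num.min (r - `|s0|) (r - `|t0|)) by [].
  by rewrite !le_min => /andP[/andP[? ?] /andP[? ?]]; split; lra.
pose F s t := f (phi s t).
have box s t : `|s - s0| < d -> `|t - t0| < d ->
    [/\ `|s| < r, `|t| < r, (S `\` T) (phi s t) & edist (phi s0 t0) (phi s t) < rf].
  move=> sd td.
  have s1 : `|s| < r by rewrite -(subrKC s0 s) (le_lt_trans (ler_normD _ _)) //; lra.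
  have t1 : `|t| < r by rewrite -(subrKC t0 t) (le_lt_trans (ler_normD _ _)) //; lra.
  have lip : edist (phi s0 t0) (phi s t) < d + d.
    by rewrite (le_lt_trans (phi_lip _ _ _ _)) // (distrC s0) (distrC t0); lra.
  split=> //; last exact: lt_le_trans lip df.
  by split; [exact: phi_S | apply: He; exact: lt_le_trans lip de].
have iso s t s' t' : `|s - s0| < d -> `|t - t0| < d -> `|s' - s0| < d -> `|t' - t0| < d ->
    (0 <= t /\ 0 <= t' \/ t <= 0 /\ t' <= 0) ->
    dotp (F s t - F s' t') (F s t - F s' t') = (s - s') ^+ 2 + (t - t') ^+ 2.
  move=> h1 h2 h3 h4 side; have [q1 q2 q3 q4] := box _ _ h1 h2; have [q1' q2' q3' q4'] := box _ _ h3 h4.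
  have [E seg] := phi_side side q1 q2 q1' q2'.
  rewrite -E -!enorm_sqr -!edistE; congr (_ ^+ 2).
  exact: Hf.
have zz : `|0 : R| < d by rewrite normr0.
have dd2 : `|d / 2| < d by rewrite gtr0_norm ?divr_gt0 // ltr_pdivrMr // ltr_pMr // ltr1n.
have d2n : d / 2 != 0 by rewrite gt_eqF // divr_gt0.
have k1 (s : R) : s + d / 2 - s = d / 2 by ring.
have k2 (s : R) : s + - (d / 2) - s = - (d / 2) by ring.
have mk (p a1 a2 : 'rV[R]_2) : dotp a1 a1 = 1 -> dotp a2 a2 = 1 -> dotp a1 a2 = 0 ->
    (exists2 d', 0 < d' & forall s t, `|s - s0| < d' -> `|t - t0| < d' -> F s t = p + (s - s0) *: a1 + (t - t0) *: a2) ->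
    exists2 M, orthonormal M & rigid_at F s0 t0 M.
  move=> h1 h2 h3 [d' d'0 H]; exists (p - s0 *: a1 - t0 *: a2, a1, a2); first by split.
  by exists d' => // s t sd td; rewrite H // /aff /=; row_ring.
have [tp|tn|tz] := ltgtP 0 t0.
- pose D s t := `|s - s0| < d /\ `|t - t0| < d /\ 0 <= t.
  have c1 : D s0 t0.
    by split; [|split]; rewrite ?subrr ?(ltW tp).
  have c2 : D (s0 + d / 2) t0.
    by split; [|split]; rewrite ?subrr ?k1 ?(ltW tp).
  have c3 : D s0 (t0 + d / 2).
    by split; [|split]; rewrite ?subrr ?k1 // addr_ge0 ?(ltW tp) // divr_ge0 // ltW.
  have c4 : forall s t s' t', D s t -> D s' t' ->
      dotp (F s t - F s' t') (F s t - F s' t') = (s - s') ^+ 2 + (t - t') ^+ 2.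
    by move=> s t s' t' [? [? ?]] [? [? ?]]; apply: iso => //; left.
  have [a1 [a2 [h1 h2 h3 _ H]]] := isometry_aff d2n d2n c1 c2 c3 c4.
  apply: (mk _ _ _ h1 h2 h3); exists (Num.min d t0); first by rewrite lt_min d0.
  move=> s t; rewrite !lt_min => /andP[sd _] /andP[td tt]; apply: H; split=> //; split=> //.
  by move: tt; rewrite ltr_norml => /andP[]; lra.
- pose D s t := `|s - s0| < d /\ `|t - t0| < d /\ t <= 0.
  have d2n' : - (d / 2) != 0 by rewrite oppr_eq0.
  have c1 : D s0 t0.
    by split; [|split]; rewrite ?subrr ?(ltW tn).
  have c2 : D (s0 + d / 2) t0.
    by split; [|split]; rewrite ?subrr ?k1 ?(ltW tn).
  have c3 : D s0 (t0 + - (d / 2)).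
    split; [|split]; rewrite ?subrr ?k2 ?normrN //; lra.
  have c4 : forall s t s' t', D s t -> D s' t' ->
      dotp (F s t - F s' t') (F s t - F s' t') = (s - s') ^+ 2 + (t - t') ^+ 2.
    by move=> s t s' t' [? [? ?]] [? [? ?]]; apply: iso => //; right.
  have [a1 [a2 [h1 h2 h3 _ H]]] := isometry_aff d2n d2n' c1 c2 c3 c4.
  apply: (mk _ _ _ h1 h2 h3); exists (Num.min d (- t0)); first by rewrite lt_min d0 oppr_gt0.
  move=> s t; rewrite !lt_min => /andP[sd _] /andP[td tt]; apply: H; split=> //; split=> //.
  by move: tt; rewrite ltr_norml => /andP[]; lra.
rewrite -tz in box iso mk *.
pose D1 s t := `|s - s0| < d /\ `|t - 0| < d /\ 0 <= t.
pose D2 s t := `|s - s0| < d /\ `|t - 0| < d /\ t <= 0.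
have c1 : D1 s0 0.
  by split; [|split]; rewrite ?subrr.
have c2 : D1 (s0 + d / 2) 0.
  by split; [|split]; rewrite ?subrr ?k1.
have c3 : D1 s0 (0 + d / 2).
  by split; [|split]; rewrite ?subrr ?k1 // add0r divr_ge0 // ltW.
have c4 : forall s t s' t', D1 s t -> D1 s' t' ->
    dotp (F s t - F s' t') (F s t - F s' t') = (s - s') ^+ 2 + (t - t') ^+ 2.
  by move=> s t s' t' [? [? ?]] [? [? ?]]; apply: iso => //; left.
have [a1 [a2 [h1 h2 h3 ha H1]]] := isometry_aff d2n d2n c1 c2 c3 c4.
have d2n' : - (d / 2) != 0 by rewrite oppr_eq0.
have c1' : D2 s0 0.
  by split; [|split]; rewrite ?subrr.
have c2' : D2 (s0 + d / 2) 0.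
  by split; [|split]; rewrite ?subrr ?k1.
have c3' : D2 s0 (0 + - (d / 2)).
  by split; [|split]; rewrite ?subrr ?k2 ?normrN // add0r oppr_le0 divr_ge0 // ltW.
have c4' : forall s t s' t', D2 s t -> D2 s' t' ->
    dotp (F s t - F s' t') (F s t - F s' t') = (s - s') ^+ 2 + (t - t') ^+ 2.
  by move=> s t s' t' [? [? ?]] [? [? ?]]; apply: iso => //; right.
have [b1 [b2 [g1 g2 g3 hb H2]]] := isometry_aff d2n d2n' c1' c2' c3' c4'.
have ab1 : b1 = a1 by apply: (scalerI d2n); apply: (@addrI _ (F s0 0)); rewrite -ha -hb.
have b2E : b2 = dotp a2 b2 *: a2.
  by rewrite {1}(orthonormal_pair h1 h2 h3 b2) -{1}ab1 g3 scale0r add0r.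
have : dotp a2 b2 ^+ 2 = 1 by rewrite -[RHS]g2 [in RHS]b2E dotpZl dotpZr h2; ring.
move=> /eqP; rewrite sqrf_eq1 => /orP[/eqP E|/eqP E]; rewrite E ?scale1r ?scaleN1r in b2E.
  apply: (mk _ _ _ h1 h2 h3); exists d => // s t sd td.
  by have [t0p|/ltW t0n] := leP 0 t; [exact: H1 | rewrite H2 // ab1 b2E].
exfalso.
have e1 : F s0 (d / 2) = F s0 0 + (s0 - s0) *: a1 + (d / 2 - 0) *: a2.
  by apply: H1; split; [|split]; rewrite ?subrr ?subr0 // divr_ge0 // ltW.
have e2 : F s0 (- (d / 2)) = F s0 0 + (s0 - s0) *: b1 + (- (d / 2) - 0) *: b2.
  by apply: H2; split; [|split]; rewrite ?subrr ?subr0 ?normrN // oppr_le0 divr_ge0 // ltW.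
have EF : F s0 (d / 2) = F s0 (- (d / 2)).
  by rewrite e1 e2 b2E !subrr !scale0r !subr0 scalerN scaleNr opprK.
have bx1 : (S `\` T) (phi s0 (d / 2)) by case: (box s0 (d / 2)); rewrite ?subrr ?subr0.
have bx2 : (S `\` T) (phi s0 (- (d / 2))) by case: (box s0 (- (d / 2))); rewrite ?subrr ?subr0 ?normrN.
have [_] := phi_inj (finj bx1 bx2 EF).
by move=> dd; move: d0; lra.
Qed.

End AtPoint.

(** This keeps from [phi] only what the study of leaves calls for: rays from [x], a Lipschitz bound,
    injectivity and rigidity off [T]. The two half planes are forgotten. *)
Definition chart (x : 'rV[R]_3) (ph : R -> R -> 'rV[R]_3) (r : R) :=
  [/\ 0 < r, ph 0 0 = x,
      forall s t, `|s| < r -> `|t| < r -> S (ph s t) &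
      forall y, S y -> edist x y < r -> exists s t, y = ph s t] /\
  [/\ forall k s t, 0 <= k -> ph (k * s) (k * t) = x + k *: (ph s t - x),
      forall s t s' t', edist (ph s t) (ph s' t') <= `|s - s'| + `|t - t'|,
      forall s t s' t', ph s t = ph s' t' -> s = s' /\ t = t' &
      forall s0 t0, `|s0| < r -> `|t0| < r -> ~ T (ph s0 t0) ->
        exists2 M, orthonormal M & rigid_at (fun s t => f (ph s t)) s0 t0 M].

Lemma chart_exists x : S x -> (forall i, x != V i) -> exists ph r, chart x ph r.
Proof.
move=> Sx xV; have [u [a [b [[uu aa bb] [ua ub ab [r r0 [chS chT]]]]]]] := boundary_chart PV Sx xV.
exists (phi x u a b), r; split; split.
- by [].
- exact: phi0.
- by move=> s t; apply: phi_S chS s t.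
- by move=> y; apply: phi_onto chT y.
- by move=> k s t; apply: phiZ.
- by move=> s t s' t'; apply: phi_lip.
- by move=> s t s' t'; apply: phi_inj.
- move=> s0 t0; exact: (phi_rigid uu aa bb ua ub ab chS).
Qed.

End Unfold.

(** * A simple closed polygon has no end points *)

Section PolygonEnd.
Variables (R : realType) (m : nat) (q : nat -> 'rV[R]_2).
Hypothesis sq : simple_closed_polygon m q.
Local Notation J := (polygon_boundary m q).

Lemma poly_side_boundary i : (i < m)%N -> poly_side m q i `<=` J.
Proof. by move=> im z zi; exists i. Qed.

Lemma closed_polygon_boundary : closed J.
Proof.
have -> : J = \bigcup_(i in [set` finset.setT : {set 'I_m}]) poly_side m q i.
  apply/seteqP; split=> z [i im zi]; last by exists i => //=; exact: ltn_ord.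
  by exists (Ordinal im) => //=; rewrite finset.in_setT.
by apply: closed_bigcup => // i _; exact: closed_segment.
Qed.

(** Two pieces of sides leave every point of the polygon and meet only there. If the polygon near
    [z] lay on one ray from [z], they would overlap. *)
Lemma polygon_no_end (z v : 'rV[R]_2) (e : R) : J z -> 0 < e ->
  (forall y, J y -> edist z y < e -> exists2 k, 0 <= k & y = z + k *: v) -> False.
Proof.
case: sq => m3 qinj sides [i im zi] e0 ray.
have m0 : (0 < m)%N by apply: leq_trans m3.
have ray1 w : w != z -> segment z w `<=` J -> exists2 k, 0 < k & w = z + k *: v.
  move=> wz sJ; rewrite eq_sym in wz; have [t [t0 t1 te]] := segment_initial wz e0.
  have [|k k0 kE] := ray _ _ te; first by apply/sJ/segmentP; exists t; rewrite ?(ltW t0).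
  have wE : w = z + (k / t) *: v.
    have /addrI E := kE; rewrite [k / t]mulrC -scalerA -E scalerA mulVf ?gt_eqF // scale1r.
    by rewrite subrKC.
  exists (k / t) => //; rewrite lt_neqAle divr_ge0 ?(ltW t0) // andbT eq_sym.
  by apply: contraNneq wz => k00; rewrite wE k00 scale0r addr0.
have two w1 w2 : w1 != z -> w2 != z -> segment z w1 `<=` J -> segment z w2 `<=` J ->
    segment z w1 `&` segment z w2 `<=` [set z] -> False.
  move=> w1z w2z s1 s2 s12; have [k1 k10 E1] := ray1 _ w1z s1; have [k2 k20 E2] := ray1 _ w2z s2.
  have sub (p r : R) : 0 < p -> p <= r -> segment z (z + r *: v) (z + p *: v).
    move=> p0 pr; have r0 := lt_le_trans p0 pr; apply/segmentP; exists (p / r).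
      by rewrite divr_ge0 ?(ltW p0) ?(ltW r0) //= ler_pdivrMr // mul1r.
    by rewrite [_ - z]addrC addKr scalerA divfK // gt_eqF.
  have [le|le] := leP k1 k2.
    have : (segment z w1 `&` segment z w2) w1 by split; [exact: segment_r | rewrite E1 E2; exact: sub].
    by move=> /s12 /= /eqP; exact/negP.
  have : (segment z w1 `&` segment z w2) w2.
    by split; [rewrite E1 E2; apply: sub => //; exact: ltW | exact: segment_r].
  by move=> /s12 /= /eqP; exact/negP.
have vertex k : (k < m)%N -> z = q k -> False.
  (* At [q 0] the preceding side is the last one, [m.-1]; elsewhere it has the previous index. *)
  move=> km zk; case: k km zk => [|k] km zk.
    have m1 : (m.-1 < m)%N by rewrite prednK.
    have := sides 0%N m.-1 ltac:(lia) m1.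
    have -> : (m.-1 == 1)%N = false by lia.
    rewrite !eqxx /= /poly_side prednK // modnn (modn_small (_ : (1 < m)%N)); last by lia.
    rewrite (segmentC (q m.-1)) -zk => S0.
    apply: (@two (q 1%N) (q m.-1)); rewrite ?S0 //.
    - by apply/eqP; rewrite zk => /qinj; lia.
    - by apply/eqP; rewrite zk => /qinj; lia.
    - have := @poly_side_boundary 0%N m0; rewrite /poly_side modn_small -?zk //; lia.
    - by have := @poly_side_boundary m.-1 m1; rewrite /poly_side prednK // modnn segmentC -zk.
  have km' : (k < m)%N by lia.
  have := sides k k.+1 (ltnSn k) km; rewrite eqxx /poly_side (modn_small km) (segmentC (q k)) -zk => S0.
  have nk : (k.+2 %% m < m)%N by rewrite ltn_mod.
  apply: (@two (q k) (q (k.+2 %% m)%N)); rewrite ?S0 //.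
  - by apply/eqP; rewrite zk => /qinj; lia.
  - apply/eqP; rewrite zk => /(qinj _ _ nk km).
    have [k2|k2] := ltnP k.+2 m; first by rewrite modn_small //; lia.
    have -> : k.+2 = m by lia.
    by rewrite modnn.
  - by have := poly_side_boundary km'; rewrite /poly_side (modn_small km) segmentC -zk.
  - by have := poly_side_boundary km; rewrite /poly_side -zk.
have [/eqP zi0|zi0] := boolP (z == q i); first exact: vertex zi0.
have im' : (i.+1 %% m < m)%N by rewrite ltn_mod.
have [/eqP zi1|zi1] := boolP (z == q (i.+1 %% m)%N); first exact: vertex zi1.
have sJ : segment (q i) (q (i.+1 %% m)%N) `<=` J by exact: (poly_side_boundary im).
have [||k1 k10 E1] := ray1 (q i); first by rewrite eq_sym.
  by apply: subset_trans sJ; rewrite segmentC; exact: segment_subl.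
have [||k2 k20 E2] := ray1 (q (i.+1 %% m)%N); first by rewrite eq_sym.
  by apply: subset_trans sJ; exact: segment_subr.
have [t /andP[t0 t1] tE] := (segmentP _ _ _).1 zi.
(* For [z] inside a side, both ends lie on the ray from [z], while [z] is a convex combination of
   them. *)
have : ((1 - t) * k1 + t * k2) *: v = 0.
  transitivity ((1 - t) *: (q i - z) + t *: (q (i.+1 %% m)%N - z)).
    by rewrite E1 E2; row_ring.
  by rewrite {1 2}tE; row_ring.
move/eqP; rewrite scaler_eq0 => /orP[/eqP E|/eqP v0].
  have : 0 <= (1 - t) * k1 by rewrite mulr_ge0 ?subr_ge0 // ltW.
  have : 0 <= t * k2 by rewrite mulr_ge0 // ltW.
  by nra.
by case/negP: zi0; rewrite E1 v0 scaler0 addr0.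
Qed.

End PolygonEnd.

Lemma normr_sub_lt (R : realType) (a b c e : R) : `|a - b| < e / 2 -> `|b - c| < e / 2 -> `|a - c| < e.
Proof. by move=> h1 h2; rewrite -(subrK b a) -addrA (le_lt_trans (ler_normD _ _)) //; lra. Qed.

(** * A square slit along a ray *)

Section Slit.
Variables (R : realType) (n1 n2 : R).
Hypothesis N0 : 0 < n1 ^+ 2 + n2 ^+ 2.

Definition onray (s t : R) := exists2 l, 0 <= l & s = l * n1 /\ t = l * n2.

Let N := `|n1| + `|n2| + 1.
Let n1N : `|n1| <= N. Proof. by rewrite /N; have := normr_ge0 n2; lra. Qed.
Let n2N : `|n2| <= N. Proof. by rewrite /N; have := normr_ge0 n1; lra. Qed.
Let Np : 0 < N. Proof. by rewrite /N; have := normr_ge0 n1; have := normr_ge0 n2; lra. Qed.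

Lemma ray_small d : 0 < d -> exists2 c, 0 < c & forall l, 0 <= l -> l <= c -> `|l * n1| < d /\ `|l * n2| < d.
Proof.
move=> d0; have c0 : 0 < d / 2 / N by rewrite !divr_gt0.
exists (d / 2 / N) => // l l0 lc.
have lN : l * N <= d / 2 by rewrite -ler_pdivlMr.
have dd : d / 2 < d by rewrite ltr_pdivrMr // ltr_pMr // ltr1n.
rewrite !normrM ger0_norm //; split; apply: le_lt_trans dd; apply: le_trans lN; exact: ler_wpM2l.
Qed.

Lemma opposite_offray c : 0 < c -> ~ onray (- c * n1) (- c * n2).
Proof.
move=> c0 [l l0 [E1 E2]]; have : (l + c) * (n1 ^+ 2 + n2 ^+ 2) = 0.
  have -> : (l + c) * (n1 ^+ 2 + n2 ^+ 2) = (l * n1 - - c * n1) * n1 + (l * n2 - - c * n2) * n2 by ring.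
  by rewrite -E1 -E2; ring.
by apply/eqP; rewrite gt_eqF // mulr_gt0 // ltr_wpDl.
Qed.

(** A small shift along (- n2, n1), perpendicular to the ray, leaves it. *)
Lemma offray_approx d l w : `|l * n1| < d -> `|l * n2| < d -> 0 < w -> exists s t,
  [/\ `|s| < d, `|t| < d, ~ onray s t & `|s - l * n1| + `|t - l * n2| <= w].
Proof.
move=> h1 h2 w0; pose X := Num.min (d - `|l * n1|) (d - `|l * n2|).
have [h hp [hN1 hN2]] : exists2 h, 0 < h & h * N <= w /\ h * N <= X / 2.
  have X0 : 0 < X by rewrite lt_min !subr_gt0 h1.
  exists (Num.min (w / N) (X / 2 / N)); first by rewrite lt_min !divr_gt0.
  by rewrite -!ler_pdivlMr // !ge_min !lexx orbT.
have hX : h * N < X by rewrite (le_lt_trans hN2) // ltr_pdivrMr // ltr_pMr ?ltr1n // lt_min !subr_gt0 h1.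
have [x1 x2] : `|h * n1| <= h * N /\ `|h * n2| <= h * N.
  by rewrite !normrM (gtr0_norm hp) !ler_pM2l.
move: hX; rewrite lt_min => /andP[hX1 hX2].
exists (l * n1 - h * n2), (l * n2 + h * n1); split.
- rewrite (le_lt_trans (ler_normB _ _)) //; clear - x2 hX1; lra.
- rewrite (le_lt_trans (ler_normD _ _)) //; clear - x1 hX2; lra.
- move=> [g _ [E1 E2]]; have : h * (n1 ^+ 2 + n2 ^+ 2) = 0.
    have -> : h * (n1 ^+ 2 + n2 ^+ 2) = (l * n2 + h * n1) * n1 - (l * n1 - h * n2) * n2 by ring.
    by rewrite E1 E2; ring.
  by apply/eqP; rewrite gt_eqF // mulr_gt0.
have -> : l * n1 - h * n2 - l * n1 = - (h * n2) by ring.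
have -> : l * n2 + h * n1 - l * n2 = h * n1 by ring.
apply: le_trans hN1; rewrite normrN !normrM (gtr0_norm hp) -mulrDr.
by rewrite ler_wpM2l ?(ltW hp) // /N addrC lerDl ler01.
Qed.

(* The slit square is star shaped with respect to a point opposite to the slit. *)
Lemma slit_rigid (F : R -> R -> 'rV[R]_2) (d : R) : 0 < d ->
  (forall s t, `|s| < d -> `|t| < d -> ~ onray s t -> exists2 M, orthonormal M & rigid_at F s t M) ->
  exists2 M, orthonormal M & forall s t, `|s| < d -> `|t| < d -> ~ onray s t -> F s t = aff M s t.
Proof.
move=> d0 Hrig; have [c c0 small] := ray_small d0.
have [b1 b2] : `|- c * n1| < d /\ `|- c * n2| < d.
  by rewrite !mulNr !normrN; exact: (small c (ltW c0) (lexx _)).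
have boff := opposite_offray c0.
have [M oM rM] := Hrig _ _ b1 b2 boff.
exists M => // s t sd td nr.
pose z (p q w : R) := (1 - w) * p + w * q.
have zB p q w w' : z p q w' - z p q w = (w' - w) * (q - p) by rewrite /z; ring.
(* If the point at time [w] were on the ray, solving for the end point would put that on the ray
   too. *)
have zoff w : 0 <= w -> w <= 1 -> ~ onray (z (- c * n1) s w) (z (- c * n2) t w).
  move=> w0 w1 [l l0 [E1 E2]]; have [ww|wn] := eqVneq w 0.
    by apply: boff; exists l => //; rewrite -E1 -E2 /z ww; split; ring.
  apply: nr; exists ((l + (1 - w) * c) / w).
    by rewrite divr_ge0 // addr_ge0 // mulr_ge0 ?subr_ge0 // ltW.
  have e1 : w * s = (l + (1 - w) * c) * n1 by rewrite mulrDl -E1 /z; ring.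
  have e2 : w * t = (l + (1 - w) * c) * n2 by rewrite mulrDl -E2 /z; ring.
  by split; apply: (mulfI wn); rewrite ?e1 ?e2; field.
have : rigid_at F (z (- c * n1) s 1) (z (- c * n2) t 1) M.
  apply: (locally_constant_unit (rig := fun w M => rigid_at F (z (- c * n1) s w) (z (- c * n2) t w) M)).
  - move=> w w01; have /andP[w0 w1] := w01.
    have [M' _ [d' d'0 Hd']] := Hrig _ _ (ltr_norm_conv b1 sd w01) (ltr_norm_conv b2 td w01) (zoff w w0 w1).
    exists M'; pose L := Num.max 1 (Num.max `|s - - c * n1| `|t - - c * n2|).
    have [L1 Ls Lt] : [/\ 1 <= L, `|s - - c * n1| <= L & `|t - - c * n2| <= L].
      by rewrite /L !le_max !lexx !orbT.
    have L0 : 0 < L by apply: lt_le_trans L1.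
    exists (d' / 2 / L); first by rewrite !divr_gt0.
    move=> w' _; rewrite ltr_pdivlMr // => w'L.
    exists (d' / 2); first exact: divr_gt0.
    move=> s' t' h1 h2; apply: Hd'.
      by apply: normr_sub_lt h1 _; rewrite zB normrM (le_lt_trans _ w'L) // ler_wpM2l.
    by apply: normr_sub_lt h2 _; rewrite zB normrM (le_lt_trans _ w'L) // ler_wpM2l.
  - by move=> w M1 M2 _; exact: rigid_at_inj.
  - by have zz p q : z p q 0 = p; [rewrite /z; ring | rewrite !zz].
have zz p q : z p q 1 = q by rewrite /z; ring.
by rewrite !zz => -[d' d'0 Hd']; apply: Hd'; rewrite subrr normr0.
Qed.

End Slit.

Lemma aff_lip (R : realType) (M : 'rV[R]_2 * 'rV[R]_2 * 'rV[R]_2) (s t s' t' : R) : orthonormal M ->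
  edist (aff M s t) (aff M s' t') <= `|s - s'| + `|t - t'|.
Proof.
move=> oM; rewrite edistE -(@ler_pXn2r _ 2) ?nnegrE ?enorm_ge0 ?addr_ge0 // enorm_sqr aff_dist // [leRHS]sqrrD.
rewrite !real_normK ?num_real // lerD2r lerDl mulrn_wge0 // mulr_ge0.
Qed.

Lemma aff_coord (R : realType) (M : 'rV[R]_2 * 'rV[R]_2 * 'rV[R]_2) (z : 'rV[R]_2) : orthonormal M ->
  exists s t, [/\ z = aff M s t, `|s| <= edist (aff M 0 0) z & `|t| <= edist (aff M 0 0) z].
Proof.
move=> [m1 m2 m3]; have M0 : aff M 0 0 = M.1.1 by rewrite /aff !scale0r !addr0.
exists (dotp M.1.2 (z - aff M 0 0)), (dotp M.2 (z - aff M 0 0)).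
rewrite edistC edistE; split; try exact: dotp_unit_le.
by rewrite /aff scale0r scale0r !addr0 -addrA -(orthonormal_pair m1 m2 m3) subrKC.
Qed.

(** * Leaves of a cut tree *)

Section NoLeaf.
Variables (R : realType) (n : nat) (V : 'I_n -> 'rV[R]_3) (T : set 'rV[R]_3) (f : 'rV[R]_3 -> 'rV[R]_2).
Hypothesis PV : polytope_vertices V.
Local Notation S := (bdry (hull V)).
Hypotheses (TS : T `<=` S) (Tclosed : closed T).
Hypothesis finj : forall x y, (S `\` T) x -> (S `\` T) y -> f x = f y -> x = y.
Hypothesis floc : forall x, (S `\` T) x -> exists2 r : R, 0 < r &
  forall y z, (S `\` T) y -> (S `\` T) z -> edist x y < r -> edist x z < r ->
    segment y z `<=` S -> edist (f y) (f z) = edist y z.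

(** In a chart at [y] the unfolding is a rigid motion, so it covers a disc around [f y]. The factor
    2 comes from the two coordinates in the Lipschitz bound of the chart. *)
Lemma unfolding_open y : (S `\` T) y -> (forall i, y != V i) ->
  exists2 d, 0 < d & forall z e, e < d -> edist (f y) z <= e ->
    exists y', [/\ (S `\` T) y', f y' = z & edist y y' <= 2 * e].
Proof.
move=> [Sy Ty] yV; have [ph [r [[r0 p0 pS _] [_ lip _ rig]]]] := chart_exists PV Tclosed finj floc Sy yV.
have zr : `|0 : R| < r by rewrite normr0.
have [M oM [d d0 Hd]] : exists2 M, orthonormal M & rigid_at (fun s t => f (ph s t)) 0 0 M.
  by apply: rig; rewrite ?p0.
have [e0 e00 He0] := closed_away Tclosed Ty.
have fy : f y = aff M 0 0 by have := Hd 0 0; rewrite p0 subrr normr0; apply.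
exists (Num.min (Num.min d r) (e0 / 2)); first by rewrite !lt_min d0 r0 divr_gt0.
move=> z e; rewrite !lt_min => /andP[/andP[ed er] ee0] fz.
have [s [t [zE]]] := aff_coord z oM; rewrite -fy => /le_trans/(_ fz) se /le_trans/(_ fz) te.
have yy : edist y (ph s t) <= 2 * e.
  by rewrite -p0 (le_trans (lip _ _ _ _)) // !sub0r !normrN; lra.
exists (ph s t); split=> //.
  split; first by apply: pS; [exact: le_lt_trans se er | exact: le_lt_trans te er].
  by apply: He0; rewrite (le_lt_trans yy) //; lra.
by rewrite zE Hd // subr0; [exact: le_lt_trans se ed | exact: le_lt_trans te ed].
Qed.

(* T cannot have an end point x off the vertices: the surface around x, slit along T,
   unfolds rigidly, so the boundary of the unfolding has an end point at the image of x. *)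
Lemma no_leaf x q (e : R) : simple_polygon_region (f @` (S `\` T)) ->
  T x -> (forall i, x != V i) -> x != q -> segment x q `<=` T -> 0 < e ->
  (forall y, T y -> edist x y < e -> segment x q y) -> False.
Proof.
move=> [_ _ _ [m [pq [sq JE]]]] Tx xV xq sT e0 Te.
set U := f @` (S `\` T) in JE.
have [ph [r [[r0 p0 pS ponto] [pZ lip pinj rig]]]] := chart_exists PV Tclosed finj floc (TS Tx) xV.
have [k [k0 k1 kr]] := segment_initial xq r0.
have [n1 [n2 nE]] : exists n1 n2, x + k *: (q - x) = ph n1 n2.
  by apply: ponto => //; apply/TS/sT/segmentP; exists k; rewrite ?(ltW k0).
have rayE l : 0 <= l -> ph (l * n1) (l * n2) = x + (l * k) *: (q - x).
  by move=> l0; rewrite pZ // -nE; row_ring.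
have N0 : 0 < n1 ^+ 2 + n2 ^+ 2.
  rewrite lt_neqAle addr_ge0 ?sqr_ge0 // andbT eq_sym paddr_eq0 ?sqr_ge0 // !sqrf_eq0.
  apply/negP => /andP[/eqP a0 /eqP b0]; move: nE; rewrite a0 b0 p0 => /eqP.
  rewrite -subr_eq0 addrC addKr scaler_eq0 gt_eqF //= subr_eq0 eq_sym.
  exact/negP.
have rayT l : 0 <= l -> l <= 1 -> T (ph (l * n1) (l * n2)).
  move=> l0 l1; rewrite rayE //; apply/sT/segmentP; exists (l * k) => //.
  by rewrite mulr_ge0 ?(ltW k0) //= mulr_ile1 ?(ltW k0).
pose d := Num.min r (e / 2).
have d0 : 0 < d by rewrite lt_min r0 divr_gt0.
have [dr de] : d <= r /\ d + d <= e.
  have : d <= Num.min r (e / 2) by [].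
  by rewrite le_min => /andP[-> ?]; split=> //; lra.
pose offr s t := ~ onray n1 n2 s t.
have offT s t : `|s| < d -> `|t| < d -> offr s t -> ~ T (ph s t).
  move=> sd td nr Tst; apply: nr.
  have /(Te _ Tst)/segmentP[l /andP[l0 _] lE] : edist x (ph s t) < e.
    by rewrite -p0 (le_lt_trans (lip _ _ _ _)) // !sub0r !normrN; lra.
  exists (l / k); first by rewrite divr_ge0 // ltW.
  by apply: pinj; rewrite rayE ?divfK ?gt_eqF // divr_ge0 // ltW.
have offS s t : `|s| < d -> `|t| < d -> offr s t -> (S `\` T) (ph s t).
  by move=> sd td nr; split; [apply: pS; exact: lt_le_trans dr | exact: offT].
have [c c0 small] := ray_small n1 n2 d0.
have [M oM FE] : exists2 M, orthonormal M & forall s t, `|s| < d -> `|t| < d -> offr s t -> f (ph s t) = aff M s t.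
  apply: slit_rigid => // s t sd td nr.
  by apply: rig; [exact: lt_le_trans dr | exact: lt_le_trans dr | exact: offT].
have affd s t s' t' := aff_lip s t s' t' oM.
have approx l (w : R) : 0 <= l -> l < c -> 0 < w -> exists s t,
    [/\ `|s| < d, `|t| < d, offr s t & `|s - l * n1| + `|t - l * n2| <= w].
  by move=> l0 lc w0; have [h1 h2] := small l l0 (ltW lc); exact: offray_approx.
(* An image of a slit point is a limit of images of points off the slit. Were it also [f y] for some
   [y] off [T], points near [y] would share their images with points near the slit, and injectivity
   would make [y] the slit point. [unfolding_open] asks that [y] is no vertex, whence the condition
   on [f (V i)]. *)
have inJ l : 0 <= l -> l < c -> l <= 1 -> (forall i, aff M (l * n1) (l * n2) != f (V i)) ->
    polygon_boundary m pq (aff M (l * n1) (l * n2)).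
  move=> l0 lc l1 nV; rewrite -JE; split.
    move=> B /nbhs_edistP[w w0 Bw]; have [s [t [sd td nr st]]] := approx l (w / 2) l0 lc (divr_gt0 w0 (ltr0n _ 2)).
    exists (aff M s t); split.
      by exists (ph s t); [exact: offS | exact: FE].
    apply: Bw; rewrite edistC (le_lt_trans (affd _ _ _ _)) // (le_lt_trans st) //.
    by rewrite ltr_pdivrMr // ltr_pMr // ltr1n.
  move=> [y Sy fy].
  have yV i : y != V i by apply: contraNneq (nV i) => yE; rewrite -fy yE.
  have [g g0 Hg] := unfolding_open Sy yV.
  case: Sy => Sy Ty; apply: Ty.
  suff -> : y = ph (l * n1) (l * n2) by exact: rayT.
  apply/eqP; rewrite -edist_eq0 -[_ == 0]negbK; apply/negP => ne0.
  have np : 0 < edist y (ph (l * n1) (l * n2)) by rewrite lt_neqAle eq_sym ne0 edist_ge0.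
  pose w := Num.min (g / 2) (edist y (ph (l * n1) (l * n2)) / 4).
  have w0 : 0 < w by rewrite lt_min !divr_gt0.
  have [wg wn] : w < g /\ 3 * w < edist y (ph (l * n1) (l * n2)).
    have : w <= Num.min (g / 2) (edist y (ph (l * n1) (l * n2)) / 4) by [].
    rewrite le_min => /andP[wg wn]; clear - wg wn np g0; split; lra.
  have [s [t [sd td nr st]]] := approx l w l0 lc w0.
  have [|y' [Sy' fy' yy']] := Hg (aff M s t) w wg.
    by rewrite fy edistC (le_trans (affd _ _ _ _)).
  have y'E : y' = ph s t by apply: finj => //; [exact: offS | rewrite fy' FE].
  have y'w : edist y' (ph (l * n1) (l * n2)) <= w by rewrite y'E (le_trans (lip _ _ _ _)).
  have tri := edist_triangle y' y (ph (l * n1) (l * n2)).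
  clear - tri yy' y'w wn; lra.
(* The image of the tip might coincide with that of a vertex, so it is approached along the slit,
   where points close enough avoid the finitely many vertex images; the boundary is closed. *)
have J0 : polygon_boundary m pq (aff M 0 0).
  apply: contrapT => nJ.
  have [g g0 Hg] := closed_away (@closed_polygon_boundary _ m pq) nJ.
  pose dV i := if f (V i) == aff M 0 0 then 1 else edist (aff M 0 0) (f (V i)).
  have dV0 i : 0 < dV i.
    rewrite /dV; case: ifPn => // ne; rewrite lt_neqAle eq_sym edist_eq0 edist_ge0 andbT.
    by rewrite eq_sym.
  have [h h0 hV] := exists_min_pos dV0.
  have gh0 : 0 < Num.min g h / 2 by rewrite divr_gt0 // lt_min g0.
  have [c' c'0 small'] := ray_small n1 n2 gh0.
  pose l := Num.min (Num.min (c / 2) 1) c'.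
  have l0 : 0 < l by rewrite !lt_min divr_gt0 // ltr01.
  have c2 : c / 2 < c by rewrite ltr_pdivrMr // ltr_pMr // ltr1n.
  have lc : l < c by apply: le_lt_trans c2; rewrite !ge_min lexx.
  have l1 : l <= 1 by rewrite !ge_min lexx orbT.
  have [lg lh] : edist (aff M 0 0) (aff M (l * n1) (l * n2)) < g /\
      edist (aff M 0 0) (aff M (l * n1) (l * n2)) < h.
    have lc' : l <= c' by rewrite ge_min lexx orbT.
    have [h1 h2] := small' l (ltW l0) lc'.
    apply/andP; rewrite -lt_min (le_lt_trans (affd _ _ _ _)) // !sub0r !normrN.
    by rewrite [ltRHS]splitr ltrD.
  have lne : aff M (l * n1) (l * n2) != aff M 0 0.
    rewrite -subr_eq0 -dotp_eq0 aff_dist // !subr0.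
    have -> : (l * n1) ^+ 2 + (l * n2) ^+ 2 = l ^+ 2 * (n1 ^+ 2 + n2 ^+ 2) by ring.
    by rewrite gt_eqF // mulr_gt0 // exprn_gt0.
  apply: (Hg (aff M (l * n1) (l * n2))); first exact: lg.
  apply: inJ => //; first exact: ltW.
  move=> i; apply/negP => /eqP E; have := hV i; rewrite /dV -E (negPf lne).
  by move=> hl; have := le_lt_trans hl lh; rewrite ltxx.
(* Near the image of the tip every point off the image ray belongs to the open unfolding, so the
   boundary there lies on that ray. *)
apply: (polygon_no_end sq (v := n1 *: M.1.2 + n2 *: M.2) J0 d0) => z Jz zd.
have M0 : aff M 0 0 = M.1.1 by rewrite /aff !scale0r !addr0.
have [s [t [zE /le_lt_trans/(_ zd) sd /le_lt_trans/(_ zd) td]]] := aff_coord z oM.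
have [[l l0 [sE tE]]|nr] := pselect (onray n1 n2 s t).
  by exists l => //; rewrite zE M0 sE tE /aff; row_ring.
exfalso; move: Jz; rewrite -JE => -[_]; apply.
by exists (ph s t); [exact: offS | rewrite zE; exact: FE].
Qed.

End NoLeaf.

(** * Counting *)

Lemma open_edist_ball (R : realType) (m : nat) (x : 'rV[R]_m) (e : R) : open [set y | edist x y < e].
Proof.
rewrite openE => y /= xy; apply/nbhs_edistP; exists (e - edist x y); first by rewrite subr_gt0.
move=> z yz /=; rewrite (le_lt_trans (edist_triangle y _ _)) //.
by rewrite -ltrBrDl.
Qed.

Lemma closed_polygonal (R : realType) (m : nat) (T : set 'rV[R]_m) : polygonal_set T -> closed T.
Proof.
move=> [k [a [b ->]]].
have -> : [set: 'I_k] = [set` finset.setT : {set 'I_k}].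
  by apply/seteqP; split=> i //= _; rewrite finset.in_setT.
by apply: closed_bigcup => // i _; exact: closed_segment.
Qed.

(** * The number of nodes of a cut tree *)

Section Nodes.
Variables (R : realType) (n : nat) (V : 'I_n -> 'rV[R]_3) (T : set 'rV[R]_3).
Hypotheses (PV : polytope_vertices V) (CT : cut_tree V T).

Variables (N : nat) (p : 'I_N -> 'rV[R]_3).
Hypotheses (skp : skeleton T p) (Vp : forall k, T (V k) -> exists i, V k = p i).

Let adj i j := `[< skel_adj T p i j >].

Lemma adj_sym : symmetric adj.
Proof. by move=> i j; apply/asboolP/asboolP; exact: skel_adjC. Qed.

Lemma adj_irr : irreflexive adj.
Proof. by move=> i; apply/asboolP => -[]; rewrite eqxx. Qed.

Lemma adjP i j : adj i j -> skel_adj T p i j. Proof. by move=> /asboolP. Qed.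

Let nb i := nbrs adj finset.setT i.

Lemma in_nb i j : (j \in nb i) = adj i j.
Proof. by rewrite !inE. Qed.

Let pinj : injective p. Proof. by case: skp. Qed.
Let pT i : T (p i). Proof. by case: skp. Qed.

(** Around a point inside a skeleton edge, [T] is that edge alone, so the point has exactly two
    branch directions. *)
Lemma ct_node_skeleton x : ct_node V T x -> exists i, x = p i.
Proof.
move=> [Tx nx]; apply: contrapT => xp; case: nx; last first.
  by move=> [k xk]; apply: xp; rewrite xk; apply: Vp; rewrite -xk.
apply; have [_ _ cover cross] := skp.
case: (cover x Tx) => // -[i [j [ij sx]]].
have [e e0 star] := skeleton_star x skp.
have xi l : x != p l by apply/negP => /eqP xl; apply: xp; exists l.
have [_ sT _] := ij.
(* If both ends were seen from [x] in one direction, the nearer would lie between [x] and the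
   farther one, while [x] lies between the two. *)
have noturn a b : segment a b x -> x != a -> ~ segment x b a.
  move=> /segmentP[t /andP[t0 t1] tE] xa /segmentP[s /andP[s0 s1] sE].
  have ab0 : (t + s * (1 - t)) *: (b - a) = 0.
    transitivity ((x - a) + s *: (b - x)); first by rewrite tE; row_ring.
    by rewrite {1}sE; row_ring.
  move/eqP: ab0; rewrite scaler_eq0 => /orP[/eqP E|/eqP ab]; last first.
    by case/negP: xa; rewrite tE ab scaler0 addr0.
  have st : 0 <= s * (1 - t) by rewrite mulr_ge0 ?subr_ge0.
  have t00 : t = 0 by lra.
  by case/negP: xa; rewrite tE t00 scale0r addr0.
exists (dir x (p i)), (dir x (p j)); split.
  move=> E; have [le|/ltW le] := leP (edist x (p i)) (edist x (p j)).
    exact: (noturn (p i) (p j) sx (xi i) (dir_eq (xi i) (xi j) E le)).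
  apply: (noturn (p j) (p i) _ (xi j) (dir_eq (xi j) (xi i) (esym E) le)).
  by rewrite segmentC.
rewrite (@branch_dirs_star _ _ [set q | q = p i \/ q = p j] x e) //.
- apply/seteqP; split=> u /=; first by move=> [q [->|->] <-]; [left|right].
  by move=> [->|->]; [exists (p i) => //; left|exists (p j) => //; right].
- move=> q [->|->]; split=> //; apply: subset_trans sT.
    by rewrite segmentC; exact: segment_subl.
  exact: segment_subr.
move=> y Ty xy; case: (star y Ty xy) => [->|[k [l [kl skx sky]]]]; first by left.
have sy : segment (p i) (p j) y.
  case: (cross _ _ _ _ _ kl ij skx sx) => [//|[[<- <-] //|[<- <-]]].
  by rewrite segmentC.
right; case: (segment_split sx sy) => s; last by exists (p j) => //; right.
by exists (p i); [left | rewrite segmentC].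
Qed.

Lemma skeleton_star_node i : exists2 e, 0 < e & forall y, T y -> edist (p i) y < e ->
  y = p i \/ exists2 j, j \in nb i & segment (p i) (p j) y.
Proof.
have [e e0 star] := skeleton_star (p i) skp; exists e => // y Ty iy.
case: (star y Ty iy) => [->|[k [l [kl sk sy]]]]; [by left|right].
have [_ _ H] := kl; case: (H _ sk) => ii.
  by exists l; [rewrite in_nb; apply/asboolP; rewrite ii | rewrite ii].
by exists k; [rewrite in_nb; apply/asboolP; rewrite ii; exact: skel_adjC | rewrite ii segmentC].
Qed.

(** Two neighbours in one direction are impossible: the nearer would be a node inside the edge to
    the farther. *)
Lemma degree2_node i : #|nb i| = 2%N -> has_degree2 T (p i).
Proof.
move=> /eqP /cards2P[j [l [jl nE]]].
have [e e0 star] := skeleton_star_node i.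
have adjn k : k \in nb i -> skel_adj T p i k by rewrite in_nb => /adjP.
have jn : j \in nb i by rewrite nE !inE eqxx.
have ln : l \in nb i by rewrite nE !inE eqxx orbT.
have [ij sj Hj] := adjn _ jn; have [il sl Hl] := adjn _ ln.
exists (dir (p i) (p j)), (dir (p i) (p l)); split.
  have pij : p i != p j by rewrite (inj_eq pinj).
  have pil : p i != p l by rewrite (inj_eq pinj).
  move=> E; case: (leP (edist (p i) (p j)) (edist (p i) (p l))) => [le|/ltW le].
    by case: (Hl _ (dir_eq pij pil E le)) => jj; move: ij jl; rewrite jj eqxx.
  by case: (Hj _ (dir_eq pil pij (esym E) le)) => jj; move: il jl; rewrite jj eqxx.
rewrite (@branch_dirs_star _ _ [set q | exists2 k, k \in nb i & q = p k] (p i) e) //.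
- apply/seteqP; split=> u /=.
    by move=> [q [k kn ->] <-]; move: kn; rewrite nE !inE => /orP[/eqP ->|/eqP ->]; [left|right].
  by move=> [->|->]; [exists (p j) => //; exists j|exists (p l) => //; exists l].
- by move=> q [k /adjn[ik sk _] ->]; rewrite (inj_eq pinj).
move=> y Ty iy; case: (star y Ty iy) => [->|[k kn sk]]; [by left|right].
by exists (p k) => //; exists k.
Qed.

Lemma leaf_vertex i : #|nb i| = 1%N -> exists k, p i = V k.
Proof.
move=> /eqP /cards1P[j nE]; apply: contrapT => nV.
have [TS [polyT _ _ _] [f [finj _ floc reg]]] := CT.
have [e e0 star] := skeleton_star_node i.
have : j \in nb i by rewrite nE inE.
rewrite in_nb => /adjP[ij sj _].
apply: (no_leaf PV TS (closed_polygonal polyT) finj floc reg (pT i) _ _ sj e0).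
- by move=> k; apply/negP => /eqP ik; apply: nV; exists k.
- by rewrite (inj_eq pinj).
move=> y Ty iy; case: (star y Ty iy) => [->|[k]]; first exact: segment_l.
by rewrite nE inE => /eqP ->.
Qed.

(** A node without neighbours is open and closed in the connected [T], hence all of it. *)
Lemma isolated_node i : #|nb i| = 0%N -> (N <= 1)%N.
Proof.
move=> /eqP; rewrite cards_eq0 => /eqP nE.
have [_ [_ _ connT _] _] := CT.
have [e e0 star] := skeleton_star_node i.
have TE : [set p i] = T.
  apply: connT; first by exists (p i).
    exists [set y | edist (p i) y < e]; first exact: open_edist_ball.
    apply/seteqP; split=> y /=.
      by move=> ->; split=> //; rewrite edistxx.
    move=> [Ty iy]; case: (star y Ty iy) => // -[k]; by rewrite nE inE.
  exists [set p i]; first by rewrite -segmentxx; exact: closed_segment.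
  by apply/seteqP; split=> y /= => [->|[]].
have all j : j = i.
  by apply: pinj; have : [set p i] (p j) by rewrite TE.
rewrite -[N]card_ord; apply/card_le1_eqP => j k _ _.
by rewrite (all j) (all k).
Qed.

(** With W the vertices of the polytope among the nodes and B the branch points, degree plus
    membership in W is at least 2 plus membership in B. Summing over the forest gives |B| + 2 <= |W|
    <= n, and every node of the cut tree is in W or B. *)
Lemma card_nodes : (0 < n)%N -> (#|[set i | `[< ct_node V T (p i) >]]%SET| <= 2 * n)%N.
Proof.
move=> n0; have [N1|N1] := leqP N 1.
  by rewrite (leq_trans (max_card _)) // card_ord; lia.
have deg0 i : (0 < #|nb i|)%N.
  by rewrite lt0n; apply/eqP => /isolated_node; rewrite leqNgt N1.
pose W := [set i | `[< exists k, p i = V k >]]%SET.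
pose B := [set i | (2 < #|nb i|)%N]%SET.
have cW : (#|W| <= n)%N.
  have /choice[g gP] : forall i, exists k, i \in W -> p i = V k.
    move=> i; have [|] := boolP (i \in W); last by exists (Ordinal n0).
    by rewrite inE => /asboolP[k ik]; exists k.
  rewrite -[n]card_ord -(card_in_imset (f := g)); first exact: max_card.
  by move=> i j iW jW gg; apply: pinj; rewrite (gP i iW) (gP j jW) gg.
have deg i : (2 + (i \in B) <= #|nb i| + (i \in W))%N.
  rewrite [i \in B]inE; case: (ltngtP 2 #|nb i|) => [d3|d1|d2].
  - by rewrite (leq_trans d3) // leq_addr.
  - have d1' : #|nb i| = 1%N by have := deg0 i; move: d1; case: (#|nb i|) => [|[|]].
    have -> : i \in W by rewrite inE; apply/asboolP; exact: leaf_vertex.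
    by rewrite d1'.
  - by rewrite addn0 -d2 leq_addr.
have [_ [_ _ _ nl] _] := CT.
have acyc := skeleton_acyclic skp adjP nl.
have setT0 : (finset.setT : {set 'I_N}) != finset.set0.
  by apply/set0Pn; exists (Ordinal (ltnW N1)); rewrite inE.
have := forest_degree_sum adj_sym adj_irr acyc setT0.
rewrite cardsT card_ord => sumle.
have sumB (A : {set 'I_N}) : (\sum_(i in finset.setT) (i \in A))%N = #|A|.
  by rewrite big_mkcond -sum1_card [RHS]big_mkcond; apply: eq_bigr => i _; rewrite inE; case: (i \in A).
have : (\sum_(i in finset.setT) (2 + (i \in B)) <= \sum_(i in finset.setT) (#|nb i| + (i \in W)))%N.
  by apply: leq_sum => i _; exact: deg.
rewrite !big_split /= !sumB sum_nat_const cardsT card_ord => le.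
have cB : (#|B| <= n)%N.
  set S := (\sum_(i in _) #|nb i|)%N in le; have sl : (S + 2 <= 2 * N)%N := sumle.
  move: S #|B| #|W| sl le cW => S k l; clear; lia.
have : [set i | `[< ct_node V T (p i) >]]%SET \subset (W :|: B)%SET.
  apply/fintype.subsetP => i; rewrite inE => /asboolP[_ nd]; rewrite finset.in_setU.
  case: nd => [d2|[k ik]]; last by apply/orP; left; rewrite inE; apply/asboolP; exists k.
  have := deg i; rewrite [i \in B]inE; case: (ltnP 2 #|nb i|) => [_ _|le2]; first by rewrite orbT.
  case: (i \in W) => //=; rewrite !addn0 => ge2.
  by case: d2; apply: degree2_node; apply/eqP; rewrite eqn_leq le2.
move=> /subset_leq_card /leq_trans; apply.
by rewrite (leq_trans (leq_card_setU _ _)) // mul2n -addnn leq_add.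
Qed.

End Nodes.

Lemma cut_tree_nodes (R : realType) (n : nat) (V : 'I_n -> 'rV[R]_3) (T : set 'rV[R]_3) :
  (0 < n)%N -> polytope_vertices V -> cut_tree V T ->
  exists (m : nat) (s : 'I_m -> 'rV[R]_3), [/\ (m <= 2 * n)%N, injective s,
    forall i, ct_node V T (s i) & forall x, ct_node V T x -> exists i, s i = x].
Proof.
move=> n0 PV CT; have [_ [polyT _ _ _] _] := CT.
have fW : finite_set (range V `&` T) by apply: sub_finite_set (@subIsetl _ _ _) _; exact: finite_image.
have [N [p [skp Wp]]] := skeleton_exists polyT fW (@subIsetr _ _ _).
have Vp k : T (V k) -> exists i, V k = p i by move=> Tk; apply: Wp; split=> //; exists k.
pose A := [set i | `[< ct_node V T (p i) >]]%SET.
exists #|A|, (fun i => p (enum_val i)); split.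
- exact: (card_nodes PV CT skp).
- by case: skp => pinj _ _ _ i j /pinj /enum_val_inj.
- by move=> i; have := enum_valP i; rewrite inE => /asboolP.
move=> x xn; have [i xi] := ct_node_skeleton skp Vp xn.
have iA : i \in A by rewrite inE; apply/asboolP; rewrite -xi.
by exists (enum_rank_in iA i); rewrite enum_rankK_in.
Qed.

(** * Encoding labeled trees with at most 2n nodes *)

Section Codes.
Variable n : nat.

(** A node count, an adjacency table and a labelling, both padded to size 2n. Several codes may give
    one tree, which is harmless for an upper bound. *)
Definition tree_code := ('I_(2 * n).+1 * {ffun 'I_(2 * n) * 'I_(2 * n) -> bool} *
  {ffun 'I_(2 * n) -> option 'I_n})%type.

Definition code_tree (x : tree_code) : ltree n :=
  let w := widen_ord (ltn_ord x.1.1 : (x.1.1 <= 2 * n)%N) in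
  @LTree n x.1.1 (fun i j => x.1.2 (w i, w j)) (fun i => x.2 (w i)).

(** The exponent 8 is 2 + 4 + 2, for the node count, the adjacency table and the labels. *)
Lemma card_tree_code : (0 < n)%N -> (#|{: tree_code}| <= 2 ^ (8 * (n * n)))%N.
Proof.
move=> n0; rewrite !card_prod !card_ffun card_option card_bool card_prod !card_ord.
have h1 : ((2 * n).+1 <= 2 ^ (2 * (n * n)))%N.
  by apply: leq_trans (ltn_expl (2 * n) (isT : (1 < 2)%N)) _; rewrite leq_exp2l // leq_mul2l leq_pmulr.
have h2 : (n.+1 ^ (2 * n) <= 2 ^ (2 * (n * n)))%N.
  have -> : (2 * (n * n) = n * (2 * n))%N by lia.
  by rewrite [leqRHS]expnM leq_exp2r ?muln_gt0 // ltn_expl.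
have -> : (8 * (n * n) = 2 * (n * n) + 2 * n * (2 * n) + 2 * (n * n))%N by lia.
rewrite (expnD 2 (_ + _)) (expnD 2 _ (2 * n * (2 * n))).
exact: (leq_mul (leq_mul h1 (leqnn _)) h2).
Qed.

Lemma comb_tree_code (R : realType) (V : 'I_n -> 'rV[R]_3) (T : set 'rV[R]_3) :
  (0 < n)%N -> polytope_vertices V -> cut_tree V T ->
  exists x : tree_code, comb_tree_is V T (code_tree x).
Proof.
move=> n0 PV CT; have [Vinj _ _] := PV.
have [m [s [m2 sinj snode nodes]]] := cut_tree_nodes n0 PV CT.
pose w (i : 'I_m) : 'I_(2 * n) := widen_ord m2 i.
have winj : injective w by move=> i j /(congr1 val) /= /val_inj.
pose A := [ffun ab : 'I_(2 * n) * 'I_(2 * n) =>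
  `[< exists i j, [/\ w i = ab.1, w j = ab.2 & ct_adj V T (s i) (s j)] >]].
pose L := [ffun a : 'I_(2 * n) => [pick k | `[< exists i, w i = a /\ s i = V k >]]].
have m2' : (m < (2 * n).+1)%N by [].
exists (Ordinal m2', A, L); exists s => /=.
have wE (i : 'I_m) : widen_ord (ltn_ord (Ordinal m2') : (m <= 2 * n)%N) i = w i by apply: val_inj.
split=> //.
  move=> i j; rewrite !wE ffunE; split=> [ij|/asboolP[i' [j' [/winj -> /winj -> //]]]].
  by apply/asboolP; exists i, j.
move=> i k; rewrite wE ffunE; case: pickP => [l /asboolP[i' [/winj -> sl]]|H].
  by split=> [[<-] //|sk]; congr Some; apply: Vinj; rewrite -sl.
by split=> // sk; have /asboolP[] := H k; exists i.
Qed.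

End Codes.

Theorem theorem12 (R : realType) :
  (exists C N0 : nat, forall n : nat, (N0 <= n)%N ->
     forall V : 'I_n -> 'rV[R]_3, polytope_vertices V ->
     exists (M : nat) (L : 'I_M -> ltree n), (M <= 2 ^ (C * n))%N /\
       forall T : set 'rV[R]_3, edge_cut_tree V T ->
         exists i : 'I_M, comb_tree_is V T (L i))
  /\
  (exists C N0 : nat, forall n : nat, (N0 <= n)%N ->
     forall V : 'I_n -> 'rV[R]_3, polytope_vertices V ->
     exists (M : nat) (L : 'I_M -> ltree n), (M <= 2 ^ (C * (n * n)))%N /\
       forall T : set 'rV[R]_3, cut_tree V T ->
         exists i : 'I_M, comb_tree_is V T (L i)).
Proof.
split.
  exists 10%N, 1%N => n n0 V PV; have [E [cE edgeE]] := polytope_edge_list PV.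
  pose TA (A : {set 'I_n * 'I_n}) : set 'rV[R]_3 := [set x | exists2 e, e \in A & segment (V e.1) (V e.2) x].
  (* Each set of vertex pairs is assigned one tree, with the empty tree as default when its union of
     segments has none. *)
  have /choice[t tP] : forall A, exists t : ltree n,
      (exists t', comb_tree_is V (TA A) t') -> comb_tree_is V (TA A) t.
    move=> A; have [[t tA]|nt] := pselect (exists t', comb_tree_is V (TA A) t'); first by exists t.
    by exists (@LTree n 0 (fun _ _ => False) (fun=> None)).
  exists #|powerset E|, (fun i => t (enum_val i)); split.
    by rewrite card_powerset leq_exp2l.
  move=> T [CT [k [a [b [ab TE]]]]].
  pose A := [set e in E | `[< exists i, segment (a i) (b i) = segment (V e.1) (V e.2) >]]%SET.
  have AE : A \in powerset E by rewrite powersetE; apply/fintype.subsetP => e; rewrite inE => /andP[].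
  have TAE : T = TA A.
    rewrite TE; apply/seteqP; split=> x.
      move=> [i _ si]; have [e eE se] := edgeE _ _ (ab i); exists e; last by rewrite -se.
      by rewrite inE eE; apply/asboolP; exists i.
    by move=> [e]; rewrite inE => /andP[_ /asboolP[i <-]] sx; exists i.
  exists (enum_rank_in AE A); rewrite enum_rankK_in // TAE; apply: tP.
  (* The node bound serves here only to show that [T] has some finite tree, so that the chosen one
     describes it. *)
  have [x xP] := comb_tree_code n0 PV CT.
  by exists (code_tree x); rewrite -TAE.
exists 8%N, 1%N => n n0 V PV.
exists #|{: tree_code n}|, (fun i => code_tree (enum_val i)); split; first exact: card_tree_code.
move=> T CT; have [x xP] := comb_tree_code n0 PV CT.
by exists (enum_rank x); rewrite enum_rankK.
Qed.
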